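(* $\mathcal{T}_{h+1}$-Free Edge Deletion on an $n$-vertex, $m$-edge graph of neighborhood diversity $t$ can be solved in time $\mathcal{O}\left(f(t,h)\cdot(\log n)^2+n+m\right)$, where $f(t,h)=t\cdot\binom{h+t}{t}^{2.5\binom{h+t}{t}+o\left(\binom{h+t}{t}\right)}$.
   Context: $\mathcal{T}_{h+1}$-Free Edge Deletion: given a simple undirected graph $G$ and positive integers $k,h$, decide whether there is $F\subseteq E(G)$ with $|F|\le k$ such that every connected component of $G\setminus F$ has at most $h$ vertices. Two distinct vertices $u,v$ are twins if $N[u]=N[v]$ or $N(u)=N(v)$. $G$ has neighborhood diversity at most $t$ if $V(G)$ can be partitioned into at most $t$ sets such that any two vertices in the same set are twins. *)

(* Defs.v *)
From HB Require Import structures.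
From mathcomp Require Import all_boot all_order all_algebra.
From mathcomp Require Import all_classical all_reals all_analysis.

Set Implicit Arguments.
Unset Strict Implicit.
Unset Printing Implicit Defensive.

Local Open Scope nat_scope.

Record sgraph (T : finType) := SGraph {
  adjacent :> rel T;
  adjacent_sym : symmetric adjacent;
  adjacent_irrefl : irreflexive adjacent }.

Section Graphs.
Variables (T : finType) (G : sgraph T).

Definition edges : {set {set T}} :=
  [set [set x.1; x.2] | x : T * T & G x.1 x.2]%SET.

Definition open_nbh (u : T) : {set T} := [set v | G u v]%SET.
Definition closed_nbh (u : T) : {set T} := (u |: open_nbh u)%SET.

Definition twins (u v : T) : bool :=
  (u != v) &&
  ((closed_nbh u == closed_nbh v) || (open_nbh u == open_nbh v)).

Definition nbh_diversity_le (t : nat) : Prop :=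
  exists P : {set {set T}},
    [/\ finset.partition P [set: T]%SET, #|P| <= t &
        forall A : {set T}, A \in P ->
        forall u v : T, u \in A -> v \in A -> u != v -> twins u v].

Definition delete_edges (F : {set {set T}}) : rel T :=
  fun u v => G u v && ([set u; v]%SET \notin F).

Definition component (e : rel T) (u : T) : {set T} :=
  [set v | connect e u v]%SET.

Definition free_edge_deletion (k h : nat) : bool :=
  [exists F : {set {set T}},
    [&& F \subset edges, #|F| <= k &
        [forall u, #|component (delete_edges F) u| <= h]]].

End Graphs.

(* A word RAM: the registers and the memory cells hold w-bit words, arithmetic
   is modulo 2 ^ w, and every instruction takes one unit of time. In the
   constructors, registers are designated by their index. *)
Inductive instr :=
| Const of nat & nat        (* Const r v   : r := v             *)
| Add of nat & nat & nat    (* Add r a b   : r := a + b         *)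
| Sub of nat & nat & nat    (* Sub r a b   : r := a - b         *)
| Mul of nat & nat & nat    (* Mul r a b   : r := a * b         *)
| Div of nat & nat & nat    (* Div r a b   : r := floor (a / b) *)
| Read of nat & nat         (* Read r a    : r := mem[a]        *)
| Write of nat & nat        (* Write a r   : mem[a] := r        *)
| JumpLt of nat & nat & nat (* JumpLt a b l: if a < b then go to line l *)
| Answer of bool.           (* halt, accepting or rejecting     *)

Definition program := seq instr.

Record config :=
  Config { pc : nat; registers : nat -> nat; memory : nat -> nat }.

Definition upd (f : nat -> nat) (i v : nat) : nat -> nat :=
  fun j => if j == i then v else f j.

Definition exec (w : nat) (i : instr) (c : config) : config :=
  let: Config l r m := c in
  let set_reg a v := Config l.+1 (upd r a (v %% 2 ^ w)) m in
  match i with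
  | Const a v => set_reg a v
  | Add a x y => set_reg a (r x + r y)
  | Sub a x y => set_reg a (r x + (2 ^ w - r y))
  | Mul a x y => set_reg a (r x * r y)
  | Div a x y => set_reg a (r x %/ r y)
  | Read a x => set_reg a (m (r x))
  | Write x a => Config l.+1 r (upd m (r x) (r a))
  | JumpLt x y l' => Config (if r x < r y then l' else l.+1) r m
  | Answer _ => c
  end.

(* [run w P s c = Some b]: from c, the program P answers b after executing at
   most s instructions. Leaving the program text is not an answer. *)
Fixpoint run (w : nat) (P : program) (s : nat) (c : config) : option bool :=
  if s is s'.+1 then
    match onth P (pc c) with
    | None => None
    | Some (Answer b) => Some b
    | Some i => run w P s' (exec w i c)
    end
  else None.

Definition init (x : seq nat) : config := Config 0 (fun _ => 0) (nth 0 x).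

(* The neighbours of each vertex may be listed in any order. *)
Definition adjacency_lists (n : nat) (G : sgraph 'I_n)
    (adj : 'I_n -> seq 'I_n) : Prop :=
  forall u, uniq (adj u) /\ (forall v, (v \in adj u) = G u v).

(* n, k, h, followed for each vertex by its degree and its neighbours. *)
Definition instance (n : nat) (adj : 'I_n -> seq 'I_n) (k h : nat) : seq nat :=
  [:: n; k; h] ++
  flatten [seq size (adj u) :: [seq val v | v <- adj u] | u <- enum 'I_n].

(* Words have at least c * log2 N bits, where N bounds, up to a factor 2, the length
   of the instance and the integers in it. *)
Definition word_size_ok (c w n m k h : nat) : Prop :=
  (n + m + k + h).+2 ^ c <= 2 ^ w.

Local Open Scope ring_scope.

Definition fpt_factor (R : realType) (g : nat -> R) (t h : nat) : R :=
  let p := 'C(h + t, t) in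
  t%:R * p%:R `^ (5 / 2 * p%:R + g p).

(* Main.v *)
(* The type of a component is the vector counting its vertices in each of the t
   twin classes. There are at most p = 'C(h + t, t) types, and the number of edges
   inside a vertex set depends only on its type. Hence a deletion set of size at
   most k exists if and only if there are multiplicities x_q of the types q such
   that the types add up to the class sizes and at least m - k edges are kept.

   If p > n, all n ^ n assignments of vertices to components are tried. Otherwise,
   let D = 2 p h + 2. If D ^ t <= n ^ 48, the multiplicities are determined bit by
   bit, from the least significant one, by a dynamic program whose states are the
   vectors of carries: log n rounds on tables of size D ^ t. If n ^ 48 < D ^ t, an
   exchange argument gives an optimal x with at most 2 t entries above 2 t h, and
   all such x are enumerated; the n ^ (2 t) values of the large entries number less
   than D ^ (t ^ 2 / 24). As t ^ 2 <= 2 p, h t < p and (h + 1) ^ t <= 2 ^ p for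
   h >= 2, each case takes time at most p ^ (5 p / 2) (log n) ^ 2 up to a constant
   factor, even with the term o(p) equal to 0. The cases h = 1 and h >= n are
   immediate. The twin classes are found in time O(n + m) by partition refinement. *)

Require Import Defs.
From HB Require Import structures.
From mathcomp Require Import all_boot all_order all_algebra.
From mathcomp Require Import all_classical all_reals all_analysis.
From mathcomp Require Import zify ring lra.
Import Order.TTheory GRing.Theory Num.Theory.
Import numFieldNormedType.Exports.
Set Implicit Arguments.
Unset Strict Implicit.
Unset Printing Implicit Defensive.
Local Open Scope nat_scope.

(** * A structured language compiled to the word RAM *)

Inductive expr :=
| EK of nat
| EV of nat
| EAdd of expr & expr
| ESub of expr & expr
| EMul of expr & expr
| EDiv of expr & expr
| EAr of nat & expr
| EIn of expr.

Inductive cmd :=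
| Asg of nat & expr
| Sto of nat & expr & expr
| Seq of cmd & cmd
| If of expr & expr & cmd & cmd
| While of expr & expr & cmd.

(* [ck] counts the instructions executed by the compiled code. *)
Record st := St { vr : nat -> nat; ar : nat -> nat -> nat; ck : nat }.

Definition aupd (f : nat -> nat -> nat) (a i v : nat) : nat -> nat -> nat :=
  fun b j => if (b == a) && (j == i) then v else f b j.

Fixpoint ce (e : expr) : nat :=
  match e with
  | EK _ => 1
  | EV _ => 2
  | EAdd e1 e2 | ESub e1 e2 | EMul e1 e2 | EDiv e1 e2 => ce e1 + ce e2 + 1
  | EAr _ e => ce e + 6
  | EIn e => ce e + 1
  end.

Section Semantics.
Variables (inp : nat -> nat) (len M : nat).

Fixpoint ev (s : st) (e : expr) : nat :=
  match e with
  | EK v => v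
  | EV x => vr s x
  | EAdd e1 e2 => ev s e1 + ev s e2
  | ESub e1 e2 => ev s e1 - ev s e2
  | EMul e1 e2 => ev s e1 * ev s e2
  | EDiv e1 e2 => ev s e1 %/ ev s e2
  | EAr a e => ar s a (ev s e)
  | EIn e => inp (ev s e)
  end.

Fixpoint ok (s : st) (e : expr) : Prop :=
  match e with
  | EK v => v < M
  | EV x => True
  | EAdd e1 e2 => [/\ ok s e1, ok s e2 & ev s e1 + ev s e2 < M]
  | ESub e1 e2 => [/\ ok s e1, ok s e2 & ev s e2 <= ev s e1]
  | EMul e1 e2 => [/\ ok s e1, ok s e2 & ev s e1 * ev s e2 < M]
  | EDiv e1 e2 => ok s e1 /\ ok s e2
  | EAr a e => ok s e /\ ev s e < M
  | EIn e => ok s e /\ ev s e < len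
  end.

Definition tick (s : st) (k : nat) : st := St (vr s) (ar s) (ck s + k).
Definition setv (s : st) (x v k : nat) : st :=
  St (upd (vr s) x v) (ar s) (ck s + k).
Definition seta (s : st) (a i v k : nat) : st :=
  St (vr s) (aupd (ar s) a i v) (ck s + k).

Inductive sem : cmd -> st -> st -> Prop :=
| SAsg x e s : ok s e -> sem (Asg x e) s (setv s x (ev s e) (ce e + 2))
| SSto a e1 e2 s : ok s e1 -> ev s e1 < M -> ok s e2 ->
    sem (Sto a e1 e2) s (seta s a (ev s e1) (ev s e2) (ce e1 + ce e2 + 6))
| SSeq c1 c2 s s1 s2 : sem c1 s s1 -> sem c2 s1 s2 -> sem (Seq c1 c2) s s2
| SIfT e1 e2 c1 c2 s s' : ok s e1 -> ok s e2 -> ev s e1 < ev s e2 ->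
    sem c1 (tick s (ce e1 + ce e2 + 1)) s' -> sem (If e1 e2 c1 c2) s s'
| SIfF e1 e2 c1 c2 s s' : ok s e1 -> ok s e2 -> ev s e2 <= ev s e1 ->
    sem c2 (tick s (ce e1 + ce e2 + 1)) s' ->
    sem (If e1 e2 c1 c2) s (tick s' 3)
| SWhT e1 e2 c s s1 s2 : ok s e1 -> ok s e2 -> ev s e1 < ev s e2 ->
    sem c (tick s (ce e1 + ce e2 + 1)) s1 ->
    sem (While e1 e2 c) (tick s1 3) s2 -> sem (While e1 e2 c) s s2
| SWhF e1 e2 c s : ok s e1 -> ok s e2 -> ev s e2 <= ev s e1 ->
    sem (While e1 e2 c) s (tick s (ce e1 + ce e2 + 4)).

Lemma sem_ck c s s' : sem c s s' -> ck s <= ck s'.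
Proof. by elim=> //=; move=> *; lia. Qed.

End Semantics.

Definition nvars := 64.
Definition narrs := 32.
Definition tmp d := nvars.+1 + d.

Definition caddr d a : seq instr :=
  [:: Const (tmp d.+1) narrs; Mul (tmp d) (tmp d) (tmp d.+1);
      Const (tmp d.+1) a; Add (tmp d) (tmp d) (tmp d.+1);
      Add (tmp d) (tmp d) nvars].

Fixpoint cexp d (e : expr) : seq instr :=
  match e with
  | EK v => [:: Const (tmp d) v]
  | EV x => [:: Const (tmp d) 0; Add (tmp d) (tmp d) x]
  | EAdd e1 e2 => cexp d e1 ++ cexp d.+1 e2 ++ [:: Add (tmp d) (tmp d) (tmp d.+1)]
  | ESub e1 e2 => cexp d e1 ++ cexp d.+1 e2 ++ [:: Defs.Sub (tmp d) (tmp d) (tmp d.+1)]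
  | EMul e1 e2 => cexp d e1 ++ cexp d.+1 e2 ++ [:: Mul (tmp d) (tmp d) (tmp d.+1)]
  | EDiv e1 e2 => cexp d e1 ++ cexp d.+1 e2 ++ [:: Div (tmp d) (tmp d) (tmp d.+1)]
  | EAr a e => cexp d e ++ caddr d a ++ [:: Read (tmp d) (tmp d)]
  | EIn e => cexp d e ++ [:: Read (tmp d) (tmp d)]
  end.

Definition cjump l : seq instr :=
  [:: Const (tmp 0) 0; Const (tmp 1) 1; JumpLt (tmp 0) (tmp 1) l].

Fixpoint csz (c : cmd) : nat :=
  match c with
  | Asg x e => ce e + 2
  | Sto a e1 e2 => ce e1 + ce e2 + 6
  | Seq c1 c2 => csz c1 + csz c2
  | If e1 e2 c1 c2 => ce e1 + ce e2 + 1 + csz c2 + 3 + csz c1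
  | While e1 e2 c => ce e1 + ce e2 + 1 + 3 + csz c + 3
  end.

Fixpoint ccmd l (c : cmd) : seq instr :=
  match c with
  | Asg x e => cexp 0 e ++ [:: Const (tmp 1) 0; Add x (tmp 0) (tmp 1)]
  | Sto a e1 e2 =>
      cexp 0 e1 ++ caddr 0 a ++ cexp 1 e2 ++ [:: Write (tmp 0) (tmp 1)]
  | Seq c1 c2 => ccmd l c1 ++ ccmd (l + csz c1) c2
  | If e1 e2 c1 c2 =>
      let l2 := l + (ce e1 + ce e2 + 1) in
      let l1 := l2 + csz c2 + 3 in
      cexp 0 e1 ++ cexp 1 e2 ++ [:: JumpLt (tmp 0) (tmp 1) l1] ++
      ccmd l2 c2 ++ cjump (l1 + csz c1) ++ ccmd l1 c1
  | While e1 e2 c =>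
      let l1 := l + (ce e1 + ce e2 + 1) + 3 in
      cexp 0 e1 ++ cexp 1 e2 ++ [:: JumpLt (tmp 0) (tmp 1) l1] ++
      cjump (l1 + csz c + 3) ++ ccmd l1 c ++ cjump l
  end.

Fixpoint wfe (e : expr) : bool :=
  match e with
  | EK _ => true
  | EV x => x < nvars
  | EAdd e1 e2 | ESub e1 e2 | EMul e1 e2 | EDiv e1 e2 => wfe e1 && wfe e2
  | EAr a e => (a < narrs) && wfe e
  | EIn e => wfe e
  end.

Fixpoint wfc (c : cmd) : bool :=
  match c with
  | Asg x e => (x < nvars) && wfe e
  | Sto a e1 e2 => [&& a < narrs, wfe e1 & wfe e2]
  | Seq c1 c2 => wfc c1 && wfc c2
  | If e1 e2 c1 c2 => [&& wfe e1, wfe e2, wfc c1 & wfc c2]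
  | While e1 e2 c => [&& wfe e1, wfe e2 & wfc c]
  end.

Lemma size_cexp d e : size (cexp d e) = ce e.
Proof.
by elim: e d => //= [e1 I1 e2 I2|e1 I1 e2 I2|e1 I1 e2 I2|e1 I1 e2 I2|a e I|e I] d;
  rewrite !size_cat ?I1 ?I2 ?I /=; lia.
Qed.

Lemma size_ccmd l c : size (ccmd l c) = csz c.
Proof.
elim: c l => /= [x e|a e1 e2|c1 I1 c2 I2|e1 e2 c1 I1 c2 I2|e1 e2 c I] l.
- by rewrite size_cat size_cexp.
- by rewrite size_cat /= size_cat !size_cexp /=; lia.
- by rewrite size_cat I1 I2.
- by rewrite !size_cat /= !size_cat /= !size_cexp I1 I2; lia.
by rewrite !size_cat /= !size_cat /= !size_cexp I; lia.
Qed.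

Section CodeAt.
Variable P : program.

Definition code_at l (is_ : program) :=
  forall i, i < size is_ -> onth P (l + i) = onth is_ i.

Lemma code_atL l p1 p2 : code_at l (p1 ++ p2) -> code_at l p1.
Proof.
move=> H i Hi; rewrite H ?size_cat; last by lia.
by rewrite !onthE map_cat nth_cat size_map Hi.
Qed.

Lemma code_atR l p1 p2 : code_at l (p1 ++ p2) -> code_at (l + size p1) p2.
Proof.
move=> H i Hi; rewrite -addnA H ?size_cat; last by lia.
by rewrite !onthE map_cat nth_cat size_map ltnNge leq_addr /= addKn.
Qed.

Lemma code_at0 l i p : code_at l (i :: p) -> onth P l = Some i.
Proof. by move=> /(_ 0 isT); rewrite addn0. Qed.

Lemma code_atS l i p : code_at l (i :: p) -> code_at l.+1 p.
Proof. by move=> H; rewrite -addn1; apply: (@code_atR l [:: i]). Qed.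

End CodeAt.

Section Compile.
Variables (w : nat) (inp : nat -> nat) (len base M : nat) (P : program).
Hypothesis len_base : len <= base.
Hypothesis M_small : base + (M * narrs + narrs) <= 2 ^ w.
Notation code_at := (code_at P).

Definition steps k c c' := forall f, run w P (k + f) c = run w P f c'.

Lemma steps_trans k1 k2 c1 c2 c3 :
  steps k1 c1 c2 -> steps k2 c2 c3 -> steps (k1 + k2) c1 c3.
Proof. by move=> H1 H2 f; rewrite -addnA H1 H2. Qed.

Lemma steps1 i c : onth P (pc c) = Some i ->
  (if i is Answer _ then false else true) -> steps 1 c (exec w i c).
Proof. by move=> H Hi f; rewrite add1n /= H; case: i Hi {H}. Qed.

Definition matches (s : st) (c : config) :=
  [/\ forall x, x < nvars -> registers c x = vr s x,
      registers c nvars = base,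
      forall r, registers c r < 2 ^ w,
      forall i, memory c i < 2 ^ w &
      (forall i, i < len -> memory c i = inp i) /\
      (forall a i, a < narrs -> memory c (base + (i * narrs + a)) = ar s a i)].

Lemma matches_setreg s l r m x v : nvars < x ->
  matches s (Config l r m) -> matches s (Config l.+1 (upd r x (v %% 2 ^ w)) m).
Proof.
move=> Hx [/= H1 H2 H3 H4 H5]; split=> //= [y Hy||y]; rewrite /upd.
- by rewrite ltn_eqF ?H1 //; lia.
- by rewrite ltn_eqF.
by case: ifP => // _; rewrite ltn_pmod // expn_gt0.
Qed.

Definition isset (i : instr) : option (nat * ((nat -> nat) -> (nat -> nat) -> nat)) :=
  match i with
  | Const a v => Some (a, fun r m => v)
  | Add a x y => Some (a, fun r m => r x + r y)
  | Defs.Sub a x y => Some (a, fun r m => r x + (2 ^ w - r y))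
  | Mul a x y => Some (a, fun r m => r x * r y)
  | Div a x y => Some (a, fun r m => r x %/ r y)
  | Read a x => Some (a, fun r m => m (r x))
  | _ => None
  end.

Lemma step_set i a f c : onth P (pc c) = Some i -> isset i = Some (a, f) ->
  let c' := Config (pc c).+1
     (upd (registers c) a (f (registers c) (memory c) %% 2 ^ w)) (memory c) in
  steps 1 c c'.
Proof.
case: c => l r m; case: i => //= > H [<- <-]; exact: (@steps1 _ (Config l r m) H isT).
Qed.

Lemma step_tmp s i d f v c : onth P (pc c) = Some i ->
  isset i = Some (tmp d, f) -> matches s c ->
  f (registers c) (memory c) %% 2 ^ w = v ->
  exists c', [/\ steps 1 c c', matches s c', pc c' = (pc c).+1,
    registers c' (tmp d) = v &
    forall r, r != tmp d -> registers c' r = registers c r].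
Proof.
move=> Hc Hi Hrel Hv; have /= Hst := step_set Hc Hi.
case: c Hc Hv Hst Hrel => l r m /= Hc Hv Hst Hrel.
eexists; split; first exact: Hst; rewrite ?Hv //=.
- by rewrite -Hv; apply: matches_setreg Hrel; rewrite /tmp; lia.
- by rewrite /upd eqxx.
by move=> x /negPf Hx; rewrite /upd Hx.
Qed.

Lemma M_leW v : v < M -> v < 2 ^ w.
Proof. by move: M_small; rewrite /narrs; lia. Qed.

Lemma addr_ok s d a c l : matches s c -> pc c = l -> code_at l (caddr d a) ->
  a < narrs -> registers c (tmp d) < M ->
  exists c', [/\ steps 5 c c', matches s c', pc c' = l + 5,
    registers c' (tmp d) = base + (registers c (tmp d) * narrs + a) &
    forall d', d' < d -> registers c' (tmp d') = registers c (tmp d')].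
Proof.
move=> R0 pc0 C0 Ha Hv; set v := registers c _ in Hv *; subst l.
have mm : v * narrs + narrs <= M * narrs by rewrite -mulSnr leq_mul2r Hv orbT.
have D1 : tmp d.+1 != tmp d by rewrite /tmp; lia.
have D1' := D1; rewrite eq_sym in D1'.
have Dn : nvars != tmp d by rewrite /tmp; lia.
have Dn' : nvars != tmp d.+1 by rewrite /tmp; lia.
have [|c1 [S1 R1 pc1 V1 F1]] := step_tmp (v := narrs) (code_at0 C0) (erefl _) R0.
  by rewrite /= modn_small //; move: M_small; lia.
move: (code_atS C0); rewrite -pc1 => C1.
have [|c2 [S2 R2 pc2 V2 F2]] := step_tmp (v := v * narrs) (code_at0 C1) (erefl _) R1.
  by rewrite /= V1 F1 // modn_small //; move: M_small; lia.
move: (code_atS C1); rewrite -pc2 => C2.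
have [|c3 [S3 R3 pc3 V3 F3]] := step_tmp (v := a) (code_at0 C2) (erefl _) R2.
  by rewrite /= modn_small //; move: M_small; lia.
move: (code_atS C2); rewrite -pc3 => C3.
have [|c4 [S4 R4 pc4 V4 F4]] := step_tmp (v := v * narrs + a) (code_at0 C3) (erefl _) R3.
  by rewrite /= V3 F3 // V2 modn_small //; move: M_small; lia.
move: (code_atS C3); rewrite -pc4 => C4.
have [|c5 [S5 R5 pc5 V5 F5]] := step_tmp (v := base + (v * narrs + a)) (code_at0 C4) (erefl _) R4.
  rewrite /= V4; case: R4 => _ -> _ _ _; rewrite addnC modn_small //.
  by move: M_small; lia.
exists c5; split=> //; first 1 last.
- by rewrite pc5 pc4 pc3 pc2 pc1; lia.
- by move=> d' Hd; rewrite F5 ?F4 ?F3 ?F2 ?F1 // /tmp; lia.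
exact: (steps_trans S1 (steps_trans S2 (steps_trans S3 (steps_trans S4 S5)))).
Qed.

Lemma jump_ok s c l p l' : matches s c -> pc c = l -> code_at l (cjump l' ++ p) ->
  exists c', [/\ steps 3 c c', matches s c' & pc c' = l'].
Proof.
move=> R0 pc0 C0; subst l.
have [|c1 [S1 R1 pc1 V1 F1]] := step_tmp (v := 0) (code_at0 C0) (erefl _) R0.
  by rewrite /= mod0n.
move: (code_atS C0); rewrite -pc1 => C1.
have [|c2 [S2 R2 pc2 V2 F2]] := step_tmp (v := 1) (code_at0 C1) (erefl _) R1.
  by rewrite /= modn_small //; move: M_small; rewrite /narrs; lia.
move: (code_atS C1); rewrite -pc2 => C2.
have S3 := steps1 (code_at0 C2) isT.
eexists; split; first exact: (steps_trans S1 (steps_trans S2 S3)).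
  by move: R2; case: (c2).
by move: V2 (F2 (tmp 0) isT); rewrite V1; case: (c2) => l2 r2 m2 /= -> ->.
Qed.

Lemma size_caddr d a : size (caddr d a) = 5. Proof. by []. Qed.

Lemma size_cjump l : size (cjump l) = 3. Proof. by []. Qed.

Opaque caddr cjump.

Lemma binop_ok s e1 e2 d c l i v f : matches s c -> pc c = l ->
  code_at l (cexp d e1 ++ cexp d.+1 e2 ++ [:: i]) ->
  isset i = Some (tmp d, f) ->
  (forall r m, r (tmp d) = ev inp s e1 -> r (tmp d.+1) = ev inp s e2 ->
     (forall x, r x < 2 ^ w) -> f r m %% 2 ^ w = v) ->
  (forall d c l, matches s c -> pc c = l -> code_at l (cexp d e1) ->
    exists c', [/\ steps (ce e1) c c', matches s c', pc c' = l + ce e1,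
    registers c' (tmp d) = ev inp s e1 &
    forall d', d' < d -> registers c' (tmp d') = registers c (tmp d')]) ->
  (forall d c l, matches s c -> pc c = l -> code_at l (cexp d e2) ->
    exists c', [/\ steps (ce e2) c c', matches s c', pc c' = l + ce e2,
    registers c' (tmp d) = ev inp s e2 &
    forall d', d' < d -> registers c' (tmp d') = registers c (tmp d')]) ->
  exists c', [/\ steps (ce e1 + ce e2 + 1) c c', matches s c',
    pc c' = l + (ce e1 + ce e2 + 1), registers c' (tmp d) = v &
    forall d', d' < d -> registers c' (tmp d') = registers c (tmp d')].
Proof.
move=> R0 pc0 C0 Hi Hf I1 I2; subst l.
have [c1 [S1 R1 pc1 V1 F1]] := I1 _ _ _ R0 (erefl _) (code_atL C0).
move: (code_atR C0); rewrite size_cexp -pc1 => C1.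
have [c2 [S2 R2 pc2 V2 F2]] := I2 _ _ _ R1 (erefl _) (code_atL C1).
move: (code_atR C1); rewrite size_cexp -pc2 => C2.
have [|c3 [S3 R3 pc3 V3 F3]] := step_tmp (v := v) (code_at0 C2) Hi R2.
  by apply: Hf => //; [rewrite F2|case: R2].
exists c3; split=> //; first exact: (steps_trans (steps_trans S1 S2) S3).
  by rewrite pc3 pc2 pc1; lia.
by move=> d' Hd; rewrite F3 ?F2 ?F1 //; rewrite /tmp; lia.
Qed.

Lemma cexp_ok s e d c l : matches s c -> pc c = l -> code_at l (cexp d e) ->
  wfe e -> ok inp len M s e ->
  exists c', [/\ steps (ce e) c c', matches s c', pc c' = l + ce e,
    registers c' (tmp d) = ev inp s e &
    forall d', d' < d -> registers c' (tmp d') = registers c (tmp d')].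
Proof.
elim: e d c l => [v|x|e1 I1 e2 I2|e1 I1 e2 I2|e1 I1 e2 I2|e1 I1 e2 I2|a e I|e I]
  d c l R0 pc0 /= C0 /=; subst l.
- move=> _ Hv.
  have [|c1 [S1 R1 pc1 V1 F1]] := step_tmp (v := v) (code_at0 C0) (erefl _) R0.
    by rewrite /= modn_small //; apply: M_leW.
  by exists c1; split=> // [|d' Hd]; rewrite ?pc1 ?F1 ?addn1 // /tmp; lia.
- move=> Hx _.
  have [|c1 [S1 R1 pc1 V1 F1]] := step_tmp (v := 0) (code_at0 C0) (erefl _) R0.
    by rewrite /= mod0n.
  move: (code_atS C0); rewrite -pc1 => C1.
  have [|c2 [S2 R2 pc2 V2 F2]] := step_tmp (v := vr s x) (code_at0 C1) (erefl _) R1.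
    by case: R1 => Hr _ Hb _ _; rewrite /= V1 add0n -Hr // modn_small.
  exists c2; split=> // [||d' Hd]; rewrite ?pc2 ?pc1 ?F2 ?F1 ?addn2 // /tmp; try lia.
  exact: (steps_trans S1 S2).
- case/andP=> W1 W2 [ O1 O2 O3].
  apply: (binop_ok R0 (erefl _) C0 (erefl _) _ (fun d c l a b k => I1 d c l a b k W1 O1)
    (fun d c l a b k => I2 d c l a b k W2 O2)).
  by move=> r m /= -> -> _; rewrite modn_small //; apply: M_leW.
- case/andP=> W1 W2 [ O1 O2 O3].
  apply: (binop_ok R0 (erefl _) C0 (erefl _) _ (fun d c l a b k => I1 d c l a b k W1 O1)
    (fun d c l a b k => I2 d c l a b k W2 O2)).
  move=> r m /= E1 E2 Hb; have := Hb (tmp d); have := Hb (tmp d.+1).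
  rewrite E1 E2 => B2 B1; rewrite addnBA ?(ltnW B2) // addnC -addnBA //.
  by rewrite modnDl modn_small //; apply: leq_ltn_trans B1; lia.
- case/andP=> W1 W2 [ O1 O2 O3].
  apply: (binop_ok R0 (erefl _) C0 (erefl _) _ (fun d c l a b k => I1 d c l a b k W1 O1)
    (fun d c l a b k => I2 d c l a b k W2 O2)).
  by move=> r m /= -> -> _; rewrite modn_small //; apply: M_leW.
- case/andP=> W1 W2 [ O1 O2].
  apply: (binop_ok R0 (erefl _) C0 (erefl _) _ (fun d c l a b k => I1 d c l a b k W1 O1)
    (fun d c l a b k => I2 d c l a b k W2 O2)).
  move=> r m /= E1 E2 Hb; have := Hb (tmp d).
  by rewrite E1 E2 => B; rewrite modn_small // (leq_ltn_trans _ B) // leq_div.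
- case/andP=> W1 W2 [ O1 O2].
  have [c1 [S1 R1 pc1 V1 F1]] := I _ _ _ R0 (erefl _) (code_atL C0) W2 O1.
  move: (code_atR C0); rewrite size_cexp -pc1 => C1.
  have [|c2 [S2 R2 pc2 V2 F2]] := addr_ok R1 (erefl _) (code_atL C1) W1.
    by rewrite V1.
  move: (code_atR C1); rewrite size_caddr -pc2 => C2.
  have [|c3 [S3 R3 pc3 V3 F3]] := step_tmp (v := ar s a (ev inp s e)) (code_at0 C2) (erefl _) R2.
    case: R2 => _ _ _ Hb [_ Hm].
    by rewrite /= V2 V1 -Hm // modn_small.
  exists c3; split=> //.
  + by rewrite -[6]/(5 + 1) addnA; exact: (steps_trans (steps_trans S1 S2) S3).
  + by rewrite pc3 pc2 pc1; lia.
  by move=> d' Hd; rewrite F3 ?F2 ?F1 //; rewrite /tmp; lia.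
move=> W1 [ O1 O2].
have [c1 [S1 R1 pc1 V1 F1]] := I _ _ _ R0 (erefl _) (code_atL C0) W1 O1.
move: (code_atR C0); rewrite size_cexp -pc1 => C1.
have [|c3 [S3 R3 pc3 V3 F3]] := step_tmp (v := inp (ev inp s e)) (code_at0 C1) (erefl _) R1.
  by case: R1 => _ _ _ Hb [Hm _]; rewrite /= V1 -Hm // modn_small.
exists c3; split=> //; first exact: (steps_trans S1 S3).
  by rewrite pc3 pc1; lia.
by move=> d' Hd; rewrite F3 ?F1 //; rewrite /tmp; lia.
Qed.

Lemma cond_ok s e1 e2 c l p l' : matches s c -> pc c = l ->
  code_at l (cexp 0 e1 ++ cexp 1 e2 ++ [:: JumpLt (tmp 0) (tmp 1) l'] ++ p) ->
  wfe e1 -> wfe e2 -> ok inp len M s e1 -> ok inp len M s e2 ->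
  exists c', [/\ steps (ce e1 + ce e2 + 1) c c', matches s c' &
    pc c' = if ev inp s e1 < ev inp s e2 then l' else l + (ce e1 + ce e2 + 1)].
Proof.
move=> R0 pc0 C0 W1 W2 O1 O2; subst l.
have [c1 [S1 R1 pc1 V1 F1]] := cexp_ok R0 (erefl _) (code_atL C0) W1 O1.
move: (code_atR C0); rewrite size_cexp -pc1 => C1.
have [c2 [S2 R2 pc2 V2 F2]] := cexp_ok R1 (erefl _) (code_atL C1) W2 O2.
move: (code_atR C1); rewrite size_cexp -pc2 => C2.
have S3 := steps1 (code_at0 C2) isT.
eexists; split; first exact: (steps_trans (steps_trans S1 S2) S3).
  by move: R2; case: (c2).
have : pc c2 = pc c + (ce e1 + ce e2) by rewrite pc2 pc1; lia.
move: V2 (F2 0 isT); rewrite V1; case: (c2) => l2 r2 m2 /= -> -> ->.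
by case: ifP => //; lia.
Qed.

Lemma ccmd_ok cm s s' c l : sem inp len M cm s s' ->
  matches s c -> pc c = l -> code_at l (ccmd l cm) -> wfc cm ->
  exists c', [/\ steps (ck s' - ck s) c c', matches s' c' & pc c' = l + csz cm].
Proof.
move=> H; elim: H c l => {cm s s'}
  [x e s O1|a e1 e2 s O1 O2 O3|c1 c2 s s1 s2 H1 I1 H2 I2
  |e1 e2 c1 c2 s s' O1 O2 O3 H1 I1|e1 e2 c1 c2 s s' O1 O2 O3 H1 I1
  |e1 e2 c1 s s1 s2 O1 O2 O3 H1 I1 H2 I2|e1 e2 c1 s O1 O2 O3]
  c l R0 pc0 /= C0; subst l.
- case/andP=> W1 W2.
  have [c1 [S1 R1 pc1 V1 F1]] := cexp_ok R0 (erefl _) (code_atL C0) W2 O1.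
  move: (code_atR C0); rewrite size_cexp -pc1 => C1.
  have [|c2 [S2 R2 pc2 V2 F2]] := step_tmp (v := 0) (code_at0 C1) (erefl _) R1.
    by rewrite /= mod0n.
  move: (code_atS C1); rewrite -pc2 => C2.
  have S3 := step_set (code_at0 C2) (erefl _).
  eexists; split.
  + by rewrite addKn; exact: (steps_trans S1 (steps_trans S2 S3)).
  + case: R2 V2 (F2 (tmp 0) isT); rewrite V1.
    case: (c2) => l2 r2 m2 /= A1 A2 A3 A4 A5 -> ->; rewrite addn0 modn_small; last first.
      by rewrite -V1; case: R1.
    split=> //= [y Hy||r]; rewrite /upd.
    * by case: eqP => // _; rewrite A1.
    * by rewrite gtn_eqF.
    by case: ifP => // _; rewrite -V1; case: R1.
  by rewrite /= pc2 pc1; lia.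
- case/and3P=> W1 W2 W3.
  have [c1 [S1 R1 pc1 V1 F1]] := cexp_ok R0 (erefl _) (code_atL C0) W2 O1.
  move: (code_atR C0); rewrite size_cexp -pc1 => C1.
  have [|c2 [S2 R2 pc2 V2 F2]] := addr_ok R1 (erefl _) (code_atL C1) W1.
    by rewrite V1.
  move: (code_atR C1); rewrite size_caddr -pc2 => C2.
  have [c3 [S3 R3 pc3 V3 F3]] := cexp_ok R2 (erefl _) (code_atL C2) W3 O3.
  move: (code_atR C2); rewrite size_cexp -pc3 => C3.
  have S4 := steps1 (code_at0 C3) isT.
  eexists; split.
  + rewrite addKn; have -> : ce e1 + ce e2 + 6 = ce e1 + (5 + (ce e2 + 1)) by lia.
    exact: (steps_trans S1 (steps_trans S2 (steps_trans S3 S4))).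
  + case: R3 V3 (F3 0 isT); rewrite V2 V1.
    case: (c3) => l3 r3 m3 /= A1 A2 A3 A4 [A5 A6] E1 E2.
    have vW : ev inp s e2 < 2 ^ w by rewrite -E1.
    split=> //=; rewrite /upd E2 E1; first by move=> i; case: ifP.
    split=> [i Hi|b i Hb].
      by rewrite ltn_eqF ?A5 //; apply: leq_trans (leq_addr _ _); apply: leq_trans len_base.
    rewrite /aupd eqn_add2l.
    case: (eqVneq b a) => [->|ba] /=; first rewrite eqn_add2r eqn_mul2r /=.
      by case: (eqVneq i (ev inp s e1)) => // _; rewrite A6.
    rewrite A6 //; case: eqP => // E; case/eqP: ba.
    by move: (congr1 (modn^~ narrs) E); rewrite !modnMDl !modn_small.
  rewrite /=; have : pc c3 = pc c + (ce e1 + 5 + ce e2) by rewrite pc3 pc2 pc1; lia.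
  by case: (c3) => l3 r3 m3 /= ->; lia.
- case/andP=> W1 W2.
  have [c1' [S1 R1 pc1]] := I1 _ _ R0 (erefl _) (code_atL C0) W1.
  move: (code_atR C0); rewrite size_ccmd -pc1 => C1.
  have [c2' [S2 R2 pc2]] := I2 _ _ R1 (erefl _) C1 W2.
  exists c2'; split=> //; last by rewrite pc2 pc1; lia.
  have -> : ck s2 - ck s = (ck s1 - ck s) + (ck s2 - ck s1).
    by have := sem_ck H1; have := sem_ck H2; lia.
  exact: steps_trans S1 S2.
- case/and4P=> W1 W2 W3 W4.
  have [c1' [S1 R1]] := cond_ok R0 (erefl _) C0 W1 W2 O1 O2.
  rewrite O3 => pc1.
  have C1 := code_atR (code_atR (code_atS (code_atR (code_atR C0)))).
  rewrite [X in code_at X](_ : _ = pc c1') in C1; last first.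
    by rewrite pc1 !size_cexp size_ccmd size_cjump; lia.
  have [|c2' [S2 R2 pc2]] := I1 _ _ R1 (erefl _) _ W3.
    by rewrite pc1 in C1 *.
  exists c2'; split=> //; last by rewrite pc2 pc1; lia.
  have /= := sem_ck H1 => L.
  have -> : ck s' - ck s = (ce e1 + ce e2 + 1) + (ck s' - (ck s + (ce e1 + ce e2 + 1))).
    by lia.
  exact: steps_trans S1 S2.
- case/and4P=> W1 W2 W3 W4.
  have [c1' [S1 R1]] := cond_ok R0 (erefl _) C0 W1 W2 O1 O2.
  rewrite ltnNge O3 /= => pc1.
  have C1 := code_atS (code_atR (code_atR C0)).
  rewrite [X in code_at X](_ : _ = pc c1') in C1; last first.
    by rewrite pc1 !size_cexp; lia.
  have [|c2' [S2 R2 pc2]] := I1 _ _ R1 (erefl _) _ W4.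
    by move: (code_atL C1); rewrite -pc1.
  move: (code_atR C1); rewrite size_ccmd -pc2 => C2.
  have [c3' [S3 R3 pc3]] := jump_ok R2 (erefl _) C2.
  exists c3'; split=> //; last by rewrite pc3; lia.
  have /= := sem_ck H1 => L.
  have -> : ck s' + 3 - ck s = (ce e1 + ce e2 + 1) + (ck s' - (ck s + (ce e1 + ce e2 + 1)) + 3).
    by lia.
  exact: steps_trans S1 (steps_trans S2 S3).
- move=> W0; have /and3P[W1 W2 W3] := W0.
  have [c1' [S1 R1]] := cond_ok R0 (erefl _) C0 W1 W2 O1 O2.
  rewrite O3 => pc1.
  have C1 := code_atR (code_atS (code_atR (code_atR C0))).
  rewrite [X in code_at X](_ : _ = pc c1') in C1; last first.
    by rewrite pc1 !size_cexp size_cjump; lia.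
  have [|c2' [S2 R2 pc2]] := I1 _ _ R1 (erefl _) _ W3.
    by move: (code_atL C1); rewrite -pc1.
  move: (code_atR C1); rewrite size_ccmd -pc2 => C2.
  have [|c3' [S3 R3 pc3]] := @jump_ok s1 c2' _ [::] (pc c) R2 (erefl _).
    by rewrite cats0.
  have [c4' [S4 R4 pc4]] := I2 c3' _ R3 pc3 C0 W0.
  exists c4'; split=> //.
  have /= := sem_ck H1 => L; have /= := sem_ck H2 => L2.
  have -> : ck s2 - ck s = (ce e1 + ce e2 + 1) + (ck s1 - (ck s + (ce e1 + ce e2 + 1)) + (3 + (ck s2 - (ck s1 + 3)))).
    by lia.
  exact: steps_trans S1 (steps_trans S2 (steps_trans S3 S4)).
case/and3P=> W1 W2 W3.
have [c1' [S1 R1]] := cond_ok R0 (erefl _) C0 W1 W2 O1 O2.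
rewrite ltnNge O3 /= => pc1.
have C1 := code_atS (code_atR (code_atR C0)).
rewrite [X in code_at X](_ : _ = pc c1') in C1; last first.
  by rewrite pc1 !size_cexp; lia.
have [c3' [S3 R3 pc3]] := jump_ok R1 (erefl _) C1.
exists c3'; split=> //; last by rewrite pc3; lia.
by rewrite addKn -[4]/(1 + 3) addnA; exact: steps_trans S1 S3.
Qed.
End Compile.

Transparent caddr cjump.

(** * Weakest preconditions *)

Coercion EV : nat >-> expr.
Declare Scope expr_scope.
Delimit Scope expr_scope with X.
Bind Scope expr_scope with expr.
Notation "e1 + e2" := (EAdd e1 e2) : expr_scope.
Notation "e1 - e2" := (ESub e1 e2) : expr_scope.
Notation "e1 * e2" := (EMul e1 e2) : expr_scope.
Notation "e1 / e2" := (EDiv e1 e2) : expr_scope.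
Notation "a ![ e ]" := (EAr a e) : expr_scope.
Notation "x <~ e" := (Asg x e%X) (at level 60).
Notation "a =[ e1 ]= e2" := (Sto a e1%X e2%X)
  (at level 60, e1 at level 60).
Notation "c1 ;; c2" := (Seq c1 c2) (at level 75, right associativity).

Definition Skip := 0 <~ 0.
Definition For x e c := x <~ EK 0;; While x e (c;; x <~ x + EK 1).
Definition IfEq e1 e2 c1 c2 := If e1 e2 c2 (If e2 e1 c2 c1).

Fixpoint mods c : seq nat :=
  match c with
  | Asg x _ => [:: x]
  | Sto _ _ _ => [::]
  | Seq c1 c2 | If _ _ c1 c2 => mods c1 ++ mods c2
  | While _ _ c => mods c
  end.

Fixpoint amods c : seq nat :=
  match c with
  | Asg _ _ => [::]
  | Sto a _ _ => [:: a]
  | Seq c1 c2 | If _ _ c1 c2 => amods c1 ++ amods c2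
  | While _ _ c => amods c
  end.

Definition same (xs aa : seq nat) (s s' : st) :=
  (forall x, x \notin xs -> vr s' x = vr s x) /\
  (forall a i, a \notin aa -> ar s' a i = ar s a i).

Lemma same_refl xs aa s : same xs aa s s.
Proof. by []. Qed.

Lemma same_trans xs aa s1 s2 s3 :
  same xs aa s1 s2 -> same xs aa s2 s3 -> same xs aa s1 s3.
Proof.
by move=> [A1 A2] [B1 B2]; split=> [x Hx|a i Ha]; rewrite ?B1 ?A1 ?B2 ?A2.
Qed.

Lemma same_sub xs aa ys bb s1 s2 : {subset xs <= ys} -> {subset aa <= bb} ->
  same xs aa s1 s2 -> same ys bb s1 s2.
Proof.
move=> H1 H2 [A1 A2]; split=> [x Hx|a i Ha].
  by apply: A1; apply: contra Hx => /H1.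
by apply: A2; apply: contra Ha => /H2.
Qed.

Section Wp.
Variables (inp : nat -> nat) (len M : nat).
Notation ev := (ev inp).
Notation ok := (ok inp len M).
Notation sem := (sem inp len M).

Lemma sem_same c s s' : sem c s s' -> same (mods c) (amods c) s s'.
Proof.
elim=> {c s s'} /= [x e s _|a e1 e2 s _ _ _|c1 c2 s s1 s2 _ I1 _ I2
  |e1 e2 c1 c2 s s' _ _ _ _ I1|e1 e2 c1 c2 s s' _ _ _ _ I1
  |e1 e2 c1 s s1 s2 _ _ _ _ I1 _ I2|e1 e2 c1 s _ _ _].
- by split=> //= y; rewrite inE /upd => /negPf->.
- by split=> //= b i; rewrite inE /aupd => /negPf->.
- by apply: (same_trans (s2 := s1)); [apply: same_sub I1|apply: same_sub I2];
    move=> x; rewrite mem_cat => ->; rewrite ?orbT.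
- by have [A B] := I1; split=> [x|a i]; rewrite mem_cat negb_or => /andP[? ?];
    [exact: A|exact: B].
- by have [A B] := I1; split=> [x|a i]; rewrite mem_cat negb_or => /andP[? ?];
    [exact: A|exact: B].
- exact: (same_trans (s2 := s1)).
exact: same_refl.
Qed.

Lemma ev_tick s k e : ev (tick s k) e = ev s e.
Proof.
by elim: e => //= [e1 -> e2 ->|e1 -> e2 ->|e1 -> e2 ->|e1 -> e2 ->|a e ->|e ->].
Qed.

Lemma ok_tick s k e : ok (tick s k) e = ok s e.
Proof.
elim: e => //= [e1 I1 e2 I2|e1 I1 e2 I2|e1 I1 e2 I2|e1 I1 e2 I2|a e I|e I];
  by rewrite ?ev_tick ?I1 ?I2 ?I.
Qed.

Definition wp c (Q : st -> Prop) s := exists s', sem c s s' /\ Q s'.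

Lemma wp_conseq c (Q R : st -> Prop) s :
  wp c Q s -> (forall s', same (mods c) (amods c) s s' -> Q s' -> R s') ->
  wp c R s.
Proof.
by move=> [s' [H1 H2]] H; exists s'; split=> //; apply: H => //; apply: sem_same.
Qed.

Lemma wp_asg x e Q s : ok s e -> Q (setv s x (ev s e) (ce e + 2)) ->
  wp (Asg x e) Q s.
Proof. by move=> H1 H2; eexists; split; [exact: SAsg|]. Qed.

Lemma wp_sto a e1 e2 Q s : ok s e1 -> ev s e1 < M -> ok s e2 ->
  Q (seta s a (ev s e1) (ev s e2) (ce e1 + ce e2 + 6)) -> wp (Sto a e1 e2) Q s.
Proof. by move=> H1 H2 H3 H4; eexists; split; [exact: SSto|]. Qed.

Lemma wp_seq c1 c2 Q s : wp c1 (wp c2 Q) s -> wp (Seq c1 c2) Q s.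
Proof.
move=> [s1 [H1 [s2 [H2 H3]]]]; exists s2; split=> //.
exact: SSeq H1 H2.
Qed.

Lemma wp_if e1 e2 c1 c2 Q s : ok s e1 -> ok s e2 ->
  (ev s e1 < ev s e2 -> wp c1 Q (tick s (ce e1 + ce e2 + 1))) ->
  (ev s e2 <= ev s e1 ->
     wp c2 (fun s' => Q (tick s' 3)) (tick s (ce e1 + ce e2 + 1))) ->
  wp (If e1 e2 c1 c2) Q s.
Proof.
move=> O1 O2 H1 H2; case: (ltnP (ev s e1) (ev s e2)) => H.
  by have [s' [A B]] := H1 H; exists s'; split=> //; apply: SIfT.
by have [s' [A B]] := H2 H; exists (tick s' 3); split=> //; apply: SIfF.
Qed.

Lemma wp_ifeq e1 e2 c1 c2 Q s : ok s e1 -> ok s e2 ->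
  (ev s e1 = ev s e2 -> wp c1 (fun s' => Q (tick s' 6))
     (tick s (2 * (ce e1 + ce e2 + 1)))) ->
  (ev s e1 <> ev s e2 -> forall k, k <= 2 * (ce e1 + ce e2 + 1) ->
     wp c2 (fun s' => forall j, j <= 3 -> Q (tick s' j)) (tick s k)) ->
  wp (IfEq e1 e2 c1 c2) Q s.
Proof.
move=> O1 O2 H1 H2.
have tick0 s' : tick s' 0 = s' by case: s' => f g k; rewrite /tick addn0.
have tickD s' a b : tick (tick s' a) b = tick s' (a + b) by rewrite /tick /= addnA.
apply: wp_if => // H3.
  have [||s' [A B]] := H2 _ (ce e1 + ce e2 + 1); try lia.
  by exists s'; split=> //; rewrite -(tick0 s'); apply: B.
apply: wp_if; rewrite ?ok_tick ?ev_tick // => H4.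
  rewrite tickD; have [||s' [A B]] := H2 _ (ce e1 + ce e2 + 1 + (ce e2 + ce e1 + 1)); try by move: H4 => /=; lia.
  by exists s'; split=> //; apply: B.
rewrite tickD; have -> : ce e1 + ce e2 + 1 + (ce e2 + ce e1 + 1) = 2 * (ce e1 + ce e2 + 1) by lia.
have E : ev s e1 = ev s e2 by move: H3 H4 => /=; lia.
have [s' [A B]] := H1 E; exists s'; split=> //.
by rewrite tickD.
Qed.

Lemma wp_while e1 e2 c (I : nat -> st -> Prop) N (T : nat -> nat) Q s :
  I 0 s ->
  (forall i s1, i <= N -> same (mods c) (amods c) s s1 -> I i s1 ->
    [/\ ok s1 e1, ok s1 e2 & (ev s1 e1 < ev s1 e2) = (i < N)]) ->
  (forall i s1, i < N -> same (mods c) (amods c) s s1 -> I i s1 ->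
    wp c (fun s2 => I i.+1 (tick s2 3) /\ ck s2 <= ck s1 + T i)
      (tick s1 (ce e1 + ce e2 + 1))) ->
  (forall s1, same (mods c) (amods c) s s1 -> I N s1 ->
     ck s1 <= ck s + \sum_(i < N) (T i + 3) ->
     Q (tick s1 (ce e1 + ce e2 + 4))) ->
  wp (While e1 e2 c) Q s.
Proof.
move=> H0 Hg Hb HQ.
suff H j i s1 : j + i = N -> same (mods c) (amods c) s s1 -> I i s1 ->
    ck s1 <= ck s + \sum_(i0 < i) (T i0 + 3) -> wp (While e1 e2 c) Q s1.
  by apply: (H N 0); rewrite ?addn0 ?leq_addr //; apply: same_refl.
elim: j i s1 => [|j IH] i s1 Hj Hs HI Hc.
  have [|O1 O2] := Hg i s1 _ Hs HI; first by lia.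
  have EiN : i = N by lia.
  rewrite EiN ltnn => /negbT; rewrite -leqNgt => H.
  eexists; split; first exact: SWhF.
  by subst i; apply: HQ.
have [|O1 O2] := Hg i s1 _ Hs HI; first by lia.
have iN : i < N by lia.
rewrite iN => H.
have [s2 [H1 [H2 H3]]] := Hb i s1 iN Hs HI.
have Hs2 : same (mods c) (amods c) s (tick s2 3).
  exact: same_trans Hs (sem_same H1).
have [||s3 [H4 H5]] := IH i.+1 (tick s2 3) _ Hs2 H2; first by lia.
  rewrite big_ord_recr /=; set S := \sum_(_ < i) _.
  by move: Hc H3; rewrite -/S; lia.
by exists s3; split=> //; exact: SWhT H4.
Qed.

Lemma wp_for x e c N (I : nat -> (nat -> nat) -> (nat -> nat -> nat) -> Prop)
    (T : nat -> nat) Q s :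
  x \notin mods c -> N < M -> 1 < M ->
  (forall s1, same (x :: mods c) (amods c) s s1 -> ok s1 e /\ ev s1 e = N) ->
  I 0 (upd (vr s) x 0) (ar s) ->
  (forall i s1, i < N -> same (x :: mods c) (amods c) s s1 -> vr s1 x = i ->
    I i (vr s1) (ar s1) ->
    wp c (fun s2 => I i.+1 (upd (vr s2) x i.+1) (ar s2) /\
      ck s2 <= ck s1 + T i) s1) ->
  (forall s1, same (x :: mods c) (amods c) s s1 -> vr s1 x = N ->
    I N (vr s1) (ar s1) ->
    ck s1 <= ck s + \sum_(i < N) (T i + (ce e + 12)) + (ce e + 10) ->
    Q s1) ->
  wp (For x e c) Q s.
Proof.
move=> Hx HN M1 He H0 Hb HQ.
apply: wp_seq; apply: wp_asg => /=; first by lia.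
have HS s1 : same (mods c ++ [:: x]) (amods c ++ [::]) (setv s x 0 (1 + 2)) s1 ->
    same (x :: mods c) (amods c) s s1.
  move=> [A B]; split=> [y|a i Ha]; last by rewrite B // cats0.
  rewrite inE negb_or => /andP[yx yc]; rewrite A /= /upd ?(negPf yx) //.
  by rewrite mem_cat negb_or yc inE.
apply: (wp_while (I := fun i s1 => vr s1 x = i /\ I i (vr s1) (ar s1)) (N := N)
   (T := fun i => T i + (ce e + 9))) => /=.
- by rewrite /upd eqxx; split.
- move=> i s1 Hi /HS Hs [A B]; have [C D] := He s1 Hs.
  by rewrite D A.
- move=> i s1 Hi /HS Hs [A B]; apply: wp_seq.
  apply: (wp_conseq (Hb i _ Hi _ _ _)) => //=.
  move=> s2 [Hs2 _] [B2 C2]; have x2 : vr s2 x = i by rewrite Hs2.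
  apply: wp_asg => /=; first by split=> //; lia.
  rewrite x2 addn1 /upd eqxx; split; first by split.
  by lia.
- move=> s1 /HS Hs [A B] C; apply: HQ => //=.
  have E : \sum_(i < N) (T i + (ce e + 9) + 3) = \sum_(i < N) (T i + (ce e + 12)).
    by apply: eq_bigr => i _; lia.
  by move: C; rewrite E /=; lia.
Qed.

End Wp.

(** * Partition refinement *)

Notation vN := 1 (only parsing).
Notation vK := 2 (only parsing).
Notation vH := 3 (only parsing).
Notation vAns := 4 (only parsing).
Notation vM2 := 5 (only parsing).
Notation vT := 6 (only parsing).
Notation vP := 7 (only parsing).
Notation vFresh := 8 (only parsing).
Notation vU := 9 (only parsing).
Notation vJ := 10 (only parsing).
Notation vV := 11 (only parsing).
Notation vC := 12 (only parsing).
Notation vX := 13 (only parsing).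

Notation aPOS := 1 (only parsing).
Notation aDEG := 2 (only parsing).

Ltac simp := rewrite /= /upd /aupd /=;
  repeat match goal with H : vr ?s ?x = _ |- context [vr ?s ?x] => rewrite H end;
  rewrite ?eqxx /=.

Ltac okt := simp; repeat match goal with
  | |- and3 _ _ _ => split
  | |- _ /\ _ => split
  end; simp; try assumption; try lia.

Ltac wps := repeat (apply: wp_seq);
  first [ apply: wp_asg; [okt | simp] | apply: wp_sto; [okt | okt | okt | simp] ].

Definition block1 :=
  vM2 <~ EK 0;; vX <~ EK 3;;
  For vU vN (aPOS =[vU]= vX + EK 1;; aDEG =[vU]= EIn vX;;
     vM2 <~ vM2 + aDEG![vU];; vX <~ vX + aDEG![vU] + EK 1).

Section Block1.
Variables (inp : nat -> nat) (len M n : nat) (nb : nat -> seq nat).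
Notation wp := (wp inp len M).

Definition pos u := 3 + \sum_(i < u) (size (nb i)).+1.
Hypothesis inp_deg : forall u, u < n -> inp (pos u) = size (nb u).
Hypothesis inp_nb : forall u j, u < n -> j < size (nb u) ->
  inp (pos u + 1 + j) = nth 0 (nb u) j.
Hypothesis len_pos : len = pos n.
Hypothesis M_len : len + n + 10 < M.

Lemma pos_le u v : u <= v -> pos u <= pos v.
Proof.
rewrite /pos leq_add2l => uv; rewrite (big_ord_widen v (fun i => (size (nb i)).+1)) //.
by rewrite [leqRHS](bigID (fun i : 'I_v => i < u)) leq_addr.
Qed.

Lemma pos_sum u : pos u = 3 + u + \sum_(i < u) size (nb i).
Proof.
by rewrite /pos -addnA; under eq_bigr do rewrite -add1n; rewrite big_split /= sum1_card card_ord.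
Qed.

Lemma block1_ok s : vr s vN = n ->
  wp block1 (fun s1 => [/\ vr s1 vM2 = \sum_(u < n) size (nb u),
      forall u, u < n -> ar s1 aPOS u = pos u + 1 /\ ar s1 aDEG u = size (nb u)
    & ck s1 <= ck s + 100 * n + 100]) s.
Proof.
move=> Hn; rewrite /block1.
wps; wps.
apply: (wp_for (N := n) (I := fun i f g => [/\ f vX = pos i,
    f vM2 = \sum_(u < i) size (nb u) &
    forall u, u < i -> g aPOS u = pos u + 1 /\ g aDEG u = size (nb u)])
  (T := fun _ => 80)) => //=; try lia.
- by move=> s1 [A _]; rewrite A.
- by rewrite /upd /= big_ord0 /pos big_ord0.
- move=> i s1 Hi Hs Hu [H1 H2 H3].
  have L := @pos_le i.+1 n Hi; rewrite -len_pos in L.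
  have E : pos i.+1 = pos i + (size (nb i)).+1.
    by rewrite /pos big_ord_recr /= addnA.
  have S1 := pos_sum i; rewrite -H2 in S1.
  wps; wps; rewrite ?inp_deg //; wps; wps.
  split; last by lia.
  rewrite E big_ord_recr /=; split=> //; first by lia.
  move=> u; rewrite ltnS; case: (eqVneq u i) => [->|ui] ? //; apply: H3; lia.
move=> s1 _ _ [H1 H2 H3]; rewrite sum_nat_const card_ord => H4; split=> //; lia.
Qed.
End Block1.

(* Round [u] splits every block [vC] met by the (closed, if [b]) neighbourhood of
   [u]; the mark [aS![vC] = u + 1] says that [aN![vC]] is already the new block of
   this round. *)
Definition refine b aC aS aN :=
  vFresh <~ EK 1;;
  For vU vN (
    For vJ (aDEG![vU] + EK b) (
      If vJ aDEG![vU] (vV <~ EIn (aPOS![vU] + vJ)) (vV <~ vU);;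
      vC <~ aC![vV];;
      If aS![vC] (vU + EK 1)
        (aS =[vC]= vU + EK 1;; aN =[vC]= vFresh;; vFresh <~ vFresh + EK 1)
        Skip;;
      aC =[vV]= aN![vC])).

Section Refine.
Variables (inp : nat -> nat) (len M n : nat) (nb : nat -> seq nat).
Notation wp := (wp inp len M).
Notation pos := (pos nb).
Hypothesis inp_nb : forall u j, u < n -> j < size (nb u) ->
  inp (pos u + 1 + j) = nth 0 (nb u) j.
Hypothesis len_pos : len = pos n.
Hypothesis M_len : len + n + 10 < M.
Hypothesis nb_lt : forall u v, u < n -> v \in nb u -> v < n.
Hypothesis nb_uniq : forall u, u < n -> uniq (nb u).
Hypothesis nb_irr : forall u, u < n -> u \notin nb u.

Variables (b : bool) (aC aS aN : nat).
Hypothesis aCS : (aC == aS) = false.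
Hypothesis aSC : (aS == aC) = false.
Hypothesis aCN : (aC == aN) = false.
Hypothesis aNC : (aN == aC) = false.
Hypothesis aNS : (aN == aS) = false.
Hypothesis aSN : (aS == aN) = false.
Hypothesis Ha : all (fun a => 2 < a) [:: aC; aS; aN].

Definition nbl u := nb u ++ nseq b u.

Lemma nbl_lt u v : u < n -> v \in nbl u -> v < n.
Proof.
move=> un; rewrite mem_cat => /orP[/(nb_lt un)//|].
by rewrite mem_nseq => /andP[_ /eqP->].
Qed.

Lemma nbl_uniq u : u < n -> uniq (nbl u).
Proof.
move=> un; rewrite cat_uniq nb_uniq //=; case: b => //=.
by rewrite orbF nb_irr.
Qed.

Lemma size_nbl u : size (nbl u) = size (nb u) + b.
Proof. by rewrite size_cat size_nseq. Qed.

Lemma nth_nbl u j : j < size (nbl u) ->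
  nth 0 (nbl u) j = if j < size (nb u) then nth 0 (nb u) j else u.
Proof.
rewrite size_nbl nth_cat; case: ifP => // H; case: b => /=; last by lia.
by move=> H1; have -> : j - size (nb u) = 0 by lia.
Qed.

Lemma pos_lt u j : u < n -> j < size (nb u) -> pos u + 1 + j < len.
Proof.
move=> un Hj; rewrite len_pos; have := pos_le nb un.
by rewrite /pos big_ord_recr /=; lia.
Qed.

Definition total i := \sum_(u < i) size (nbl u).

Lemma totalS i : total i.+1 = total i + (size (nb i) + b).
Proof. by rewrite /total big_ord_recr /= size_nbl. Qed.

Definition inner_inv u (s1 : st) j (f : nat -> nat) (g : nat -> nat -> nat) :=
  [/\ forall v, v < n -> v \notin take j (nbl u) -> g aC v = ar s1 aC v,
      forall v, v \in take j (nbl u) ->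
        g aS (ar s1 aC v) = u.+1 /\ g aC v = g aN (ar s1 aC v),
      (forall c, g aS c <= u.+1) /\
      (forall c, g aS c = u.+1 -> vr s1 vFresh <= g aN c < f vFresh),
      forall c c', g aS c = u.+1 -> g aS c' = u.+1 -> g aN c = g aN c' -> c = c'
    & vr s1 vFresh <= f vFresh <= vr s1 vFresh + j].

Definition outer_inv i (f : nat -> nat) (g : nat -> nat -> nat) :=
  [/\ forall v v', v < n -> v' < n -> (g aC v = g aC v') <->
        (forall u, u < i -> (v \in nbl u) = (v' \in nbl u)),
      forall v, v < n -> g aC v < f vFresh,
      forall c, g aS c <= i
    & 1 <= f vFresh <= 1 + total i].

Lemma sum_nbl i : i <= n -> total i <= len.
Proof.
rewrite /total => Hi; have := pos_le nb Hi; rewrite -len_pos; apply: leq_trans.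
rewrite pos_sum; under eq_bigr do rewrite size_nbl.
rewrite big_split /= sum_nat_const card_ord.
by have : i * b <= i; [case: (b); rewrite ?muln1 ?muln0|]; lia.
Qed.

Lemma refine_ok s : vr s vN = n ->
  (forall u, u < n -> ar s aPOS u = pos u + 1 /\ ar s aDEG u = size (nb u)) ->
  (forall a i, a \in [:: aC; aS; aN] -> ar s a i = 0) ->
  wp (refine b aC aS aN) (fun s1 =>
    [/\ forall v v', v < n -> v' < n -> (ar s1 aC v = ar s1 aC v') <->
        (forall u, u < n -> (v \in nbl u) = (v' \in nbl u)),
      forall v, v < n -> ar s1 aC v <= len
    & ck s1 <= ck s + 300 * len + 300]) s.
Proof.
move=> Hn Hpd Hz; rewrite /refine.
have [a1C a1S a1N] : [/\ 1 != aC, 1 != aS & 1 != aN].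
  by case/and4P: Ha => *; split; lia.
have [a2C a2S a2N] : [/\ 2 != aC, 2 != aS & 2 != aN].
  by case/and4P: Ha => *; split; lia.
have bb : b <= 1 by case: b.
wps.
apply: (wp_for (N := n) (I := outer_inv)
  (T := fun i => 160 * size (nbl i) + 60)) => //=; try lia.
- by move=> s1 [A _]; rewrite A.
- split=> [v v' Hv Hv'|v Hv|c|].
  + by rewrite !Hz ?inE ?eqxx.
  + by rewrite Hz ?inE ?eqxx.
  + by rewrite Hz ?inE ?eqxx ?orbT.
  by rewrite /upd /= /total big_ord0.
- move=> i s1 Hi [_ Hs] Hu [H1 H2 H3 H4].
  have Hs' u : u < n -> ar s1 aPOS u = pos u + 1 /\ ar s1 aDEG u = size (nb u).
    by move=> un; have [<- <-] := Hpd u un; rewrite !Hs //= !inE !negb_or ?a1C ?a1S ?a1N ?a2C ?a2S ?a2N.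
  have [P1 P2] := Hs' i Hi.
  have SL := @sum_nbl i.+1 Hi; rewrite totalS in SL.
  apply: (wp_for (N := size (nbl i)) (I := inner_inv i s1) (T := fun _ => 130)) => //=.
  + by rewrite size_nbl; lia.
  + by lia.
  + move=> s2 [A B]; rewrite A //= Hu B; last by rewrite !inE !negb_or a2C a2S a2N.
    rewrite P2 size_nbl; split=> //; do ?split; lia.
  + split; rewrite ?take0 //.
    * split=> c; first by have := H3 c; lia.
      by have := H3 c; lia.
    * by move=> c c'; have := H3 c; lia.
    * by rewrite /upd /= addn0 !leqnn.
  + move=> j s2 Hj [A B] Hj2 [I1 I2 [I3 I3'] I4 I5].
    have Hu2 : vr s2 9 = i by rewrite A.
    have [Q1 Q2] : ar s2 1 i = pos i + 1 /\ ar s2 2 i = size (nb i).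
      by rewrite !B ?P1 ?P2 // !inE !negb_or ?a1C ?a1S ?a1N ?a2C ?a2S ?a2N.
    set v := nth 0 (nbl i) j.
    have vin : v \in nbl i by apply: mem_nth.
    have vn : v < n by apply: nbl_lt vin.
    have vnot : v \notin take j (nbl i).
      by rewrite in_take_leq ?(ltnW Hj) // index_uniq ?ltnn ?nbl_uniq.
    apply: wp_seq.
    apply: (wp_conseq (Q := fun s3 => vr s3 vV = v /\ ck s3 <= ck s2 + 40)) => /=.
      apply: wp_if; try by okt.
        simp; rewrite Q2 => Hlt; have PL := pos_lt Hi Hlt; wps.
        by rewrite Q1 inp_nb // /v nth_nbl // Hlt; split=> //; lia.
      simp; rewrite Q2 => Hge; wps.
      by rewrite /v nth_nbl // ltnNge Hge; split=> //; lia.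
    move=> s3 [A3 B3] [V3 C3].
    have U3 : vr s3 9 = i by rewrite A3.
    have E3 a l : ar s3 a l = ar s2 a l by apply: B3.
    set c := ar s1 aC v.
    have Ec : ar s2 aC v = c by rewrite I1.
    have cF : c < vr s1 vFresh by apply: H2.
    have F3 : vr s3 vFresh = vr s2 vFresh by rewrite A3.
    have SN : size (nbl i) = size (nb i) + b := size_nbl i.
    wps.
    have Tj : take j.+1 (nbl i) = rcons (take j (nbl i)) v by rewrite (take_nth 0).
    have arv w0 : w0 < n -> w0 \in take j.+1 (nbl i) ->
        w0 = v \/ (w0 \notin [:: v] /\ w0 \in take j (nbl i)).
      move=> _; rewrite Tj mem_rcons !inE; case: eqP => [->|_] /= ?; first by left.
      by right.
    have cM : c < M.
      apply: leq_trans cF _; case/andP: H4 => _.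
      have := @sum_nbl i (ltnW Hi); lia.
    have S3 : vr s1 8 + j < M.
      have := @sum_nbl i.+1 Hi; rewrite totalS; lia.
    rewrite E3 Ec; apply: wp_seq.
    apply: wp_if; try okt; rewrite ?aCS ?aCN ?aNS ?aSC ?aNC ?aSN /=.
    * simp; rewrite E3 => Hlt; do 4 wps; rewrite ?aCS ?aCN ?aNS ?aSC ?aNC ?aSN /=.
      split; last by lia.
      have nc c' : ar s2 aS c' = i.+1 -> (c' == c) = false.
        by move=> H; apply/eqP => E; move: Hlt; rewrite -E H; lia.
      split.
      -- move=> w0 w0n; rewrite Tj mem_rcons inE negb_or => /andP[/negPf wv wj].
         by rewrite eqxx wv /= aCN aCS /= E3 I1.
      -- move=> w0; rewrite Tj mem_rcons inE => /orP[/eqP->|wj].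
           by rewrite -/c aSC aSN aNC !eqxx /= addn1.
         have wv : (w0 == v) = false by apply: contraNF vnot => /eqP<-.
         have [J1 J2] := I2 _ wj; have nw := nc _ J1.
         by rewrite aSC aSN aNC aCN aCS aNS !eqxx /= wv nw !E3.
      -- rewrite aSC aSN aNC aNS !eqxx /=; split=> c'.
           by case: eqP => [_|_]; [lia|rewrite E3].
         by case: eqP => [_ _|_]; [lia|rewrite !E3 => /I3'; lia].
      -- move=> c1 c2; rewrite aSC aSN aNC aNS !eqxx /=.
         case: (eqVneq c1 c) => [->|c1c]; case: (eqVneq c2 c) => [->//|c2c];
           rewrite ?E3.
         ++ by move=> _ /I3' H E; lia.
         ++ by move=> /I3' H _ E; lia.
         exact: I4.
      rewrite /=; lia.
    * simp; rewrite E3 => Hge.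
      have Sc : ar s2 aS c = i.+1 by have := I3 c; lia.
      wps; wps; split; last by lia.
      split.
      -- move=> w0 w0n; rewrite Tj mem_rcons inE negb_or => /andP[/negPf wv wj].
         by rewrite eqxx wv /= E3 I1.
      -- move=> w0; rewrite Tj mem_rcons inE => /orP[/eqP->|wj].
           by rewrite -/c aSC aNC !eqxx /= !E3.
         have wv : (w0 == v) = false by apply: contraNF vnot => /eqP<-.
         by have [J1 J2] := I2 _ wj; rewrite aSC aNC eqxx wv /= !E3.
      -- rewrite aSC aNC /= ; split=> c'; rewrite !E3 // F3; exact: I3'.
      -- by move=> c1 c2; rewrite aSC aNC /= !E3; apply: I4.
      by rewrite /= F3; lia.
  + move=> s2 _ _; rewrite /inner_inv take_size => -[I1 I2 [I3 I3'] I4 I5].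
    rewrite sum_nat_const card_ord => Hck; split; last by rewrite /=; lia.
    have IN v : v < n -> v \in nbl i -> vr s1 8 <= ar s2 aC v < vr s2 8.
      by move=> vn /I2[J1 ->]; apply: I3'.
    have OUT v : v < n -> v \notin nbl i -> ar s2 aC v < vr s1 8.
      by move=> vn vi; rewrite I1 // H2.
    split.
    * move=> v v' vn v'n.
      have RHS : (forall u, u < i.+1 -> (v \in nbl u) = (v' \in nbl u)) <->
          (ar s1 aC v = ar s1 aC v' /\ (v \in nbl i) = (v' \in nbl i)).
        rewrite H1 //; split=> [H|[A B] u]; first by split=> [u ui|]; apply: H; lia.
        by rewrite ltnS leq_eqVlt => /orP[/eqP->|/A].
      rewrite RHS.
      case: (boolP (v \in nbl i)) => vi; case: (boolP (v' \in nbl i)) => v'i.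
      -- have [J1 ->] := I2 _ vi; have [K1 ->] := I2 _ v'i.
         by split=> [H|[-> //]]; split=> //; apply: I4 H.
      -- by have := IN _ vn vi; have := OUT _ v'n v'i; split=> [|[]//]; lia.
      -- by have := IN _ v'n v'i; have := OUT _ vn vi; split=> [|[]//]; lia.
      by rewrite !I1 //; split=> [|[]].
    * move=> v vn; rewrite /upd /=; case: (boolP (v \in nbl i)) => vi.
        by have := IN _ vn vi; lia.
      by have := OUT _ vn vi; lia.
    * exact: I3.
    rewrite /upd /= totalS; move: I5; rewrite size_nbl; lia.
move=> s1 [A _] _ [H1 H2 H3 H4] Hck.
have L := sum_nbl (leqnn n).
split=> // [v vn|]; first by have := H2 v vn; lia.
have nl : n <= len by rewrite len_pos pos_sum; lia.
have E : \sum_(i < n) (160 * size (nbl i) + 60 + (2 + 12)) = 160 * total n + n * 74.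
  rewrite /total big_distrr /= -[n in n * _]card_ord -sum_nat_const -big_split /=.
  by apply: eq_bigr => i _; lia.
by rewrite E in Hck; lia.
Qed.
End Refine.

Notation aOP := 3 (only parsing).
Notation aCL := 6 (only parsing).
Notation aFOP := 9 (only parsing).
Notation aFCL := 10 (only parsing).
Notation aREP := 11 (only parsing).
Notation aCID := 12 (only parsing).
Notation aCNT := 13 (only parsing).

Definition find_class :=
  vX <~ aFOP![aOP![vU]];;
  If (EK 0) vX Skip
    (vX <~ aFCL![aCL![vU]];;
     If (EK 0) vX Skip
       (aREP =[vT]= vU;; vT <~ vT + EK 1;; vX <~ vT)).

Definition classes_prog :=
  vT <~ EK 0;;
  For vU vN (
    find_class;;
    aFOP =[aOP![vU]]= vX;; aFCL =[aCL![vU]]= vX;;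
    aCID =[vU]= vX - EK 1;;
    aCNT =[vX - EK 1]= aCNT![vX - EK 1] + EK 1).

Section Classes.
Variables (inp : nat -> nat) (len M n : nat) (op cl : nat -> nat).
Notation wp := (wp inp len M).
Hypothesis M_len : len + n + 10 < M.
Hypothesis op_lt : forall v, v < n -> op v <= len.
Hypothesis cl_lt : forall v, v < n -> cl v <= len.

Definition tw u v := (op u == op v) || (cl u == cl v).
Hypothesis tw_trans : forall u v w, u < n -> v < n -> w < n ->
  tw u v -> tw v w -> tw u w.

Lemma tw_refl u : tw u u. Proof. by rewrite /tw eqxx. Qed.
Lemma tw_sym u v : tw u v = tw v u.
Proof. by rewrite /tw eq_sym (eq_sym (cl u)). Qed.

Definition cls_inv i (f : nat -> nat) (g : nat -> nat -> nat) :=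
  [/\ f vT <= i /\ (forall v, v < i -> g aCID v < f vT),
      forall v v', v < i -> v' < i -> (g aCID v = g aCID v') <-> tw v v',
      (forall v, v < i -> g aFOP (op v) = (g aCID v).+1 /\
         g aFCL (cl v) = (g aCID v).+1) /\
      (forall c, (g aFOP c != 0 -> exists2 v, v < i & op v = c) /\
         (g aFCL c != 0 -> exists2 v, v < i & cl v = c)),
      forall j, j < f vT -> g aREP j < i /\ g aCID (g aREP j) = j
    & forall j, g aCNT j = \sum_(v < i) (g aCID v == j)].

Lemma classes_ok s : vr s vN = n ->
  (forall v, v < n -> ar s aOP v = op v /\ ar s aCL v = cl v) ->
  (forall a i, 9 <= a -> ar s a i = 0) ->
  wp classes_prog (fun s1 =>
    [/\ vr s1 vT <= n /\ (forall v, v < n -> ar s1 aCID v < vr s1 vT),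
      forall v v', v < n -> v' < n -> (ar s1 aCID v = ar s1 aCID v') <-> tw v v',
      forall j, j < vr s1 vT -> ar s1 aREP j < n /\ ar s1 aCID (ar s1 aREP j) = j,
      forall j, ar s1 aCNT j = \sum_(v < n) (ar s1 aCID v == j)
    & ck s1 <= ck s + 300 * n + 300]) s.
Proof.
move=> Hn Hoc Hz; rewrite /classes_prog; wps.
apply: (wp_for (N := n) (I := cls_inv) (T := fun i => 200)) => //=; try lia.
- by move=> s1 [A _]; rewrite A.
- split=> //.
  + by split=> // c; rewrite !Hz.
  + by move=> j; rewrite Hz // big_ord0.
- move=> i s1 Hi [A B] Hu [[H1 H1'] H2 [H3 H3'] H4 H5].
  have Ei : ar s1 aOP i = op i /\ ar s1 aCL i = cl i by rewrite !B //; apply: Hoc.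
  have [K1 C1] := Ei.
  have L1 := op_lt Hi; have L2 := cl_lt Hi.
  apply: wp_seq.
  apply: (wp_conseq (Q := fun s2 => [/\ vr s1 vT <= vr s2 vT <= i.+1,
    (exists v, [/\ v < i, tw v i, vr s2 vX = (ar s1 aCID v).+1, vr s2 vT = vr s1 vT
       & forall j, ar s2 aREP j = ar s1 aREP j]) \/
    [/\ forall v, v < i -> tw v i = false, vr s2 vX = (vr s1 vT).+1,
        vr s2 vT = (vr s1 vT).+1 &
        forall j, ar s2 aREP j = if j == vr s1 vT then i else ar s1 aREP j] &
    ck s2 <= ck s1 + 90])).
  + rewrite /find_class; wps; rewrite K1; try lia.
    apply: wp_if; try okt.
      simp; rewrite lt0n => H; wps; split; try lia.
      left; have [v vi ov] := (H3' (op i)).1 H; exists v; split=> //.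
        by rewrite /tw ov eqxx.
      by rewrite -ov (H3 v vi).1.
    simp; rewrite leqn0 => /eqP Z1; wps; rewrite C1; try lia.
    apply: wp_if; try okt.
      simp; rewrite lt0n => H; wps; split; try lia.
      left; have [v vi ov] := (H3' (cl i)).2 H; exists v; split=> //.
        by rewrite /tw ov eqxx orbT.
      by rewrite -ov (H3 v vi).2.
    simp; rewrite leqn0 => /eqP Z2; wps; wps; wps; split; try lia.
    right; split; try lia; move=> v vi; rewrite /tw.
    apply/negbTE; rewrite negb_or; apply/andP; split; apply/eqP => E.
      by have := (H3 v vi).1; rewrite E Z1.
    by have := (H3 v vi).2; rewrite E Z2.
  move=> s2 [A2 B2] [T2 Hx C2].
  have U2 : vr s2 vU = i by rewrite A2.
  have O2 : ar s2 aOP i = op i by rewrite B2.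
  have Cl2 : ar s2 aCL i = cl i by rewrite B2.
  have {Hx} [x [X2 Xt Xn Xtw XR]] : exists x, [/\ vr s2 vX = x.+1, x < vr s2 vT,
      x <= i, forall v, v < i -> (ar s1 aCID v = x) <-> tw v i &
      forall j, j < vr s2 vT -> if j == x then (ar s2 aREP j = i \/
           (ar s2 aREP j < i /\ ar s1 aCID (ar s2 aREP j) = j)) else
         ar s2 aREP j < i /\ ar s1 aCID (ar s2 aREP j) = j].
    case: Hx => [[v [vi tv X2 T2' R2]]|[tv X2 T2' R2]].
      exists (ar s1 aCID v); split=> //.
      * by rewrite T2' H1'.
      * by have := H1' v vi; lia.
      * move=> v' v'i; rewrite H2 //; split=> H.
          by apply: tw_trans H tv; lia.
        by apply: tw_trans H _; rewrite 1?tw_sym //; lia.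
      move=> j jT; rewrite R2; have HH : ar s1 11 j < i /\ ar s1 12 (ar s1 11 j) = j.
        by apply: H4; rewrite -T2'.
      by case: ifP => _ //; right.
    exists (vr s1 vT); split=> //; try lia.
      by move=> v vi; rewrite tv //; split=> // E; have := H1' v vi; lia.
    move=> j jT; rewrite R2; case: eqP => [_|jx]; first by left.
    by apply: H4; lia.
  have E12 v : ar s2 12 v = ar s1 12 v by apply: B2.
  have E9 v : ar s2 9 v = ar s1 9 v by apply: B2.
  have E10 v : ar s2 10 v = ar s1 10 v by apply: B2.
  have E13 v : ar s2 13 v = ar s1 13 v by apply: B2.
  wps; rewrite ?O2; try lia.
  wps; rewrite ?Cl2; try lia.
  wps; rewrite ?subn1 /=; try lia.
  have CB : ar s1 13 x <= i.
    rewrite H5 -[leqRHS]muln1 -[X in _ <= X * _]card_ord -sum_nat_const.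
    by apply: leq_sum => v _; case: (_ == _).
  wps; rewrite ?subn1 /= ?E13; try lia.
  split; last by lia.
  have tws v : v < i -> tw v i -> ar s1 12 v = x by move=> vi; apply: (Xtw v vi).2.
  split=> /=.
  + split; first by lia.
    move=> v; rewrite ltnS; case: (eqVneq v i) => [//|vi] vi'.
    by rewrite E12; have := H1' v; lia.
  + move=> v v'; rewrite !ltnS.
    case: (eqVneq v i) => [->|vi] v1; case: (eqVneq v' i) => [->|v'i] v1'; rewrite ?E12.
    * by rewrite tw_refl.
    * have lt : v' < i by lia.
      by rewrite tw_sym -(Xtw _ lt); split=> ->.
    * have lt : v < i by lia.
      by rewrite -(Xtw _ lt).
    by apply: H2; lia.
  + split.
      move=> v; rewrite ltnS; case: (eqVneq v i) => [->|vi] vi'; first by rewrite !eqxx.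
      have vlt : v < i by lia.
      rewrite E9 E10 E12; have [-> ->] := H3 v vlt.
      split; case: eqP => // E; rewrite tws // /tw E eqxx ?orbT //.
    move=> c; rewrite E9 E10; have [F1 F2] := H3' c; split.
      case: (c =P op i) => [-> _|_]; first by exists i.
      by move=> /F1[v vi <-]; exists v => //; lia.
    case: (c =P cl i) => [-> _|_]; first by exists i.
    by move=> /F2[v vi <-]; exists v => //; lia.
  + move=> l lT; have := XR l lT; rewrite !E12.
    have F w0 : w0 < i -> (w0 == i) = false by move=> H; apply/negbTE; lia.
    case: (eqVneq l x) => [->|lx]; last by case=> H /[dup] H' ->; rewrite F //; split=> //; lia.
    by case=> [->|[H E]]; rewrite ?eqxx ?F //; split=> //; lia.
  + move=> l; rewrite big_ord_recr /= eqxx E13 !H5.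
    have -> : \sum_(v < i) ((if v == i :> nat then x else ar s2 12 v) == l) =
        \sum_(v < i) (ar s1 12 v == l).
      by apply: eq_bigr => v _; rewrite (ltn_eqF (ltn_ord v)) E12.
    by rewrite (eq_sym x); case: eqP => [->|_]; rewrite ?addn1 ?addn0.
move=> s1 _ _ [[H1 H1'] H2 H3 H4 H5]; rewrite sum_nat_const card_ord => Hck.
split=> //; lia.
Qed.
End Classes.

Notation aMT := 14 (only parsing).

Definition matrix_prog :=
  For vU vT (
    vV <~ aREP![vU];;
    For vJ aDEG![vV] (
      aMT =[vU * vT + aCID![EIn (aPOS![vV] + vJ)]]= EK 1)).

Section ClassMatrix.
Variables (inp : nat -> nat) (len M n t : nat) (nb : nat -> seq nat).
Variables (rep cid : nat -> nat).
Notation wp := (wp inp len M).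
Notation pos := (pos nb).
Hypothesis inp_nb : forall u j, u < n -> j < size (nb u) ->
  inp (pos u + 1 + j) = nth 0 (nb u) j.
Hypothesis len_pos : len = pos n.
Hypothesis M_len : len + n * n + 10 < M.
Hypothesis nb_lt : forall u v, u < n -> v \in nb u -> v < n.
Hypothesis rep_lt : forall i, i < t -> rep i < n.
Hypothesis cid_rep : forall i, i < t -> cid (rep i) = i.
Hypothesis cid_lt : forall v, v < n -> cid v < t.
Hypothesis t_le : t <= n.

Definition cadj i j : bool := has (fun v => cid v == j) (nb (rep i)).

Lemma sum_rep (f : nat -> nat) : \sum_(i < t) f (rep i) <= \sum_(v < n) f v.
Proof.
pose r (i : 'I_t) := Ordinal (rep_lt (ltn_ord i)).
have rinj : injective r.
  move=> i j /(congr1 val) /= E; apply: val_inj.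
  by rewrite /= -(cid_rep (ltn_ord i)) -(cid_rep (ltn_ord j)) E.
have -> : \sum_(i < t) f (rep i) = \sum_(v in [set r i | i : 'I_t]%SET) f v.
  by rewrite big_imset //= => i j _ _; apply: rinj.
by rewrite [leqRHS](bigID (mem [set r i | i : 'I_t]%SET)) leq_addr.
Qed.

Lemma matrix_ok s : vr s vT = t ->
  (forall u, u < n -> ar s aPOS u = pos u + 1 /\ ar s aDEG u = size (nb u)) ->
  (forall i, i < t -> ar s aREP i = rep i) ->
  (forall v, v < n -> ar s aCID v = cid v) ->
  (forall i, ar s aMT i = 0) ->
  wp matrix_prog (fun s1 =>
    (forall i j, i < t -> j < t -> ar s1 aMT (i * t + j) = cadj i j) /\
    ck s1 <= ck s + 200 * len + 100) s.
Proof.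
move=> HT Hpd Hrep Hcid Hz; rewrite /matrix_prog.
have nl : 3 + n <= len by rewrite len_pos pos_sum; lia.
pose mi := fun i (_ : nat -> nat) (g : nat -> nat -> nat) =>
  forall i' j, i' < t -> j < t -> g aMT (i' * t + j) = (i' < i) && cadj i' j.
have tt i j : i < t -> j < t -> i * t + j < n * n.
  move=> it jt; have : i.+1 * t <= t * t by rewrite leq_mul2r it orbT.
  have : t * t <= n * n by apply: leq_mul.
  by rewrite mulSn; lia.
apply: (wp_for (N := t) (I := mi)
  (T := fun i => 80 * size (nb (rep i)) + 60)) => //=; try lia.
- by move=> s1 [A _]; rewrite A.
- move=> i s1 Hi [A B] Hu HI; wps.
  have Ti : vr s1 vT = t by rewrite A.
  rewrite B // Hrep //; have ri := rep_lt Hi.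
  have [P1 P2] := Hpd _ ri.
  have PL j : j < size (nb (rep i)) -> pos (rep i) + 1 + j < len.
    move=> Hj; rewrite len_pos; have := pos_le nb ri.
    by rewrite /pos big_ord_recr /=; lia.
  have NL : size (nb (rep i)) <= len.
    by case: (size (nb (rep i))) PL => // m /(_ m (ltnSn m)); lia.
  apply: (wp_for (N := size (nb (rep i))) (I := fun j _ g =>
     forall i' j', i' < t -> j' < t -> g aMT (i' * t + j') =
       (i' < i) && cadj i' j' ||
       (i' == i) && has (fun v => cid v == j') (take j (nb (rep i))))
    (T := fun _ => 50)) => //=; try lia.
  + by move=> s2 [A2 B2]; rewrite A2 //= B2 // B // P2 /upd /=; do ?split; lia.
  + move=> i' j' H1 H2; rewrite (HI _ _ H1 H2) take0 andbF orbF //.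
  + move=> j s2 Hj [A2 B2] J2 HI2.
    have U2 : vr s2 vU = i by rewrite A2.
    have V2 : vr s2 vV = rep i by rewrite A2.
    have T2 : vr s2 vT = t by rewrite A2.
    have Q1 : ar s2 aPOS (rep i) = pos (rep i) + 1 by rewrite B2 //= B //.
    have PLj := PL j Hj.
    have vin : nth 0 (nb (rep i)) j \in nb (rep i) by apply: mem_nth.
    have vn := nb_lt ri vin.
    have cv : ar s2 aCID (inp (ar s2 aPOS (rep i) + j)) = cid (nth 0 (nb (rep i)) j).
      by rewrite Q1 inp_nb // B2 //= B // Hcid.
    have ct := cid_lt vn; have ij := tt i _ Hi ct.
    wps; rewrite ?cv ?Q1 ?inp_nb //; try lia.
    split; last by lia.
    move=> i' j' H1 H2; rewrite (take_nth 0) // has_rcons HI2 //.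
    case: (eqVneq i' i) => [->|ii] /=.
      rewrite eqn_add2l eq_sym ltnn /=; case: eqP => //= _.
    rewrite !orbF; case: eqP => // E; case/eqP: ii.
    have t0 : 0 < t by lia.
    by move: (congr1 (divn^~ t) E); rewrite !divnMDl // !divn_small // !addn0.
  move=> s2 _ _ HI2; rewrite sum_nat_const card_ord => Hck; split; last by lia.
  move=> i' j' H1 H2; rewrite HI2 // take_size.
  rewrite ltnS [i' <= i]leq_eqVlt; case: (eqVneq i' i) => [->|_] /=.
    by rewrite ltnn.
  by rewrite orbF.
move=> s1 _ _ HI; rewrite big_split /= sum_nat_const card_ord => Hck; split.
  by move=> i j it jt; rewrite HI // it.
have S : \sum_(i < t) (80 * size (nb (rep i)) + 60) <=
    80 * (\sum_(v < n) size (nb v)) + n * 60.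
  apply: leq_trans (sum_rep (fun v => 80 * size (nb v) + 60)) _.
  by rewrite big_split /= -big_distrr /= sum_nat_const card_ord.
have := pos_sum nb n; rewrite -len_pos => L.
move: S Hck L; set S0 := \sum_(i < t) _; set S1 := \sum_(i < n) _; lia.
Qed.
End ClassMatrix.

(** * Mixed-radix counters *)

Section Digits.
Variable b : nat -> nat.

Definition weight j := \prod_(i < j) b i.
Definition digit k j := (k %/ weight j) %% b j.

Lemma weightS j : weight j.+1 = weight j * b j.
Proof. by rewrite /weight big_ord_recr. Qed.

Lemma weight_gt0 Q : (forall j, j < Q -> 0 < b j) -> 0 < weight Q.
Proof. by move=> H; apply: prodn_cond_gt0 => i _; apply: H. Qed.

Lemma carryS k j : 0 < weight j -> 0 < b j ->
  (weight j.+1 %| k.+1) = (weight j %| k.+1) && (digit k j + 1 == b j).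
Proof.
move=> w0 b0; rewrite weightS; case: (boolP (weight j %| k.+1)) => /= H; last first.
  by apply/negbTE; apply: contra H; apply: dvdn_trans; apply: dvdn_mulr.
have D := divnS k w0; rewrite H /= in D.
have E : k.+1 = (1 + k %/ weight j) * weight j by rewrite -D divnK.
rewrite {1}E mulnC dvdn_pmul2r // /digit /dvdn add1n.
have L : (k %/ weight j) %% b j < b j by rewrite ltn_mod.
rewrite {1}(divn_eq (k %/ weight j) (b j)) -addnS modnMDl.
move: L; rewrite leq_eqVlt addn1 => /orP[/eqP->|L]; first by rewrite modnn !eqxx.
by rewrite modn_small // (ltn_eqF L).
Qed.

Lemma digitS k j : 0 < weight j -> 0 < b j ->
  digit k.+1 j = if weight j %| k.+1 then
    (if digit k j + 1 < b j then digit k j + 1 else 0) else digit k j.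
Proof.
move=> w0 b0; rewrite /digit divnS //; case: ifP => _ //=.
have L : (k %/ weight j) %% b j < b j by rewrite ltn_mod.
rewrite {1}(divn_eq (k %/ weight j) (b j)) addnCA modnMDl add1n addn1.
case: ltnP => H; first by rewrite modn_small.
have -> : (k %/ weight j %% b j).+1 = b j by lia.
by rewrite modnn.
Qed.

Lemma digit0 j : digit 0 j = 0.
Proof. by rewrite /digit div0n mod0n. Qed.

Lemma digit_lt k j : 0 < b j -> digit k j < b j.
Proof. by move=> ?; rewrite ltn_mod. Qed.

Lemma digit_onto Q (a : nat -> nat) : (forall j, j < Q -> a j < b j) ->
  exists2 k, k < weight Q & forall j, j < Q -> digit k j = a j.
Proof.
elim: Q => [|Q IH] H; first by exists 0 => //; rewrite /weight big_ord0.
have [k kQ Hk] := IH (fun j jQ => H j (ltnW jQ)).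
have bp j : j < Q.+1 -> 0 < b j by move=> /H; apply: leq_ltn_trans.
have wp j : j <= Q -> 0 < weight j.
  by move=> jQ; apply: weight_gt0 => i ij; apply: bp; apply: leq_trans ij _; lia.
exists (a Q * weight Q + k).
  rewrite weightS; have := H Q (ltnSn Q); move: kQ => k1 k2.
  have : (a Q).+1 * weight Q <= b Q * weight Q by rewrite leq_mul2r k2 orbT.
  by rewrite mulSn (mulnC (b Q)); lia.
move=> j; rewrite ltnS leq_eqVlt => /orP[/eqP->|jQ].
  by rewrite /digit divnMDl ?wp // divn_small // addn0 modn_small // H.
rewrite /digit -(Hk j jQ) /digit.
have : weight j.+1 %| weight Q.
  elim: (Q) jQ => // q IHq; rewrite ltnS leq_eqVlt => /orP[/eqP->//|/IHq].
  by rewrite [weight q.+1]weightS => h; apply: dvdn_mulr.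
case/dvdnP => d ->; rewrite weightS.
have -> : a Q * (d * (weight j * b j)) = (a Q * d * b j) * weight j by lia.
by rewrite divnMDl ?wp 1?ltnW // modnMDl.
Qed.

End Digits.

Notation vCy := 20 (only parsing).
Notation vI := 21 (only parsing).

Definition odometer aD aB vQ body :=
  vCy <~ EK 0;;
  While vCy (EK 1) (
    body;;
    vCy <~ EK 1;;
    For vI vQ (
      If (EK 0) vCy
        (If (aD![vI] + EK 1) aB![vI]
           (aD =[vI]= aD![vI] + EK 1;; vCy <~ EK 0)
           (aD =[vI]= EK 0))
        Skip)).

Section Odometer.
Variables (inp : nat -> nat) (len M : nat).
Notation wp := (wp inp len M).

Lemma wp_odometer aD aB vQ body Q (b : nat -> nat) (I : nat -> st -> Prop) Tb
    (R : st -> Prop) s :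
  vCy \notin mods body -> vI \notin mods body ->
  vQ \notin vCy :: vI :: 0 :: mods body ->
  aD \notin amods body -> aB \notin amods body -> (aB == aD) = false ->
  vr s vQ = Q -> Q + 2 < M ->
  (forall j, j < Q -> [/\ ar s aB j = b j, ar s aD j = 0, 0 < b j & b j < M]) ->
  (forall k s1 s2, same [:: vCy; vI; 0] [:: aD] s1 s2 -> I k s1 -> I k s2) ->
  I 0 s ->
  (forall k s1, k < weight b Q ->
    same [:: vCy, vI, 0 & mods body] (aD :: amods body) s s1 ->
    (forall j, j < Q -> ar s1 aD j = digit b k j) -> I k s1 ->
    wp body (fun s2 => I k.+1 s2 /\ ck s2 <= ck s1 + Tb) s1) ->
  (forall s1, same [:: vCy, vI, 0 & mods body] (aD :: amods body) s s1 ->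
    I (weight b Q) s1 ->
    ck s1 <= ck s + weight b Q * (Tb + 80 * Q + 80) + 30 -> R s1) ->
  wp (odometer aD aB vQ body) R s.
Proof.
move=> m1 m2; rewrite !inE !negb_or => /and4P[q1 q2 q3 q4] d1 d2 dBA HQ QM Hb HI I0 Hbody HR.
have dAB : (aD == aB) = false by rewrite eq_sym.
have bp j : j < Q -> 0 < b j by case/Hb.
have w0 j : j <= Q -> 0 < weight b j.
  by move=> jQ; apply: weight_gt0 => i ij; apply: bp; apply: leq_trans ij _.
have sub s1 : same (mods (body;; vCy <~ EK 1;;
     For vI vQ (If (EK 0) vCy
        (If (aD![vI] + EK 1) aB![vI]
           (aD =[vI]= aD![vI] + EK 1;; vCy <~ EK 0)
           (aD =[vI]= EK 0)) Skip)))
    (amods (body;; vCy <~ EK 1;;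
     For vI vQ (If (EK 0) vCy
        (If (aD![vI] + EK 1) aB![vI]
           (aD =[vI]= aD![vI] + EK 1;; vCy <~ EK 0)
           (aD =[vI]= EK 0)) Skip))) (setv s vCy 0 3) s1 ->
    same [:: vCy, vI, 0 & mods body] (aD :: amods body) s s1.
  move=> [A B]; split=> [x|a i]; rewrite !inE !negb_or.
    case/and4P=> x1 x2 x3 x4; rewrite A /= /upd ?(negPf x1) //.
    by rewrite mem_cat !inE !negb_or x1 x2 x3 x4.
  by case/andP=> x1 x2; rewrite B //= mem_cat !inE !negb_or x1 x2.
wps.
apply: (wp_while (N := weight b Q) (I := fun k s1 =>
   [/\ k < weight b Q -> forall j, j < Q -> ar s1 aD j = digit b k j,
       vr s1 vCy = (k == weight b Q) & I k s1])
   (T := fun _ => Tb + 70 * Q + 70)).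
- split=> [_ j jQ||]; last by apply: HI I0; split=> //= x; rewrite /upd !inE; case: eqP.
    by rewrite digit0; case: (Hb j jQ).
  by rewrite /= /upd /= eq_sym (gtn_eqF (w0 Q (leqnn _))).
- by move=> k s1 kW _ [A B C]; okt.
- move=> k s1 kW /sub Hs [A B C]; apply: wp_seq.
  have Hs' : same [:: vCy, vI, 0 & mods body] (aD :: amods body) s
      (tick s1 (ce vCy + ce (EK 1) + 1)) by [].
  apply: (wp_conseq (Hbody k _ kW Hs' (A kW) _)) => /=; first exact: HI C.
  move=> s2 [A2 B2] [I2 C2]; wps.
  have Q2 : vr s2 vQ = Q.
    by rewrite A2 //= (proj1 Hs) // !inE !negb_or q1 q2 q3.
  have D2 j : j < Q -> ar s2 aD j = digit b k j.
    by move=> jQ; rewrite B2 //= A.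
  have E2 j : j < Q -> ar s2 aB j = b j.
    move=> jQ; rewrite B2 //= (proj2 Hs) ?inE ?negb_or ?dBA //.
    by case: (Hb j jQ).
  apply: (wp_for (N := Q) (I := fun j f g =>
     (forall l, l < Q -> g aD l = digit b (if l < j then k.+1 else k) l) /\
     f vCy = (weight b j %| k.+1)) (T := fun _ => 50)).
  + by [].

  + lia.
  + lia.
  + move=> s3 [A3 B3]; split=> //=; rewrite A3 /= ?/upd ?(negPf q1) //.
    by rewrite !inE !negb_or q1 q2 q3.
  + split=> [l lQ|]; first by rewrite /= D2.
    by rewrite /upd /= /weight big_ord0 dvd1n.
  + move=> j s3 jQ [A3 B3] J3 [G3 F3].
    have bM : b j < M by case: (Hb j jQ).
    have [wj bj] := (w0 j (ltnW jQ), bp j jQ).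
    have dl := digit_lt k bj.
    have G3j := G3 j jQ; rewrite ltnn in G3j.
    have B3j : ar s3 aB j = b j by rewrite B3 /= ?E2 // !inE dBA.
    have CS := carryS k wj bj; have DS := digitS k wj bj.
    apply: wp_if; [okt|okt| |].
      simp; case: (boolP (weight b j %| k.+1)) => // Hd _.
      rewrite Hd /= in CS DS.
      apply: wp_if; [okt|okt| |].
        simp; rewrite G3j B3j => Hlt; wps; wps; split; last by lia.
        split; last by rewrite CS (ltn_eqF Hlt).
        move=> l lQ; case: (eqVneq l j) => [->|lj]; rewrite ?andbF ?eqxx /=.
          by rewrite ltnSn DS Hlt G3j.
        by rewrite G3 // [l < j.+1]ltnS [l <= j]leq_eqVlt (negPf lj).
      simp; rewrite G3j B3j => Hge; wps; split; last by lia.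
      have Eb : digit b k j + 1 = b j by lia.
      split; last by rewrite ?F3 CS Eb eqxx Hd.
      move=> l lQ; case: (eqVneq l j) => [->|lj]; rewrite ?andbF ?eqxx /=.
        by rewrite ltnSn DS ltnNge Hge.
      by rewrite G3 // [l < j.+1]ltnS [l <= j]leq_eqVlt (negPf lj).
    simp; case: (boolP (weight b j %| k.+1)) => // Hd _.
    rewrite (negPf Hd) /= in CS DS.
    wps; split; last by lia.
    split; last by rewrite ?F3 ?(negPf Hd) CS.
    move=> l lQ; rewrite G3 // [l < j.+1]ltnS [l <= j]leq_eqVlt.
    by case: (eqVneq l j) => [->|lj] //=; rewrite ltnn DS.
  + move=> s3 [A3 B3] J3 [G3 F3]; rewrite sum_nat_const card_ord => C3.
    split; last by move: C3 => /=; lia.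
    split=> [kW' j jQ||].
    * by rewrite /= G3 // jQ.
    * rewrite /= F3; congr nat_of_bool; apply/idP/eqP => [Hd|->]; last exact: dvdnn.
      by apply/eqP; rewrite eqn_leq kW dvdn_leq.
    apply: HI I2; split=> [x|a i]; rewrite !inE.
      by rewrite !negb_or => /and3P[x1 x2 x3]; rewrite /= A3 /= ?/upd ?(negPf x1) // !inE !negb_or x1 x2.
    by move=> ad; rewrite /= B3 //= !inE !negb_or ad.
- move=> s1 /sub Hs [A B C]; rewrite sum_nat_const card_ord => H.
  apply: HR => //=; first exact: HI C.
  move: H => /=; nia.
Qed.
End Odometer.

(** * Enumeration of component types *)

Notation aBS1 := 15 (only parsing).
Notation aDG1 := 16 (only parsing).
Notation aTAU := 17 (only parsing).
Notation aCC := 18 (only parsing).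
Notation vS := 22 (only parsing).
Notation vA := 23 (only parsing).
Notation vB := 24 (only parsing).
Notation vW := 25 (only parsing).

Definition store_type :=
  vW <~ EK 0;;
  For vA vT (
    aTAU =[vP * vT + vA]= aDG1![vA];;
    For vB vT (
      vW <~ vW + aMT![vA * vT + vB] * (aDG1![vA] * aDG1![vB]));;
    vW <~ vW - aMT![vA * vT + vA] * aDG1![vA]);;
  aCC =[vP]= vW;;
  vP <~ vP + EK 1.

Definition types_body :=
  vS <~ EK 0;;
  For vA vT (vS <~ vS + aDG1![vA]);;
  If vH vS Skip (If vN vP Skip store_type).

Definition types_prog :=
  For vI vT (aBS1 =[vI]= vH + EK 1);;
  vP <~ EK 0;;
  odometer aDG1 aBS1 vT types_body.

Section Types.
Variables (inp : nat -> nat) (len M n h t : nat) (adj : nat -> nat -> bool).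
Notation wp := (wp inp len M).
Hypothesis h_lt : h < n.
Hypothesis t_le : t <= n.
Hypothesis M_len : len + 10 * ((n + 2) * (n + 2)) < M.

Definition tau k j := digit (fun _ => h.+1) k j.
Definition valid k := \sum_(j < t) tau k j <= h.
Definition types k := [seq q <- iota 0 k | valid q].

Definition wt_row (a : nat -> nat) i j :=
  \sum_(j' < j) adj i j' * (a i * a j').
Definition wt_pre (a : nat -> nat) i :=
  \sum_(i' < i) (wt_row a i' t - adj i' i' * a i').

(* Twice the number of edges inside a component with [a i] vertices in class [i]. *)
Definition wt (a : nat -> nat) := wt_pre a t.

Lemma wt_rowS a i j :
  wt_row a i j.+1 = wt_row a i j + adj i j * (a i * a j).
Proof. by rewrite /wt_row big_ord_recr. Qed.

Lemma wt_preS a i :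
  wt_pre a i.+1 = wt_pre a i + (wt_row a i t - adj i i * a i).
Proof. by rewrite /wt_pre big_ord_recr. Qed.

Lemma typesS k : types k.+1 = if valid k then rcons (types k) k else types k.
Proof.
by rewrite /types -addn1 iotaD filter_cat /= add0n; case: ifP; rewrite ?cats1 ?cats0.
Qed.

Definition types_inv k (f : nat -> nat) (g : nat -> nat -> nat) :=
  f vP = minn (size (types k)) n.+1 /\
  (forall q, q < f vP -> (forall j, j < t -> g aTAU (q * t + j) =
      tau (nth 0 (types k) q) j) /\ g aCC q = wt (tau (nth 0 (types k) q))).

Lemma sum_part (a : nat -> nat) i : i <= t ->
  \sum_(j < i) a j <= \sum_(j < t) a j.
Proof.
move=> it; rewrite (big_ord_widen t a) // [leqRHS](bigID (fun j : 'I_t => j < i)).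
exact: leq_addr.
Qed.

Lemma wt_bound (a : nat -> nat) i j : i < t -> j <= t ->
  \sum_(j < t) a j <= h -> wt_pre a i + wt_row a i j <= h * h.
Proof.
move=> it jt ah.
have R i' : wt_row a i' j <= a i' * \sum_(j < t) a j.
  rewrite /wt_row; apply: (@leq_trans (\sum_(j' < j) a i' * a j')).
    by apply: leq_sum => j' _; case: (adj _ _); rewrite ?mul1n ?mul0n.
  by rewrite -big_distrr /= leq_mul2l sum_part ?orbT.
have R' i' : wt_row a i' t <= a i' * \sum_(j < t) a j.
  rewrite /wt_row big_distrr /=.
  by apply: leq_sum => j' _; case: (adj _ _); rewrite ?mul1n ?mul0n.
apply: (@leq_trans ((\sum_(i' < i.+1) a i') * \sum_(j < t) a j)); last first.
  by apply: leq_mul; rewrite // (leq_trans (sum_part _ _) ah).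
rewrite big_ord_recr /= mulnDl leq_add // big_distrl /=.
by apply: leq_sum => i' _; apply: leq_trans (leq_subr _ _) (R' i').
Qed.

Lemma store_ok (a : nat -> nat) p s :
  vr s vT = t -> vr s vP = p -> p <= n ->
  (forall j, j < t -> ar s aDG1 j = a j) ->
  \sum_(j < t) a j <= h ->
  (forall i j, i < t -> j < t -> ar s aMT (i * t + j) = adj i j) ->
  wp store_type (fun s1 => [/\ vr s1 vP = p.+1,
     forall j, j < t -> ar s1 aTAU (p * t + j) = a j,
     forall j, j < p * t -> ar s1 aTAU j = ar s aTAU j,
     forall q, ar s1 aCC q = if q == p then wt a else ar s aCC q &
     ck s1 <= ck s + 100 * (t * t) + 100 * t + 50]) s.
Proof.
move=> HT HP pn Ha ah Hm; rewrite /store_type; wps.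
have hM : h * h + n * t + n + t * t + 10 < M.
  have : h * h <= n * n by apply: leq_mul; lia.
  have : n * t <= n * n by apply: leq_mul.
  have : t * t <= n * t by apply: leq_mul.
  lia.
apply: wp_seq.
apply: (wp_for (N := t) (I := fun i f g => [/\
    f vW = wt_pre a i,
    forall j, j < i -> g aTAU (p * t + j) = a j &
    forall j, j < p * t -> g aTAU j = ar s aTAU j])
  (T := fun _ => 80 * t + 80)) => //=; try lia.
- by move=> s1 [A B]; rewrite A.
- by split=> //; rewrite /upd /= /wt_pre big_ord0.
- move=> i s1 Hi [A B] Hu [H1 H2 H3].
  have T1 : vr s1 vT = t by rewrite A.
  have P1 : vr s1 vP = p by rewrite A.
  have G1 j : j < t -> ar s1 aDG1 j = a j by move=> jt; rewrite B //= Ha.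
  have M1 i' j : i' < t -> j < t -> ar s1 aMT (i' * t + j) = adj i' j.
    by move=> it jt; rewrite B //= Hm.
  have pt : p * t <= n * t by rewrite leq_mul2r pn orbT.
  have it : i.+1 * t <= t * t by rewrite leq_mul2r Hi orbT.
  rewrite mulSn in it.
  wps; apply: wp_seq.
  apply: (wp_for (N := t) (I := fun j f g => f vW =
     wt_pre a i + wt_row a i j) (T := fun _ => 60)) => //=; try lia.
  + by move=> s2 [A2 B2]; rewrite A2.
  + by rewrite /upd /= /wt_row big_ord0 addn0.
  + move=> j s2 Hj [A2 B2] J2 H.
    have T2 : vr s2 vT = t by rewrite A2.
    have A3 : vr s2 vA = i by rewrite A2.
    have E1 : ar s2 aMT (i * t + j) = adj i j by rewrite B2 //= /aupd /= M1.
    have E2 l : l < t -> ar s2 aDG1 l = a l by move=> lt; rewrite B2 //= /aupd /= G1.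
    have W1 := @wt_bound a i j.+1 Hi Hj ah; rewrite wt_rowS in W1.
    have Ei := E2 i Hi; have Ej := E2 j Hj.
    have aa : a i * a j <= h * h.
      apply: leq_mul; apply: leq_trans ah.
        by rewrite (bigD1 (Ordinal Hi)) //= leq_addr.
      by rewrite (bigD1 (Ordinal Hj)) //= leq_addr.
    have aa' : adj i j * (a i * a j) <= h * h.
      by case: (adj i j); rewrite ?mul1n ?mul0n.
    wps; rewrite ?E1 ?Ei ?Ej; try lia.
    by split; [rewrite wt_rowS addnA|lia].
  move=> s2 [A2 B2] J2 H; rewrite sum_nat_const card_ord => C2.
  have T2 : vr s2 vT = t by rewrite A2.
  have A3 : vr s2 vA = i by rewrite A2.
  have E1 : ar s2 aMT (i * t + i) = adj i i by rewrite B2 //= /aupd /= M1.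
  have E2 : ar s2 aDG1 i = a i by rewrite B2 //= /aupd /= G1.
  have ai : a i <= \sum_(j < t) a j by rewrite (bigD1 (Ordinal Hi)) //= leq_addr.
  have ai2 : adj i i * a i <= wt_row a i t.
    rewrite /wt_row (bigD1 (Ordinal Hi)) //=; apply: leq_trans (leq_addr _ _).
    by case: (adj i i) => //; rewrite !mul1n; case: (a i) => // m; rewrite leq_pmulr.
  have ai3 : adj i i * a i <= a i by case: (adj i i); rewrite ?mul1n ?mul0n.
  wps; rewrite ?E1 ?E2; try nia; try lia.
  split; last by lia.
  split.
  + by rewrite wt_preS addnBA.
  + move=> j; rewrite ltnS leq_eqVlt => /orP[/eqP->|ji]; rewrite B2 //= /aupd.
      by rewrite !eqxx /= G1.
    by rewrite eqn_add2l (ltn_eqF ji) H2.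
  move=> j jp; rewrite B2 //= /aupd.
  have -> : (j == p * t + i) = false by apply/negbTE; lia.
  by rewrite andbF H3.
move=> s1 [A B] J1 [H1 H2 H3]; rewrite sum_nat_const card_ord => C1.
have T1 : vr s1 vT = t by rewrite A.
have P1 : vr s1 vP = p by rewrite A.
wps; wps; split=> //.
- by rewrite addn1.
- by move=> q; case: ifP => // _; rewrite B.
move: C1 => /=; nia.
Qed.

Lemma types_ok s : vr s vT = t -> vr s vN = n -> vr s vH = h ->
  (forall i j, i < t -> j < t -> ar s aMT (i * t + j) = adj i j) ->
  (forall i, ar s aDG1 i = 0) ->
  wp types_prog (fun s1 =>
    types_inv (h.+1 ^ t) (vr s1) (ar s1) /\
    ck s1 <= ck s + h.+1 ^ t * (300 * (t.+1 * t.+1)) + 100 * t + 100) s.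
Proof.
move=> HT HN HH Hm Hz; rewrite /types_prog; apply: wp_seq.
have nn : n * n + 4 * n + 4 = (n + 2) * (n + 2) by lia.
apply: (wp_for (N := t) (I := fun i f g => forall j, j < i -> g aBS1 j = h.+1)
  (T := fun _ => 30)) => //=; try lia.
- by move=> s1 [A B]; rewrite A.
- move=> i s1 Hi [A B] Hu H.
  have H1 : vr s1 vH = h by rewrite A.
  wps; split; last by lia.
  move=> j; rewrite ltnS leq_eqVlt => /orP[/eqP->|ji]; first by rewrite eqxx addn1.
  by rewrite (ltn_eqF ji) H.
move=> s1 [A B] J1 H; rewrite sum_nat_const card_ord => C1.
wps.
have W : weight (fun _ => h.+1) t = h.+1 ^ t by rewrite /weight prod_nat_const card_ord.
apply: (wp_odometer (Q := t) (b := fun _ => h.+1)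
  (I := fun k s2 => types_inv k (vr s2) (ar s2))
  (Tb := 100 * (t * t) + 200 * t + 150)) => //=; try lia.
- by rewrite /upd /= A.
- by move=> j jt; rewrite H // B //; split=> //; lia.
- move=> k s2 s3 [A3 B3] [I1 I2]; split; first by rewrite A3.
  move=> q qP; rewrite A3 // in qP; have [I3 I4] := I2 q qP.
  by split=> [j jt|]; rewrite B3 // I3.
- move=> k s2 kW [A2 B2] D2 [I1 I2].
  have T2 : vr s2 vT = t by rewrite A2 //= /upd /= A.
  have H2 : vr s2 vH = h by rewrite A2 //= /upd /= A.
  have N2 : vr s2 vN = n by rewrite A2 //= /upd /= A.
  have M2 i j : i < t -> j < t -> ar s2 aMT (i * t + j) = adj i j.
    by move=> it jt; rewrite B2 //= B // Hm.
  wps; apply: wp_seq.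
  apply: (wp_for (N := t) (I := fun i f _ => f vS = \sum_(j < i) tau k j)
    (T := fun _ => 40)) => //=; try lia.
  + by move=> s3 [A3 B3]; rewrite A3.
  + by rewrite /upd /= big_ord0.
  + move=> i s3 Hi [A3 B3] J3 H3.
    have Di : ar s3 aDG1 i = tau k i by rewrite B3 //= D2.
    have L : \sum_(j < i) tau k j <= i * h.
      rewrite -[i in i * h]card_ord -sum_nat_const; apply: leq_sum => j _.
      by rewrite -ltnS; apply: digit_lt.
    have L2 : tau k i <= h by rewrite -ltnS; apply: digit_lt.
    have L3 : i * h <= n * n by apply: leq_mul; lia.
    have L4 : \sum_(j < i) tau k j + ar s3 aDG1 i < M.
      by rewrite Di; apply: leq_ltn_trans (leq_add L L2) _; lia.
    wps; split; last by lia.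
    by rewrite big_ord_recr /= Di.
  move=> s3 [A3 B3] J3 H3; rewrite sum_nat_const card_ord => C3.
  have T3 : vr s3 vT = t by rewrite A3.
  have HH3 : vr s3 vH = h by rewrite A3.
  have N3 : vr s3 vN = n by rewrite A3.
  have P3 : vr s3 vP = vr s2 vP by rewrite A3.
  have AR3 a i : ar s3 a i = ar s2 a i by rewrite B3.
  have M3 i j : i < t -> j < t -> ar s3 aMT (i * t + j) = adj i j.
    by move=> it jt; rewrite AR3 M2.
  have D3 j : j < t -> ar s3 aDG1 j = tau k j by move=> jt; rewrite AR3 D2.
  have inv3 f g : f vP = vr s2 vP -> (forall a i, g a i = ar s2 a i) ->
      types_inv k f g.
    move=> Ef Eg; split; first by rewrite Ef.
    by move=> q; rewrite Ef => /I2[I3 I4]; split=> [j jt|]; rewrite Eg ?I3.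
  apply: wp_if; try okt.
    simp => Hlt; wps; split; last by lia.
    rewrite /types_inv typesS /valid leqNgt Hlt /=; apply: inv3 => //=.
  simp => Hle; have Vk : valid k by rewrite /valid.
  apply: wp_if; try okt.
    simp => Hlt; wps; split; last by lia.
    rewrite /types_inv typesS Vk; split=> /=.
      by rewrite size_rcons P3 I1; lia.
    move=> q; rewrite P3 => qP; have [I3 I4] := I2 q qP.
    have qL : q < size (types k) by lia.
    by rewrite nth_rcons qL; split=> [j jt|]; rewrite AR3 ?I3.
  simp => Hle2;
  have Hle3 : vr s2 vP <= n by rewrite I1.
  refine (wp_conseq (@store_ok (tau k) (vr s2 vP)
    (tick (tick s3 (2 + 2 + 1)) (2 + 2 + 1)) T3 P3 Hle3 D3 Hle M3) _) => /=.
  move=> s4 [A4 B4] [P4 G4 G4' G5 C4]; split; last by lia.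
  have SL : size (types k) = vr s2 vP by lia.
  rewrite /types_inv typesS Vk; split=> /=.
    by rewrite size_rcons P4; lia.
  move=> q; rewrite P4 ltnS leq_eqVlt => /orP[/eqP->|qP].
    by rewrite nth_rcons SL ltnn eqxx G5 eqxx; split=> // j jt; rewrite G4.
  have [I3 I4] := I2 q qP; rewrite nth_rcons SL qP; split=> [j jt|].
    rewrite G4' ?AR3 ?I3 //.
    by have : q.+1 * t <= vr s2 vP * t; [rewrite leq_mul2r qP orbT|rewrite mulSn; lia].
  by rewrite G5 (ltn_eqF qP) AR3.
move=> s2 _; rewrite W => I2 C2; split=> //.
apply: leq_trans C2 _.
have : h.+1 ^ t * (100 * (t * t) + 200 * t + 150 + 80 * t + 80) <=
       h.+1 ^ t * (300 * (t.+1 * t.+1)) by rewrite leq_mul2l; lia.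
move: C1 => /=; lia.
Qed.

End Types.

(** * Exhaustive search over assignments *)

Notation aDG2 := 19 (only parsing).
Notation aBS2 := 20 (only parsing).

Definition brute_body :=
  vS <~ EK 1;;
  For vA vN (
    vW <~ EK 0;;
    For vB vN (IfEq aDG2![vB] vA (vW <~ vW + EK 1) Skip);;
    If vH vW (vS <~ EK 0) Skip);;
  vW <~ EK 0;;
  For vA vN (
    For vJ aDEG![vA] (
      IfEq aDG2![vA] aDG2![EIn (aPOS![vA] + vJ)] Skip (vW <~ vW + EK 1)));;
  If (vK + vK) vW (vS <~ EK 0) Skip;;
  If (EK 0) vS (vAns <~ EK 1) Skip.

Definition brute_prog :=
  For vI vN (aBS2 =[vI]= vN);;
  odometer aDG2 aBS2 vN brute_body.

Section Brute.
Variables (inp : nat -> nat) (len M n h k : nat) (nb : nat -> seq nat).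
Notation wp := (wp inp len M).
Notation pos := (pos nb).
Hypothesis inp_nb : forall u j, u < n -> j < size (nb u) ->
  inp (pos u + 1 + j) = nth 0 (nb u) j.
Hypothesis len_pos : len = pos n.
Hypothesis M_len : len + n + k + k + 10 < M.
Hypothesis nb_lt : forall u v, u < n -> v \in nb u -> v < n.
Hypothesis n_gt0 : 0 < n.

Definition block_size (a : nat -> nat) c := \sum_(v < n) (a v == c).
Definition cut_row (a : nat -> nat) v j :=
  \sum_(w <- take j (nb v)) (a v != a w).
Definition cut_size (a : nat -> nat) i := \sum_(v < i) cut_row a v (size (nb v)).
Definition small_blocks a i := all (fun c => block_size a c <= h) (iota 0 i).
Definition good a := small_blocks a n && (cut_size a n <= k + k).
Definition found_good i := has (fun r => good (digit (fun _ => n) r)) (iota 0 i).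

Lemma small_blocksS a i :
  small_blocks a i.+1 = small_blocks a i && (block_size a i <= h).
Proof. by rewrite /small_blocks -addn1 iotaD all_cat /= add0n andbT. Qed.

Lemma found_goodS i :
  found_good i.+1 = found_good i || good (digit (fun _ => n) i).
Proof. by rewrite /found_good -addn1 iotaD has_cat /= add0n orbF. Qed.

Lemma cutS a i : cut_size a i.+1 = cut_size a i + cut_row a i (size (nb i)).
Proof. by rewrite /cut_size big_ord_recr. Qed.

Lemma cut_rowS a v j : j < size (nb v) ->
  cut_row a v j.+1 = cut_row a v j + (a v != a (nth 0 (nb v) j)).
Proof. by move=> jv; rewrite /cut_row (take_nth 0) // big_rcons /= addnC. Qed.

Lemma cut_row_le a v j : cut_row a v j <= size (nb v).
Proof.
rewrite /cut_row; apply: (@leq_trans (\sum_(w <- take j (nb v)) 1)).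
  by apply: leq_sum => w _; case: (_ != _).
by rewrite sum1_size size_take_min geq_minr.
Qed.

Lemma cut_le a i j : i < n -> cut_size a i + cut_row a i j <= len.
Proof.
move=> Hi; have L := pos_le nb Hi; rewrite len_pos; apply: leq_trans L.
rewrite pos_sum big_ord_recr /=; have := cut_row_le a i j.
have : cut_size a i <= \sum_(v < i) size (nb v).
  by apply: leq_sum => v _; apply: cut_row_le.
by set X := \sum_(v < i) _; lia.
Qed.

Lemma brute_body_ok (a : nat -> nat) s :
  vr s vN = n -> vr s vH = h -> vr s vK = k ->
  (forall u, u < n -> ar s aPOS u = pos u + 1 /\ ar s aDEG u = size (nb u)) ->
  (forall v, v < n -> ar s aDG2 v = a v) ->
  wp brute_body (fun s1 => vr s1 vAns = (if good a then 1 else vr s vAns) /\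
     ck s1 <= ck s + 200 * (n * n) + 400 * len + 400) s.
Proof.
move=> HN HH HK Hpd Ha; rewrite /brute_body; wps.
have nl : n <= len by rewrite len_pos pos_sum; lia.
apply: wp_seq.
apply: (wp_for (N := n) (I := fun i f _ =>
   f vS = small_blocks a i)
   (T := fun _ => 100 * n + 80)) => //=; try lia.
- by move=> s1 [A B]; rewrite A.
- move=> i s1 Hi [A B] Hu H; wps; apply: wp_seq.
  apply: (wp_for (N := n) (I := fun j f _ => f vW = \sum_(v < j) (a v == i))
    (T := fun _ => 80)) => //=; try lia.
  + by move=> s2 [A2 B2]; rewrite A2 //= /upd /= A.
  + by rewrite /upd /= big_ord0.
  + move=> j s2 Hj [A2 B2] J2 H2.
    have A3 : vr s2 vA = i by rewrite A2.
    have D2 : ar s2 aDG2 j = a j by rewrite B2 //= B // Ha.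
    have L : \sum_(v < j) (a v == i) <= j.
      by rewrite -[leqRHS]card_ord -sum1_card leq_sum // => v _; case: (_ == _).
    have L' : \sum_(v < j) (a v == i) + 1 < M by apply: (@leq_ltn_trans (j + 1)); rewrite ?leq_add2r //; lia.
    apply: wp_ifeq; try okt.
      simp; rewrite D2 => E; wps; split; last by lia.
      by rewrite big_ord_recr /= E eqxx.
    simp; rewrite D2 => E m Hm; wps => m2 Hm2; split; last by simp; lia.
    rewrite big_ord_recr /=; case: eqP => // _; rewrite addn0.
    by simp.
  move=> s2 [A2 B2] J2 H2; rewrite sum_nat_const card_ord => C2.
  have HH2 : vr s2 vH = h by rewrite A2 //= /upd /= A.
  have S2 : vr s2 vS = vr s1 vS by rewrite A2.
  have H2' : vr s2 vW = block_size a i by rewrite H2.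
  apply: wp_if; try okt.
    simp => Hlt; wps; split; last by lia.
    by rewrite small_blocksS /block_size (leqNgt _ h) Hlt andbF.
  simp => Hle; wps; split; last by lia.
  by rewrite small_blocksS /block_size Hle andbT.
move=> s1 [A1 B1] J1 H1; rewrite sum_nat_const card_ord => C1; wps; apply: wp_seq.
apply: (wp_for (N := n) (I := fun i f _ => f vW = cut_size a i)
  (T := fun i => 130 * size (nb i) + 50)) => //=; try lia.
- by move=> s2 [A2 B2]; rewrite A2 //= /upd /= A1.
- by rewrite /upd /= /cut_size big_ord0.
- move=> i s2 Hi [A2 B2] Hu H2.
  have [P1 P2] : ar s2 aPOS i = pos i + 1 /\ ar s2 aDEG i = size (nb i).
    by rewrite !B2 //= !B1 //; apply: Hpd.
  have SL : size (nb i) <= len.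
    have := pos_le nb Hi; rewrite -len_pos pos_sum big_ord_recr /=.
    by set X := \sum_(v < i) _; lia.
  apply: (wp_for (N := size (nb i)) (I := fun j f _ => f vW = cut_size a i + cut_row a i j)
    (T := fun _ => 100)) => //=; try lia.
  + by move=> s3 [A3 B3]; rewrite A3 //= Hu B3 // P2; do ?split; lia.
  + by rewrite /upd /= H2 /cut_row take0 big_nil addn0.
  + move=> j s3 Hj [A3 B3] J3 H3.
    have A4 : vr s3 vA = i by rewrite A3.
    have PLj : pos i + 1 + j < len.
      have := pos_le nb Hi; rewrite -len_pos /pos big_ord_recr /=.
      by set X := \sum_(v < i) _; lia.
    have P3 : ar s3 aPOS i = pos i + 1 by rewrite B3.
    have vin : nth 0 (nb i) j \in nb i by apply: mem_nth.
    have vn := nb_lt Hi vin.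
    have D3 v : v < n -> ar s3 aDG2 v = a v.
      by move=> Hv; rewrite B3 // B2 //= B1 //= Ha.
    have CL := @cut_le a i j.+1 Hi; rewrite cut_rowS // in CL.
    have IV : inp (ar s3 aPOS i + j) = nth 0 (nb i) j by rewrite P3 inp_nb.
    apply: wp_ifeq; try okt.
    * simp; rewrite IV !D3 // => E; wps; split; last by lia.
      by rewrite cut_rowS // E eqxx addn0.
    simp; rewrite IV !D3 // => E m Hm; move/eqP: (E) => Eb.
    rewrite Eb in CL.
    wps => m2 Hm2; split; last by simp; lia.
    by simp; rewrite cut_rowS // Eb; lia.
  move=> s3 _ _ H3; rewrite sum_nat_const card_ord => C3.
  by split; [rewrite cutS|lia].
move=> s2 [A2 B2] J2 H2 C2.
have K2 : vr s2 vK = k by rewrite A2 //= /upd /= A1.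
have Ans2 : vr s2 vAns = vr s vAns by rewrite A2 //= /upd /= A1.
have S2 : vr s2 vS = vr s1 vS by rewrite A2.
have E : \sum_(i < n) (130 * size (nb i) + 50 + (2 + 12)) =
    130 * (\sum_(i < n) size (nb i)) + n * 64.
  rewrite big_distrr /= -[n in n * _]card_ord -sum_nat_const -big_split /=.
  by apply: eq_bigr => i _; lia.
rewrite E in C2; have PS := pos_sum nb n; rewrite -len_pos in PS.
have C3 : ck s2 <= ck s + 200 * (n * n) + 300 * len + 200.
  move: C2 C1 PS => /=; set X := \sum_(i < n) _; nia.
rewrite /good -H2; apply: wp_seq; apply: wp_if; try okt.
  simp => Hlt; wps; apply: wp_if; try okt.
  simp => _; wps; rewrite leqNgt Hlt andbF; split=> //; lia.
simp => Hle; wps; apply: wp_if; try okt.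
  simp; rewrite Hle andbT; case: ifP => // _ _; wps; split=> //; lia.
simp; rewrite Hle andbT; case: ifP => // _ _; wps; split=> //; lia.
Qed.

Lemma brute_ok s :
  vr s vN = n -> vr s vH = h -> vr s vK = k -> vr s vAns = 0 ->
  (forall u, u < n -> ar s aPOS u = pos u + 1 /\ ar s aDEG u = size (nb u)) ->
  (forall v, ar s aDG2 v = 0) ->
  wp brute_prog (fun s1 =>
    exists2 b : bool, vr s1 vAns = b & (b <-> exists2 a : nat -> nat,
      (forall v, v < n -> a v < n) & good a) /\
     ck s1 <= ck s + n ^ n * (1000 * (len + n * n + 1)) + 1000 * len) s.
Proof.
move=> HN HH HK HA Hpd Hz; rewrite /brute_prog; apply: wp_seq.
have nl : 3 + n <= len by rewrite len_pos pos_sum; lia.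
apply: (wp_for (N := n) (I := fun i f g => forall j, j < i -> g aBS2 j = n)
  (T := fun _ => 30)) => //=; try lia.
- by move=> s1 [A B]; rewrite A.
- move=> i s1 Hi [A B] Hu H.
  have H1 : vr s1 vN = n by rewrite A.
  wps; split; last by lia.
  move=> j; rewrite ltnS leq_eqVlt => /orP[/eqP->|ji]; first by rewrite eqxx.
  by rewrite (ltn_eqF ji) H.
move=> s1 [A B] J1 H; rewrite sum_nat_const card_ord => C1.
have W : weight (fun _ => n) n = n ^ n by rewrite /weight prod_nat_const card_ord.
apply: (wp_odometer (Q := n) (b := fun _ => n)
  (I := fun q s2 => vr s2 vAns = found_good q)
  (Tb := 200 * (n * n) + 400 * len + 400)) => //=; try lia.
- by rewrite A.
- by move=> j jn; rewrite H // B //; split=> //; lia.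
- by move=> q s2 s3 [A3 B3] E; rewrite A3.
- by rewrite A.
- move=> q s2 qW [A2 B2] D2 I2.
  refine (wp_conseq (@brute_body_ok (digit (fun _ => n) q) s2 _ _ _ _ D2) _).
  + by rewrite A2 // A.
  + by rewrite A2 // A.
  + by rewrite A2 // A.
  + by move=> u un; rewrite !B2 // !B //; apply: Hpd.
  move=> s3 _ [E3 C3]; split; last by lia.
  rewrite E3 I2 found_goodS.
  by case: (good _); rewrite ?orbT ?orbF.
move=> s2 _; rewrite W => I2 C2.
eexists; first exact: I2.
split; last first.
  apply: leq_trans C2 _.
  have : n ^ n * (200 * (n * n) + 400 * len + 400 + 80 * n + 80) <=
         n ^ n * (1000 * (len + n * n + 1)) by rewrite leq_mul2l; lia.
  move: C1 => /=; lia.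
split=> [/hasP[r _ Hr]|[a Ha1 Ha2]].
  by exists (digit (fun _ => n) r) => // v _; apply: digit_lt.
have [r rW Hr] := @digit_onto (fun _ => n) n a Ha1.
apply/hasP; exists r; first by rewrite mem_iota add0n -W.
move: Ha2; rewrite /good; congr (_ && _).
  apply: eq_in_all => c; rewrite mem_iota add0n => cn.
  by congr (_ <= _); apply: eq_bigr => v _; rewrite Hr.
congr (_ <= _); apply: eq_bigr => v _; rewrite /cut_row take_size.
apply: eq_big_seq => w wv; rewrite !Hr //; exact: nb_lt wv.
Qed.
End Brute.

(** * Search over multiplicities with few large entries *)

Notation aDG3 := 21 (only parsing).
Notation aBS3 := 22 (only parsing).
Notation vQ := 26 (only parsing).
Notation vR := 27 (only parsing).

Definition dot_prog (F : expr -> expr) :=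
  vW <~ EK 0;;
  For vB vP (vW <~ vW + aDG3![vB] * F vB);;
  For vB vR (vW <~ vW + aDG3![vP + vR + vB] * F (aDG3![vP + vB])%X).

Definition search_body :=
  vS <~ EK 1;;
  For vA vT (
    dot_prog (fun e => aTAU![e * vT + vA]%X);;
    IfEq vW aCNT![vA] Skip (vS <~ EK 0));;
  dot_prog (fun e => aCC![e]%X);;
  If (vW + vK + vK) vM2 (vS <~ EK 0) Skip;;
  If (EK 0) vS (vAns <~ EK 1) Skip.

Definition search_prog :=
  vR <~ EK 2 * vT;;
  vQ <~ vP + vR + vR;;
  For vI vP (aBS3 =[vI]= EK 2 * vT * vH + EK 1);;
  For vI vR (aBS3 =[vP + vI]= vP;; aBS3 =[vP + vR + vI]= vN + EK 1);;
  odometer aDG3 aBS3 vQ search_body.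

Section Search.
Variables (inp : nat -> nat) (len M n h k m2 t P : nat).
Variables (tq : nat -> nat -> nat) (cc cnt : nat -> nat).
Notation wp := (wp inp len M).
Hypothesis h_lt : h < n.
Hypothesis t_le : t <= n.
Hypothesis P_gt0 : 0 < P.
Hypothesis P_le : P <= n.
Hypothesis tq_le : forall q i, tq q i <= h.
Hypothesis cc_le : forall q, cc q <= h * h.
Hypothesis M_n : 20 * (n + 2) ^ 6 + k + k < M.

(* The digits [d] encode multiplicities: entry [q < P] is [d q], plus the amounts
   [d (P + 2 * t + s)], [s < 2 * t], such that [d (P + s) = q]. *)
Definition radix j :=
  if j < P then (2 * t * h).+1 else if j < P + 2 * t then P else n.+1.

Definition dot1 (d f : nat -> nat) i := \sum_(q < i) d q * f q.
Definition dot2 (d f : nat -> nat) i :=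
  \sum_(s < i) d (P + 2 * t + s) * f (d (P + s)).
Definition dot d f := dot1 d f P + dot2 d f (2 * t).

Definition rows_ok d i := all (fun i => dot d (tq^~ i) == cnt i) (iota 0 i).
Definition solves d := rows_ok d t && (m2 <= dot d cc + k + k).
Definition found_sol i := has (fun r => solves (digit radix r)) (iota 0 i).

Lemma rows_okS d i : rows_ok d i.+1 = rows_ok d i && (dot d (tq^~ i) == cnt i).
Proof. by rewrite /rows_ok -addn1 iotaD all_cat /= add0n andbT. Qed.

Lemma found_solS i : found_sol i.+1 = found_sol i || solves (digit radix i).
Proof. by rewrite /found_sol -addn1 iotaD has_cat /= add0n orbF. Qed.

Lemma dot1S d f i : dot1 d f i.+1 = dot1 d f i + d i * f i.
Proof. by rewrite /dot1 big_ord_recr. Qed.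

Lemma dot2S d f i :
  dot2 d f i.+1 = dot2 d f i + d (P + 2 * t + i) * f (d (P + i)).
Proof. by rewrite /dot2 big_ord_recr. Qed.

Lemma radix_le j : radix j <= 2 * n * n + 1.
Proof.
have : t * h <= n * n by apply: leq_mul => //; apply: ltnW.
rewrite /radix; case: ifP => _; first by lia.
have : n <= n * n by apply: leq_pmulr; lia.
by case: ifP => _; lia.
Qed.

Lemma radix_gt0 j : 0 < radix j.
Proof. by rewrite /radix; case: ifP => // _; case: ifP. Qed.

Definition in_box (d : nat -> nat) := forall j, j < P + 2 * t + 2 * t -> d j < radix j.

Lemma dot_term d (f : nat -> nat) j q : in_box d -> j < P + 2 * t + 2 * t ->
  (forall q, f q <= h * h) -> d j * f q <= 2 * n ^ 4.
Proof.
move=> Hd Hj Hf; have := Hd j Hj; have := radix_le j => H1 H2.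
have -> : 2 * n ^ 4 = (2 * n * n) * (n * n) by rewrite !expnS expn0; lia.
apply: leq_mul; first by lia.
by apply: leq_trans (Hf q) _; apply: leq_mul; apply: ltnW.
Qed.

Lemma dot_bound d f i j : in_box d -> (forall q, f q <= h * h) ->
  i <= P -> j <= 2 * t -> dot1 d f i + dot2 d f j <= 6 * n ^ 5.
Proof.
move=> Hd Hf Hi Hj.
have E1 : dot1 d f i <= i * (2 * n ^ 4).
  rewrite -[i in i * _]card_ord -sum_nat_const; apply: leq_sum => q _.
  by apply: dot_term => //; have := ltn_ord q; lia.
have E2 : dot2 d f j <= j * (2 * n ^ 4).
  rewrite -[j in j * _]card_ord -sum_nat_const; apply: leq_sum => q _.
  by apply: dot_term => //; have := ltn_ord q; lia.
apply: leq_trans (leq_add E1 E2) _; rewrite -mulnDl.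
have -> : 6 * n ^ 5 = 3 * n * (2 * n ^ 4) by rewrite !expnS expn0; lia.
by rewrite leq_mul2r; apply/orP; right; lia.
Qed.

Lemma M_n5 : 6 * n ^ 5 + n + n * n + 2 * n * n + 10 < M.
Proof.
have : n ^ 5 <= (n + 2) ^ 6.
  apply: leq_trans (leq_pexp2l _ (leqnSn 5)); last by lia.
  by rewrite leq_exp2r //; lia.
have E x : x ^ 6 = x * x * (x ^ 4) by rewrite !expnS expn0; lia.
have : (n + 2) * (n + 2) <= (n + 2) ^ 6.
  by rewrite E leq_pmulr // expn_gt0; lia.
have : 16 <= (n + 2) ^ 6 by apply: (@leq_trans (2 ^ 6)) => //; rewrite leq_exp2r //; lia.
move: M_n; set X := (n + 2) ^ 6; set Y := n ^ 5; lia.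
Qed.

Lemma dot_ok (F : expr -> expr) f d T s :
  vr s vP = P -> vr s vR = 2 * t -> in_box d ->
  (forall j, j < P + 2 * t + 2 * t -> ar s aDG3 j = d j) ->
  (forall q, f q <= h * h) ->
  (forall s1 e, same [:: vW; vB] [::] s s1 -> ok inp len M s1 e ->
     ev inp s1 e < P -> ok inp len M s1 (F e) /\ ev inp s1 (F e) = f (ev inp s1 e)) ->
  (forall e, ce (F e) <= ce e + T) ->
  wp (dot_prog F) (fun s1 => vr s1 vW = dot d f /\
     ck s1 <= ck s + (P + 2 * t) * (100 + T) + 50) s.
Proof.
move=> HP HR Hd Hdig Hf HF HT; have M5 := M_n5; rewrite /dot_prog; wps.
apply: wp_seq.
have PM : P + 2 * t + 2 * t < M.
  by have : n <= n * n by [apply: leq_pmulr; lia]; lia.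
apply: (wp_for (N := P) (I := fun i f' _ => f' vW = dot1 d f i)
  (T := fun _ => 30 + T)) => //=; try lia.
- by move=> s1 [A B]; rewrite A.
- by rewrite /upd /= /dot1 big_ord0.
- move=> i s1 Hi [A B] Hu H.
  have Ss : same [:: vW; vB] [::] s s1.
    split=> [x|a j _]; last by rewrite B.
    by rewrite !inE !negb_or => /andP[x1 x2]; rewrite A /= ?/upd ?(negPf x1) // !inE !negb_or x1 x2.
  have [|F1 F2] := HF s1 vB Ss I; first by rewrite /= Hu.
  have F3 := HT vB; rewrite /= Hu in F1 F2 F3.
  have D1 : ar s1 aDG3 i = d i by rewrite B //= Hdig //; lia.
  have DB := @dot_bound d f i.+1 0 Hd Hf Hi isT.
  rewrite dot1S /dot2 big_ord0 in DB.
  have DT : d i * f i <= 6 * n ^ 5 by lia.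
  wps; rewrite ?F2 ?D1; try lia; try exact: F1.
  by split; [rewrite dot1S|lia].
move=> s1 [A B] J1 H1; rewrite sum_nat_const card_ord => C1.
apply: (wp_for (N := 2 * t) (I := fun i f' _ => f' vW = dot1 d f P + dot2 d f i)
  (T := fun _ => 60 + T)) => //=; try lia.
- by move=> s2 [A2 B2]; rewrite A2 //= A.
- by rewrite /upd /= /dot2 big_ord0 addn0 H1.
- move=> i s2 Hi [A2 B2] Hu H.
  have Ss : same [:: vW; vB] [::] s s2.
    split=> [x|a j _]; last by rewrite B2 // B.
    by rewrite !inE !negb_or => /andP[x1 x2]; rewrite A2 ?A //= ?/upd ?(negPf x1) // !inE !negb_or x1 x2.
  have P2 : vr s2 vP = P by rewrite A2 //= A.
  have R2 : vr s2 vR = 2 * t by rewrite A2 //= A.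
  have D1 j : j < P + 2 * t + 2 * t -> ar s2 aDG3 j = d j.
    by move=> jl; rewrite B2 //= B //= Hdig.
  have E1 : ar s2 aDG3 (P + i) = d (P + i) by apply: D1; lia.
  have dP : d (P + i) < P.
    have := Hd (P + i); rewrite /radix.
    have -> : (P + i < P) = false by lia.
    by rewrite ltn_add2l Hi; apply; lia.
  have [||F1 F2] := HF s2 (aDG3![vP + vB])%X Ss.
  + by okt.
  + by rewrite /= Hu P2 E1.
  have F3 := HT (aDG3![vP + vB])%X; rewrite /= Hu P2 E1 in F1 F2 F3.
  have E3 : ar s2 aDG3 (P + 2 * t + i) = d (P + 2 * t + i) by apply: D1; lia.
  have DB := @dot_bound d f P i.+1 Hd Hf (leqnn _) Hi.
  rewrite dot2S in DB.
  have DT : d (P + 2 * t + i) * f (d (P + i)) <= 6 * n ^ 5 by lia.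
  wps; rewrite ?F2 ?E3; try lia; try exact: F1.
  by split; [rewrite dot2S addnA|lia].
move=> s2 [A2 B2] J2 H2; rewrite sum_nat_const card_ord => C2.
have := leq0n (T * P); have := leq0n (T * t).
split=> //; move: C1 C2 => /=; lia.
Qed.

Lemma search_body_ok (d : nat -> nat) s :
  vr s vP = P -> vr s vR = 2 * t -> vr s vT = t -> vr s vK = k -> vr s vM2 = m2 ->
  in_box d ->
  (forall j, j < P + 2 * t + 2 * t -> ar s aDG3 j = d j) ->
  (forall q, q < P -> (forall j, j < t -> ar s aTAU (q * t + j) = tq q j) /\
     ar s aCC q = cc q) ->
  (forall i, i < t -> ar s aCNT i = cnt i) ->
  wp search_body (fun s1 => vr s1 vAns = (if solves d then 1 else vr s vAns) /\
     ck s1 <= ck s + 1000 * ((t + 1) * (P + 2 * t + 1))) s.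
Proof.
move=> HP HR HT HK HM Hd Hdig Htq Hcnt; rewrite /search_body; wps; apply: wp_seq.
have M5 := M_n5.
have hh : h <= h * h by case: (h) => // h0; rewrite leq_pmulr.
have hn : h * h <= n * n by apply: leq_mul; lia.
have Pt q i : q < P -> i < t -> q * t + i < n * n.
  move=> qP it; have : q.+1 * t <= n * n by apply: leq_mul; lia.
  by rewrite mulSn; lia.
apply: (wp_for (N := t) (I := fun i f _ => f vS = rows_ok d i)
  (T := fun _ => (P + 2 * t) * 130 + 120)) => //=; try lia.
- by move=> s1 [A B]; rewrite A.
- move=> i s1 Hi [A B] Hu H; apply: wp_seq.
  refine (wp_conseq (@dot_ok (fun e => aTAU![e * vT + vA]%X) (tq^~ i) d 12 s1
     _ _ Hd _ _ _ _) _) => //=.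
  + by rewrite A.
  + by rewrite A.
  + by move=> j jl; rewrite B // Hdig.
  + by move=> q; apply: leq_trans (tq_le q i) hh.
  + move=> s2 e [A2 B2] Oe Pe.
    have T2 : vr s2 vT = t by rewrite A2 //= A.
    have A3 : vr s2 vA = i by rewrite A2.
    have X1 := Pt _ _ Pe Hi.
    okt; rewrite B2 // B // (proj1 (Htq _ Pe)) //.
  + by move=> e; lia.
  move=> s2 [A2 B2] [W2 C2].
  have A3 : vr s2 vA = i by rewrite A2.
  have N2 : ar s2 aCNT i = cnt i by rewrite B2 // B // Hcnt.
  have S2 : vr s2 vS = rows_ok d i by rewrite A2.
  apply: wp_ifeq; try okt.
    simp; rewrite N2 => E; wps; split; last by lia.
    by rewrite rows_okS E eqxx andbT.
  simp; rewrite N2 => /eqP/negPf E m Hm; wps => m' Hm'; split; last by simp; lia.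
  by simp; rewrite rows_okS E andbF.
move=> s1 [A B] J1 H1; rewrite sum_nat_const card_ord => C1; apply: wp_seq.
refine (wp_conseq (@dot_ok (fun e => aCC![e]%X) cc d 12 s1
     _ _ Hd _ cc_le _ _) _) => //=.
- by rewrite A.
- by rewrite A.
- by move=> j jl; rewrite B // Hdig.
- move=> s2 e [A2 B2] Oe Pe; okt; rewrite B2 // B // (proj2 (Htq _ Pe)) //.
- by move=> e; lia.
move=> s2 [A2 B2] [W2 C2].
have K2 : vr s2 vK = k by rewrite A2 //= A.
have M2 : vr s2 vM2 = m2 by rewrite A2 //= A.
have S2 : vr s2 vS = rows_ok d t by rewrite A2.
have Ans2 : vr s2 vAns = vr s vAns by rewrite A2 //= A.
have CB : ck s2 + 200 <= ck s + 1000 * ((t + 1) * (P + 2 * t + 1)).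
  have := leq0n (t * P); have := leq0n (t * t).
  move: C1 C2 => /=; lia.
have DB := @dot_bound d cc P (2 * t) Hd cc_le (leqnn _) (leqnn _).
have DM : dot d cc + k + k < M.
  have : 6 * n ^ 5 <= 20 * (n + 2) ^ 6.
    have : n ^ 5 <= (n + 2) ^ 6.
      apply: leq_trans (leq_pexp2l _ (leqnSn 5)); last by lia.
      by rewrite leq_exp2r //; lia.
    by set X := _ ^ 6; set Y := _ ^ 5; lia.
  move: DB M_n; rewrite -/(dot d cc); set X := _ ^ 6; set Y := _ ^ 5; lia.
rewrite /solves; apply: wp_seq; apply: wp_if; try okt.
  simp => Hlt; wps; apply: wp_if; try okt.
  simp => _; wps; rewrite leqNgt Hlt andbF; split=> //; lia.
simp => Hle; wps; rewrite Hle andbT; apply: wp_if; try okt.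
  simp; case: ifP => // _ _; wps; split=> //; lia.
simp; case: ifP => // _ _; wps; split=> //; lia.
Qed.

Lemma weight_radix : weight radix (P + 2 * t + 2 * t) =
  (2 * t * h).+1 ^ P * P ^ (2 * t) * n.+1 ^ (2 * t).
Proof.
rewrite /weight big_split_ord /= big_split_ord /=; congr (_ * _ * _).
- rewrite (eq_bigr (fun=> (2 * t * h).+1)) ?prod_nat_const ?card_ord // => j _.
  by rewrite /radix ltn_ord.
- rewrite (eq_bigr (fun=> P)) ?prod_nat_const ?card_ord // => j _.
  rewrite /radix; have -> : (P + j < P) = false by lia.
  by rewrite ltn_add2l ltn_ord.
rewrite (eq_bigr (fun=> n.+1)) ?prod_nat_const ?card_ord // => j _.
rewrite /radix; have -> : (P + 2 * t + j < P) = false by lia.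
by have -> : (P + 2 * t + j < P + 2 * t) = false by lia.
Qed.

Lemma search_ok s :
  vr s vN = n -> vr s vH = h ->
  vr s vP = P -> vr s vT = t -> vr s vK = k -> vr s vM2 = m2 -> vr s vAns = 0 ->
  (forall j, ar s aDG3 j = 0) ->
  (forall q, q < P -> (forall j, j < t -> ar s aTAU (q * t + j) = tq q j) /\
     ar s aCC q = cc q) ->
  (forall i, i < t -> ar s aCNT i = cnt i) ->
  wp search_prog (fun s1 =>
    exists2 b : bool, vr s1 vAns = b & (b <-> exists2 d, in_box d & solves d) /\
     ck s1 <= ck s + (2 * t * h).+1 ^ P * P ^ (2 * t) * n.+1 ^ (2 * t) *
       (2000 * ((t + 1) * (P + 2 * t + 1))) + 200 * (P + 2 * t + 1)) s.
Proof.
move=> HN HH HP HT HK HM HA Hz Htq Hcnt; rewrite /search_prog.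
have M5 := M_n5; have nn : n <= n * n by apply: leq_pmulr; lia.
have th : 2 * t * h <= 2 * n * n by apply: leq_mul; lia.
wps; wps; apply: wp_seq.
apply: (wp_for (N := P) (I := fun i f g => forall j, j < i -> g aBS3 j = radix j)
  (T := fun _ => 60)) => //=; try lia.
- by move=> s1 [A B]; rewrite A.
- move=> i s1 Hi [A B] Hu H.
  have H1 : vr s1 vT = t by rewrite A.
  have H2 : vr s1 vH = h by rewrite A.
  wps; split; last by lia.
  move=> j; rewrite ltnS leq_eqVlt => /orP[/eqP->|ji].
    by rewrite eqxx /radix Hi addn1.
  by rewrite (ltn_eqF ji) H.
move=> s1 [A B] J1 H; rewrite sum_nat_const card_ord => C1.
apply: wp_seq.
have R1 : vr s1 vR = 2 * t by rewrite A //= /upd /= HT.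
have P1 : vr s1 vP = P by rewrite A //= /upd /= HP.
apply: (wp_for (N := 2 * t) (I := fun i f g =>
     (forall j, j < P + i -> g aBS3 j = radix j) /\
     (forall j, j < i -> g aBS3 (P + 2 * t + j) = radix (P + 2 * t + j)))
  (T := fun _ => 60)) => //=; try lia.
- by move=> s2 [A2 B2]; rewrite A2.
- by split=> // j; rewrite addn0; apply: H.
- move=> i s2 Hi [A2 B2] Hu [G1 G2].
  have R2 : vr s2 vR = 2 * t by rewrite A2.
  have P2 : vr s2 vP = P by rewrite A2.
  have N2 : vr s2 vN = n by rewrite A2 // A.
  wps; wps; split; last by lia.
  have E1 : radix (P + i) = P.
    rewrite /radix; have -> : (P + i < P) = false by lia.
    by rewrite ltn_add2l Hi.
  have E2 : radix (P + 2 * t + i) = n.+1.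
    rewrite /radix; have -> : (P + 2 * t + i < P) = false by lia.
    by have -> : (P + 2 * t + i < P + 2 * t) = false by lia.
  split=> j jl.
    have -> : (j == P + 2 * t + i) = false by lia.
    case: (eqVneq j (P + i)) => [->|ji] /=; first by rewrite E1.
    by rewrite G1 //; lia.
  rewrite eqn_add2l; case: (eqVneq j i) => [->|ji] /=; first by rewrite E2 addn1.
  have -> : (P + 2 * t + j == P + i) = false by lia.
  by rewrite G2 //; lia.
move=> s2 [A2 B2] J2 [G1 G2]; rewrite sum_nat_const card_ord => C2.
have H3 j : j < P + 2 * t + 2 * t -> ar s2 aBS3 j = radix j.
  move=> jl; case: (ltnP j (P + 2 * t)) => H4; first exact: G1.
  by rewrite -(subnKC H4) G2 //; lia.
apply: (wp_odometer (Q := P + 2 * t + 2 * t) (b := radix)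
  (I := fun q s2 => vr s2 vAns = found_sol q)
  (Tb := 1000 * ((t + 1) * (P + 2 * t + 1)))) => //=; try lia.
- by rewrite A2 //= A //= /upd /= HP HT.
- move=> j jl; rewrite H3 // B2 // B // Hz; split=> //.
    exact: radix_gt0.
  by have := radix_le j; lia.
- by move=> q s3 s4 [A3 B3] E; rewrite A3.
- by rewrite A2 //= A //= /upd /= HA.
- move=> q s3 qW [A3 B3] D3 I3.
  have box : in_box (digit radix q).
    by move=> j _; apply: digit_lt; apply: radix_gt0.
  refine (wp_conseq (@search_body_ok (digit radix q) s3 _ _ _ _ _ box D3 _ _) _) => //=.
  + by rewrite A3 // A2 // A.
  + by rewrite A3 // A2.
  + by rewrite A3 // A2 // A.
  + by rewrite A3 // A2 // A.
  + by rewrite A3 // A2 // A.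
  + move=> q' q'P; have [X1 X2] := Htq _ q'P.
    by split=> [j jt|]; rewrite B3 // B2 // B // X1.
  + by move=> i it; rewrite B3 // B2 // B // Hcnt.
  move=> s4 _ [E4 C4]; split; last by lia.
  rewrite E4 I3 found_solS.
  by case: (solves _); rewrite ?orbT ?orbF.
move=> s3 _; rewrite weight_radix => I3 C3.
eexists; first exact: I3.
split; last first.
  apply: leq_trans C3 _; set W := _ * _ ^ _.
  have : W * (1000 * ((t + 1) * (P + 2 * t + 1)) + 80 * (P + 2 * t + 2 * t) + 80) <=
         W * (2000 * ((t + 1) * (P + 2 * t + 1))).
    by rewrite leq_mul2l; apply/orP; right; have := leq0n (t * P); have := leq0n (t * t); lia.
  move: C1 C2 => /=; rewrite /W; set Y := _ * _ ^ _; lia.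
rewrite -weight_radix; split=> [/hasP[r _ Hr]|[d Hd1 Hd2]].
  exists (digit radix r) => // j _; apply: digit_lt.
  exact: radix_gt0.
have [r rW Hr] := @digit_onto radix _ d Hd1.
apply/hasP; exists r; first by rewrite mem_iota add0n.
have DE f : dot (digit radix r) f = dot d f.
  congr (_ + _); apply: eq_bigr => q _; rewrite !Hr //; have := ltn_ord q; lia.
move: Hd2; rewrite /solves DE; congr (_ && _).
by apply: eq_all => i; rewrite DE.
Qed.
End Search.

(** * Dynamic programming over binary digits *)

Section Encode.
Variable b : nat -> nat.
Definition encode (y : nat -> nat) Q := \sum_(j < Q) y j * weight b j.

Lemma encodeS y Q : encode y Q.+1 = encode y Q + y Q * weight b Q.
Proof. by rewrite /encode big_ord_recr. Qed.

Lemma encode_lt y Q : (forall j, j < Q -> y j < b j) -> encode y Q < weight b Q.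
Proof.
elim: Q => [|Q IH] H; first by rewrite /encode /weight !big_ord0.
rewrite encodeS weightS; have := IH (fun j jQ => H j (ltnW jQ)).
have : (y Q).+1 * weight b Q <= b Q * weight b Q by rewrite leq_mul2r H ?orbT.
by rewrite mulSn (mulnC (b Q)); lia.
Qed.

Lemma encode_digit e Q : e < weight b Q -> encode (digit b e) Q = e.
Proof.
suff H : encode (digit b e) Q + e %/ weight b Q * weight b Q = e.
  by move=> eQ; rewrite -[RHS]H divn_small // mul0n addn0.
elim: Q => [|Q IH].
  by rewrite /encode /weight !big_ord0 divn1 muln1.
rewrite encodeS -[RHS]IH -addnA; congr (_ + _).
rewrite weightS divnMA /digit; set q := _ %/ weight b Q.
by rewrite [in RHS](divn_eq q (b Q)) mulnDl addnC -mulnA (mulnC (b Q)).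
Qed.

Lemma encode_inj y z Q : (forall j, j < Q -> y j < b j) ->
  (forall j, j < Q -> z j < b j) -> encode y Q = encode z Q ->
  forall j, j < Q -> y j = z j.
Proof.
elim: Q => [|Q IH] Hy Hz // E j.
have Ly := encode_lt (fun j jQ => Hy j (ltnW jQ)).
have Lz := encode_lt (fun j jQ => Hz j (ltnW jQ)).
have w0 : 0 < weight b Q by apply: leq_ltn_trans Ly.
rewrite !encodeS in E.
have E1 : encode y Q = encode z Q.
  have := congr1 (modn^~ (weight b Q)) E.
  by rewrite addnC modnMDl [in RHS]addnC modnMDl !modn_small.
have E2 : y Q = z Q.
  by move: E; rewrite E1 => /addnI/eqP; rewrite eqn_mul2r (gtn_eqF w0) => /eqP.
rewrite ltnS leq_eqVlt => /orP[/eqP-> //|].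
exact: IH (fun j jQ => Hy j (ltnW jQ)) (fun j jQ => Hz j (ltnW jQ)) E1 j.
Qed.

End Encode.

Section DigitDP.
Variables (P t h : nat) (tq : nat -> nat -> nat) (cc cnt : nat -> nat).
Hypothesis tq_le : forall q i, tq q i <= h.

Definition carry_max := P * h.
Definition dbase := (2 * carry_max).+2.
Definition bs := fun _ : nat => dbase.
Definition enc y := encode bs y t.
Definition tcode q := enc (tq q).
Definition tabsize := dbase ^ t.

Lemma weight_bs i : weight bs i = dbase ^ i.
Proof. by rewrite /weight prod_nat_const card_ord. Qed.

Definition combo (x : nat -> nat) (f : nat -> nat) := \sum_(q < P) x q * f q.

(* The [j] low binary digits of all unknowns and the next digit of the first [i]
   unknowns have been chosen; [e] encodes the vector of carries. *)
Definition reach j i e v := exists x y : nat -> nat,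
  [/\ forall q, q < P -> x q < 2 ^ (j + (q < i)),
      forall l, l < t -> combo x (tq^~ l) = cnt l %% 2 ^ j + 2 ^ j * y l,
      e = enc y & v = combo x cc].

Lemma encD y z : enc (fun l => y l + z l) = enc y + enc z.
Proof. by rewrite /enc /encode -big_split /=; apply: eq_bigr => l _; rewrite mulnDl. Qed.

Lemma enc_eq y z : (forall l, l < t -> y l = z l) -> enc y = enc z.
Proof. by move=> H; apply: eq_bigr => l _; rewrite H. Qed.

Lemma comboD x i c f : i < P ->
  combo (fun q => x q + (q == i) * c) f = combo x f + c * f i.
Proof.
move=> iP; rewrite /combo; under eq_bigr do rewrite mulnDl.
rewrite big_split /=; congr (_ + _).
rewrite (bigD1 (Ordinal iP)) //= eqxx mul1n big1 ?addn0 // => q /negPf qi.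
by have -> : (q == i :> nat) = false by [exact: qi]; rewrite !mul0n.
Qed.

Lemma reach_mono j i e v : reach j i e v -> reach j i.+1 e v.
Proof.
move=> [x [y [H1 H2 H3 H4]]]; exists x, y; split=> // q qP.
apply: leq_trans (H1 q qP) _; rewrite leq_pexp2l // leq_add2l.
by case: (ltnP q i) => // qi; have -> : q < i.+1 by lia.
Qed.

Lemma reach_step j i e v : i < P ->
  reach j i.+1 e v <->
  (reach j i e v \/ (tcode i <= e /\
     exists2 v', reach j i (e - tcode i) v' & v = v' + 2 ^ j * cc i)).
Proof.
move=> iP; split; last first.
  case=> [|[ce_ [v' [x [y [H1 H2 H3 H4]]] ->]]]; first exact: reach_mono.
  exists (fun q => x q + (q == i) * 2 ^ j), (fun l => y l + tq i l); split.
  - move=> q qP; have := H1 q qP; case: (eqVneq q i) => [->|qi].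
      by rewrite ltnn addn0 ltnSn addn1 expnS mul1n; lia.
    by rewrite mul0n addn0 ltnS [q <= i]leq_eqVlt (negPf qi).
  - by move=> l lt; rewrite comboD // H2 //; lia.
  - by rewrite encD -H3 subnK.
  by rewrite comboD // H4.
move=> [x [y [H1 H2 H3 H4]]].
have xi := H1 i iP; rewrite ltnSn addn1 expnS in xi.
case: (ltnP (x i) (2 ^ j)) => xj.
  left; exists x, y; split=> // q qP; have := H1 q qP.
  case: (eqVneq q i) => [->|qi]; first by rewrite ltnn addn0.
  by rewrite ltnS [q <= i]leq_eqVlt (negPf qi).
right; pose x' q := x q - (q == i) * 2 ^ j.
have Ex q : x q = x' q + (q == i) * 2 ^ j.
  by rewrite /x'; case: eqP => [->|_]; rewrite ?mul1n ?mul0n ?subnK ?subn0 ?addn0.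
have Ec f : combo x f = combo x' f + 2 ^ j * f i.
  by rewrite -comboD //; apply: eq_bigr => q _; rewrite Ex.
have yt l : l < t -> tq i l <= y l.
  move=> lt; have := H2 l lt; rewrite Ec => E.
  have r0 : cnt l %% 2 ^ j < 2 ^ j by rewrite ltn_mod expn_gt0.
  rewrite leqNgt; apply/negP => ly.
  have : 2 ^ j * (y l).+1 <= 2 ^ j * tq i l by rewrite leq_mul2l ly orbT.
  by rewrite mulnS; lia.
have Ee : e = enc (fun l => y l - tq i l) + tcode i.
  by rewrite H3 /tcode -encD; apply: enc_eq => l lt; rewrite subnK ?yt.
split; first by rewrite Ee leq_addl.
exists (combo x' cc); last by rewrite H4 Ec.
exists x', (fun l => y l - tq i l); split=> //.
- move=> q qP; have := H1 q qP; rewrite /x'; case: (eqVneq q i) => [->|qi].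
    by rewrite ltnn addn0 ltnSn addn1 expnS mul1n; lia.
  by rewrite mul0n subn0 ltnS [q <= i]leq_eqVlt (negPf qi).
- move=> l lt; have := H2 l lt; rewrite Ec => E.
  have := yt l lt => Hy.
  have : 2 ^ j * y l = 2 ^ j * (y l - tq i l) + 2 ^ j * tq i l.
    by rewrite -mulnDr subnK.
  by lia.
by rewrite Ee addnK.
Qed.

Lemma combo_le x c l : (forall q, q < P -> x q <= c) ->
  combo x (tq^~ l) <= c * carry_max.
Proof.
move=> H; rewrite /carry_max mulnCA -[P in P * _]card_ord -sum_nat_const.
by apply: leq_sum => q _; apply: leq_mul; rewrite ?H.
Qed.

Definition bit j l := cnt l %/ 2 ^ j %% 2.

Lemma modn_pow2S m j : m %% 2 ^ j.+1 = m %% 2 ^ j + 2 ^ j * (m %/ 2 ^ j %% 2).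
Proof.
have rl : m %% 2 ^ j < 2 ^ j by rewrite ltn_mod expn_gt0.
have bl : m %/ 2 ^ j %% 2 < 2 by rewrite ltn_mod.
have E : m = m %/ 2 ^ j %/ 2 * 2 ^ j.+1 +
    (m %% 2 ^ j + 2 ^ j * (m %/ 2 ^ j %% 2)).
  rewrite [LHS](divn_eq m (2 ^ j)) [X in X * _ + _](divn_eq _ 2) expnS; lia.
rewrite [in LHS]E modnMDl modn_small // expnS.
have : 2 ^ j * (m %/ 2 ^ j %% 2) <= 2 ^ j * 1 by rewrite leq_mul2l; lia.
by lia.
Qed.

Definition valid_code e := forall l, l < t -> digit bs e l <= carry_max.

Lemma reach_half j e v : e < tabsize ->
  reach j.+1 0 e v <->
  [/\ valid_code e, e + e + enc (bit j) < tabsize &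
      reach j P (e + e + enc (bit j)) v].
Proof.
rewrite /tabsize -weight_bs => eS.
have p0 : 0 < 2 ^ j by rewrite expn_gt0.
have bl l : bit j l < 2 by rewrite ltn_mod.
have E2 y : enc y + enc y + enc (bit j) = enc (fun l => y l + y l + bit j l).
  by rewrite !encD.
split.
  move=> [x [y [H1 H2 H3 H4]]].
  have yH l : l < t -> y l <= carry_max.
    move=> lt; have := @combo_le x (2 ^ j.+1) l _; rewrite H2 // => C.
    have {}C : 2 ^ j.+1 * y l <= 2 ^ j.+1 * carry_max.
      apply: leq_trans (leq_addl _ _) (C _) => q qP.
      by have := H1 q qP; rewrite ltn0 addn0 => /ltnW.
    by move: C; rewrite leq_mul2l expn_eq0.
  have yB l : l < t -> y l < bs l by move=> /yH; rewrite /bs /dbase; lia.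
  have dE l : l < t -> digit bs e l = y l.
    apply: (@encode_inj bs (digit bs e) y t) => //; last by rewrite encode_digit.
    by move=> l' _; apply: digit_lt.
  split.
  - by move=> l lt; rewrite dE // yH.
  - rewrite H3 E2; apply: encode_lt => l lt.
    by have := yH l lt; have := bl l; rewrite /bs /dbase; lia.
  exists x, (fun l => y l + y l + bit j l); split=> //.
  - by move=> q qP; have := H1 q qP; rewrite ltn0 qP addn0 addn1.
  - move=> l lt; rewrite H2 // modn_pow2S expnS -/(bit j l); lia.
  by rewrite H3 E2.
move=> [Hv _ [x [Y [H1 H2 H3 H4]]]].
have yS l : l < t -> Y l = digit bs e l + digit bs e l + bit j l.
  apply: (@encode_inj bs Y (fun l => digit bs e l + digit bs e l + bit j l) t).
  - move=> l' lt; have := @combo_le x (2 ^ j.+1).-1 l' _; rewrite H2 // => C.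
    have {}C : 2 ^ j * Y l' <= (2 ^ j.+1).-1 * carry_max.
      apply: leq_trans (leq_addl _ _) (C _) => q qP.
      by have := H1 q qP; rewrite qP addn1; lia.
    have {}C : 2 ^ j * Y l' <= 2 ^ j * (2 * carry_max).
      apply: leq_trans C _; rewrite mulnA (mulnC _ 2) -expnS.
      by rewrite leq_mul2r leq_pred orbT.
    by move: C; rewrite leq_mul2l expn_eq0 /bs /dbase /=; lia.
  - by move=> l' lt; have := Hv l' lt; have := bl l'; rewrite /bs /dbase; lia.
  rewrite -/(enc Y) -H3 -/(enc (fun l => digit bs e l + digit bs e l + bit j l)).
  by rewrite !encD /enc encode_digit.
exists x, (digit bs e); split=> //.
- by move=> q qP; have := H1 q qP; rewrite qP ltn0 addn0 addn1.
- move=> l lt; rewrite H2 // yS // modn_pow2S expnS -/(bit j l); lia.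
by rewrite /enc encode_digit.
Qed.

Lemma reach0 e v : e < tabsize -> reach 0 0 e v <-> (e = 0 /\ v = 0).
Proof.
move=> eS; split=> [[x [y [H1 H2 -> ->]]]|[-> ->]].
  have x0 q : q < P -> x q = 0 by move=> qP; have := H1 q qP; rewrite ltn0 addn0 expn0; lia.
  have c0 f : combo x f = 0 by apply: big1 => q _; rewrite x0.
  split=> //; apply: big1 => l _.
  by have := H2 l (ltn_ord l); rewrite c0 modn1 add0n mul1n => <-.
exists (fun _ => 0), (fun _ => 0); split.
- by move=> q _; rewrite expn_gt0.
- by move=> l _; rewrite modn1 /combo big1.
- by rewrite /enc /encode big1.
by rewrite /combo big1.
Qed.

Lemma reach_final j v : (forall l, l < t -> cnt l < 2 ^ j) ->
  reach j 0 0 v <-> exists x, [/\ forall q, q < P -> x q < 2 ^ j,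
    forall l, l < t -> combo x (tq^~ l) = cnt l & v = combo x cc].
Proof.
move=> Hc; split=> [[x [y [H1 H2 H3 H4]]]|[x [H1 H2 H3]]].
  exists x; split=> //.
    by move=> q qP; have := H1 q qP; rewrite ltn0 addn0.
  move=> l lt; rewrite H2 // modn_small ?Hc //.
  suff -> : y l = 0 by rewrite muln0 addn0.
  have : y l * weight bs l <= enc y by rewrite /enc /encode (bigD1 (Ordinal lt)) //= leq_addr.
  rewrite -H3 leqn0 muln_eq0 weight_bs expn_eq0 orbF.
  by move=> /eqP.
exists x, (fun _ => 0); split=> //.
- by move=> q qP; have := H1 q qP; rewrite ltn0 addn0.
- by move=> l lt; rewrite H2 // modn_small ?Hc // muln0 addn0.
by rewrite /enc /encode big1.
Qed.

(* [T e = v.+1] when [v] is the greatest reachable value, [T e = 0] when there is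
   none. *)
Definition is_table (T : nat -> nat) (R : nat -> nat -> Prop) :=
  forall e, e < tabsize -> (forall v, R e v -> v < T e) /\
    (0 < T e -> R e (T e).-1).

Lemma reach_value j i e v : reach j i e v -> v <= 2 ^ j.+1 * \sum_(q < P) cc q.
Proof.
move=> [x [y [H1 _ _ ->]]]; rewrite /combo big_distrr /=; apply: leq_sum => q _.
rewrite leq_mul2r; apply/orP; right; apply: ltnW; apply: leq_trans (H1 q _) _ => //.
by rewrite leq_pexp2l //; case: (_ < _); lia.
Qed.

Definition relax (T : nat -> nat) c w e :=
  if e < c then T e else
  if (0 < T (e - c)) && (T e < T (e - c) + w) then T (e - c) + w else T e.

Lemma relax_table T j i : i < P -> is_table T (reach j i) ->
  is_table (relax T (tcode i) (2 ^ j * cc i)) (reach j i.+1).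
Proof.
move=> iP HT e eS; have [H1 H2] := HT e eS; rewrite /relax.
case: (ltnP e (tcode i)) => ce_.
  split=> [v /(reach_step _ _ _ iP)[/H1//|[]]|/H2]; first by lia.
  exact: reach_mono.
have e'S : e - tcode i < tabsize by apply: leq_ltn_trans eS; apply: leq_subr.
have [H3 H4] := HT _ e'S.
case: ifP => [/andP[T0 Tl]|Hn].
  split=> [v /(reach_step _ _ _ iP)[/H1|[_ [v' /H3 ? ->]]]|_]; try by lia.
  apply/(reach_step _ _ _ iP); right; split=> //.
  by exists (T (e - tcode i)).-1; [exact: H4|lia].
split=> [v /(reach_step _ _ _ iP)[/H1//|[_ [v' /[dup] R' /H3 ? ->]]]|/H2].
  by move: Hn; case: (posnP (T (e - tcode i))) => /=; lia.
exact: reach_mono.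
Qed.

End DigitDP.

Notation aE := 23 (only parsing).
Notation aVAL := 24 (only parsing).
Notation aTB := 25 (only parsing).
Notation aBC := 26 (only parsing).
Notation vDD := 28 (only parsing).
Notation vSS := 29 (only parsing).
Notation vHH := 30 (only parsing).
Notation vL := 31 (only parsing).
Notation vY := 32 (only parsing).
Notation vZ := 33 (only parsing).

Definition codes_prog :=
  For vA vP (
    vW <~ EK 0;; vX <~ EK 1;;
    For vB vT (
      vW <~ vW + aTAU![vA * vT + vB] * vX;; vX <~ vX * vDD);;
    aE =[vA]= vW).

Definition valid_prog :=
  aVAL =[EK 0]= EK 1;;
  For vA vSS (
    If vHH (vA - (vA / vDD) * vDD) (aVAL =[vA]= EK 0)
      (aVAL =[vA]= aVAL![vA / vDD])).

Definition relax_prog :=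
  For vA vP (
    vC <~ vL * aCC![vA];;
    vY <~ vSS;;
    For vB vSS (
      vY <~ vY - EK 1;;
      If vY aE![vA] Skip (
        vZ <~ aTB![vY - aE![vA]];;
        If (EK 0) vZ (If aTB![vY] (vZ + vC) (aTB =[vY]= vZ + vC) Skip) Skip))).

Definition half_prog :=
  vW <~ EK 0;; vX <~ EK 1;;
  For vB vT (
    vW <~ vW + (aBC![vB] - aBC![vB] / EK 2 * EK 2) * vX;;
    aBC =[vB]= aBC![vB] / EK 2;;
    vX <~ vX * vDD);;
  For vB vSS (
    If (EK 0) aVAL![vB] (
      vZ <~ vB + vB + vW;;
      If vZ vSS (aTB =[vB]= aTB![vZ]) (aTB =[vB]= EK 0))
    (aTB =[vB]= EK 0)).

Definition dp_prog :=
  codes_prog;; valid_prog;;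
  For vA vT (aBC =[vA]= aCNT![vA]);;
  aTB =[EK 0]= EK 1;;
  vL <~ EK 1;;
  While vL (vN + EK 1) (relax_prog;; half_prog;; vL <~ vL + vL);;
  If (EK 0) aTB![EK 0] (If vM2 (aTB![EK 0] + vK + vK) (vAns <~ EK 1) Skip) Skip.

Section DP.
Variables (inp : nat -> nat) (len M n h k m2 t P : nat).
Variables (tq : nat -> nat -> nat) (cc cnt : nat -> nat).
Notation wp := (wp inp len M).
Notation D := (dbase P h).
Notation H := (carry_max P h).
Notation S := (tabsize P t h).
Notation enc := (enc P t h).
Notation tcode := (tcode P t h tq).
Notation bs := (bs P h).
Notation reach := (reach P t h tq cc cnt).
Notation is_table := (is_table P t h).
Notation bit := (bit cnt).
Notation valid_code := (valid_code P t h).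

Hypothesis h_lt : h < n.
Hypothesis t_le : t <= n.
Hypothesis P_gt0 : 0 < P.
Hypothesis P_le : P <= n.
Hypothesis tq_le : forall q i, tq q i <= h.
Hypothesis cc_le : forall q, cc q <= h * h.
Hypothesis cnt_le : forall i, i < t -> cnt i <= n.
Hypothesis M_S : 4 * S + len + 10 < M.
Hypothesis M_n : 10 * (n + 2) ^ 4 + k + k < M.

Lemma hH : h <= H.
Proof. by rewrite /carry_max leq_pmull. Qed.

Lemma powD_le i : i <= t -> D ^ i <= S.
Proof. by move=> it; rewrite /tabsize leq_pexp2l. Qed.

Lemma encode_lt_pow y i : (forall l, l < i -> y l < D) -> encode bs y i < D ^ i.
Proof. by move=> Hy; rewrite -(weight_bs P h i); apply: encode_lt. Qed.

Lemma n4 : n * n * (n * n) <= (n + 2) ^ 4.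
Proof.
have -> : n * n * (n * n) = n ^ 4 by rewrite !expnS expn0; lia.
by rewrite leq_exp2r // leq_addr.
Qed.

Lemma n2 : (n + 2) * (n + 2) <= (n + 2) ^ 4.
Proof.
have -> : (n + 2) ^ 4 = (n + 2) * (n + 2) * ((n + 2) * (n + 2)).
  by rewrite !expnS expn0; lia.
by rewrite leq_pmulr // muln_gt0; lia.
Qed.

Lemma M_n2 : 10 * ((n + 2) * (n + 2)) < M.
Proof. have := n2; move: M_n; set X := _ ^ 4; lia. Qed.

Lemma codes_ok s : vr s vP = P -> vr s vT = t -> vr s vDD = D ->
  (forall q, q < P -> forall j, j < t -> ar s aTAU (q * t + j) = tq q j) ->
  wp codes_prog (fun s1 => (forall q, q < P -> ar s1 aE q = tcode q) /\
     ck s1 <= ck s + P * (100 * t + 100) + 20) s.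
Proof.
move=> HP HT HD Htq; rewrite /codes_prog; have M2 := M_n2.
apply: (wp_for (N := P) (I := fun i _ g => forall q, q < i -> g aE q = tcode q)
  (T := fun _ => 80 * t + 60)) => //=; try lia.
- by move=> s1 [A B]; rewrite A.
- move=> i s1 Hi [A B] Hu G; wps; wps; apply: wp_seq.
  apply: (wp_for (N := t) (I := fun j f _ => f vW = encode bs (tq i) j /\
     f vX = D ^ j) (T := fun _ => 60)) => //=; try lia.
  + by move=> s2 [A2 B2]; rewrite A2 //= /upd /= A.
  + by rewrite /upd /= /encode big_ord0.
  + move=> j s2 Hj [A2 B2] J2 [W2 X2].
    have D2 : vr s2 vDD = D by rewrite A2 //= /upd /= A.
    have T2 : vr s2 vT = t by rewrite A2 //= /upd /= A.
    have A3 : vr s2 vA = i by rewrite A2.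
    have E2 : ar s2 aTAU (i * t + j) = tq i j by rewrite B2 //= B // Htq.
    have E3 : encode bs (tq i) j.+1 < S.
      apply: leq_trans (powD_le Hj); apply: encode_lt_pow => l _.
      by apply: leq_ltn_trans (tq_le _ _) _; have := hH; rewrite /dbase; lia.
    have E4 := powD_le Hj; have E5 := powD_le (ltnW Hj).
    rewrite encodeS weight_bs in E3; rewrite expnSr in E4.
    have ij : i * t + j < n * n.
      have : i.+1 * t <= n * n by apply: leq_mul; lia.
      by rewrite mulSn; lia.
    have it : i * t <= n * n by lia.
    have D0 : 0 < D ^ j by rewrite expn_gt0.
    wps; rewrite ?E2; try lia.
    wps; split; last by lia.
    by rewrite encodeS weight_bs expnSr.
  move=> s2 [A2 B2] J2 [W2 X2]; rewrite sum_nat_const card_ord => C2.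
  have A3 : vr s2 vA = i by rewrite A2.
  wps; split; last by lia.
  move=> q; rewrite ltnS leq_eqVlt => /orP[/eqP->|qi]; first by rewrite eqxx.
  by rewrite (ltn_eqF qi) B2 //= G.
move=> s1 _ _ G; rewrite sum_nat_const card_ord => C1; split=> //; lia.
Qed.

Lemma valid_ok s : vr s vSS = S -> vr s vDD = D -> vr s vHH = H ->
  wp valid_prog (fun s1 => (forall e, e < S ->
      exists2 b : bool, ar s1 aVAL e = b & (b <-> valid_code e)) /\
     ck s1 <= ck s + 100 * S + 50) s.
Proof.
move=> HS HD HH; rewrite /valid_prog; wps.
have dS e l : digit bs e l.+1 = digit bs (e %/ D) l.
  by rewrite /digit !weight_bs expnS divnMA.
have d0 e : digit bs e 0 = e %% D by rewrite /digit weight_bs divn1.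
have vS e : e < S -> (e %% D <= H) && true /\ valid_code (e %/ D) <-> valid_code e.
  move=> eS; rewrite andbT; split.
    move=> [V0 V] [|l] lt; first by rewrite d0.
    by rewrite dS; apply: V; lia.
  move=> V; case: (posnP t) => [t0|t0].
    have -> : e = 0 by move: eS; rewrite /tabsize t0 expn0; lia.
    by rewrite mod0n; split=> // l; rewrite t0.
  split; first by rewrite -d0; apply: V.
  move=> l lt; case: (ltnP l.+1 t) => lt'; first by rewrite -dS; apply: V.
  have El : l.+1 = t by lia.
  rewrite /digit weight_bs -divnMA -expnS El divn_small //.
apply: (wp_for (N := S) (I := fun i _ g =>
   (forall e, e < i -> exists2 b : bool, g aVAL e = b & (b <-> valid_code e)) /\
   g aVAL 0 = 1) (T := fun _ => 60)) => //=; try lia.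
- by move=> s1 [A B]; rewrite A.
- move=> i s1 Hi [A B] Hu [G G0].
  have S1 : vr s1 vDD = D by rewrite A.
  have H1 : vr s1 vHH = H by rewrite A.
  have dv : i %/ D * D <= i by apply: leq_trunc_div.
  have dl : i %/ D <= i by apply: leq_div.
  have E : i - i %/ D * D = i %% D by rewrite {1}(divn_eq i D) addKn.
  have [V1 V2] := vS i Hi; rewrite andbT in V1 V2.
  apply: wp_if; try okt.
    simp; rewrite E => Hlt; wps; split; last by lia.
    split; last first.
      case: eqP => // i0; move: Hlt; rewrite -i0 mod0n; lia.
    move=> e; rewrite ltnS leq_eqVlt => /orP[/eqP->|ei].
      by rewrite eqxx; exists false => //; split=> // /V2[]; lia.
    by rewrite (ltn_eqF ei); apply: G.
  simp; rewrite E => Hle; wps; split; last by lia.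
  split; last first.
    by case: eqP => // <-; rewrite div0n.
  move=> e; rewrite ltnS leq_eqVlt => /orP[/eqP->|ei].
    rewrite eqxx; case: (posnP i) => [i0|i0].
      exists true; first by rewrite i0 div0n.
      by split=> // _; apply: V1; rewrite i0 div0n mod0n; split=> // l _; rewrite digit0.
    have [b Eb Vb] := G (i %/ D) (ltn_Pdiv (isT : 1 < D) i0).
    exists b => //; rewrite Vb; split=> [?|/V2[]//]; exact: V1.
  by rewrite (ltn_eqF ei); apply: G.
move=> s1 _ _ [G _]; rewrite sum_nat_const card_ord => C1; split=> //; lia.
Qed.

Lemma value_le j T e : 2 ^ j <= n -> e < S ->
  forall i, i <= P -> is_table T (reach j i) -> T e <= 2 * (n * n * (n * n)) + 1.
Proof.
move=> jn eS i iP /(_ e eS)[_]; case: (T e) => // v /(_ isT) /reach_value /= V.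
rewrite addn1 ltnS; apply: leq_trans V _; rewrite expnS -!mulnA leq_mul2l /=.
apply: leq_mul => //; apply: (@leq_trans (P * (h * h))).
  by rewrite -[P in P * _]card_ord -sum_nat_const; apply: leq_sum.
by apply: leq_mul => //; apply: leq_mul; apply: ltnW.
Qed.

Lemma M_n4 : 6 * (n * n * (n * n)) + k + k + 10 < M.
Proof.
have := n4; have := n2; have : n <= n * n by apply: leq_pmulr; lia.
move: M_n; set X := _ ^ 4; set Y := n * n * (n * n); lia.
Qed.

Lemma relax_ok j s : vr s vP = P -> vr s vSS = S -> vr s vL = 2 ^ j -> 2 ^ j <= n ->
  (forall q, q < P -> ar s aE q = tcode q /\ ar s aCC q = cc q) ->
  is_table (ar s aTB) (reach j 0) ->
  wp relax_prog (fun s1 => is_table (ar s1 aTB) (reach j P) /\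
     ck s1 <= ck s + P * (200 * S + 200) + 20) s.
Proof.
move=> HP HS HL jn Hec HT; rewrite /relax_prog.
have M2 := M_n2; have M4 := M_n4.
apply: (wp_for (N := P) (I := fun i _ g => is_table (g aTB) (reach j i))
  (T := fun _ => 150 * S + 100)) => //=; try lia.
- by move=> s1 [A B]; rewrite A.
- move=> i s1 Hi [A B] Hu HT1.
  have L1 : vr s1 vL = 2 ^ j by rewrite A.
  have S1 : vr s1 vSS = S by rewrite A.
  have [E1 C1] : ar s1 aE i = tcode i /\ ar s1 aCC i = cc i.
    by rewrite !B //; apply: Hec.
  have cb : cc i <= n * n by apply: leq_trans (cc_le i) _; apply: leq_mul; apply: ltnW.
  have wb : 2 ^ j * cc i <= n * n * (n * n).
    rewrite mulnC; apply: leq_mul => //; apply: leq_trans jn _.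
    by apply: leq_pmulr; lia.
  set w := 2 ^ j * cc i in wb *.
  wps; rewrite ?C1; try lia; wps.
  apply: (wp_for (N := S) (I := fun b f g => f vY = S - b /\
     forall e, e < S -> g aTB e = if e < S - b then ar s1 aTB e else
       relax (ar s1 aTB) (tcode i) w e) (T := fun _ => 110)) => //=; try lia.
  + by move=> s2 [A2 B2]; rewrite A2.
  + by rewrite /upd /= subn0; split=> // e ->.
  + move=> b s2 Hb [A2 B2] J2 [Y2 G2].
    have A3 : vr s2 vA = i by rewrite A2.
    have C2 : vr s2 vC = w by rewrite A2.
    have E2 : ar s2 aE i = tcode i by rewrite B2.
    set y := S - b.+1.
    have yE : S - b - 1 = y by rewrite /y; lia.
    have yS : y < S by rewrite /y; lia.
    have Ty e : e <= y -> ar s2 aTB e = ar s1 aTB e.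
      move=> ey; have eb : e < S - b by move: ey yS; rewrite /y; lia.
      by rewrite G2 ?eb //; apply: leq_ltn_trans yS.
    have V e : e <= y -> ar s1 aTB e <= 2 * (n * n * (n * n)) + 1.
      move=> ey; exact: (@value_le j (ar s1 aTB) e jn (leq_ltn_trans ey yS) i (ltnW Hi) HT1).
    have step g : (forall e, e < S -> g aTB e = if e == y then
          relax (ar s1 aTB) (tcode i) w y else ar s2 aTB e) ->
        forall e, e < S -> g aTB e = if e < y then ar s1 aTB e else
          relax (ar s1 aTB) (tcode i) w e.
      move=> Hg e eS; rewrite Hg //; case: (eqVneq e y) => [->|ey].
        by rewrite ltnn.
      have -> : (e < y) = (e < S - b) by move: ey; rewrite /y; lia.
      exact: G2.
    have Vy := V y (leqnn y).
    wps; rewrite yE; apply: wp_if; try okt.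
      simp; rewrite E2 => Hlt; wps; split; last by lia.
      split=> //; apply: step => e eS; case: eqP => [->|//].
      by rewrite Ty // /relax Hlt.
    simp; rewrite E2 => Hge; wps; rewrite E2.
    rewrite (Ty (y - tcode i)) ?leq_subr //.
    have Vc := V (y - tcode i) (leq_subr _ _).
    apply: wp_if; try okt.
      simp => Hpos; apply: wp_if; try okt.
        simp; rewrite Ty // => Hlt; wps; split; last by lia.
        split=> //; apply: (step (fun a e => if (a == 25) && (e == y) then _ else ar s2 a e)) => e eS /=; case: eqP => // _.
        by rewrite /relax ltnNge Hge /= Hpos Hlt.
      simp; rewrite Ty // => Hle; wps; split; last by lia.
      split=> //; apply: step => e eS; case: eqP => [->|//].
      by rewrite Ty // /relax ltnNge Hge /= Hpos ltnNge Hle.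
    simp => H0; wps; split; last by lia.
    split=> //; apply: step => e eS; case: eqP => [->|//].
    by rewrite Ty // /relax ltnNge Hge /= ltnNge H0.
  move=> s2 [A2 B2] J2 [Y2 G2]; rewrite sum_nat_const card_ord => C2.
  split; last by move: C2 => /=; lia.
  have HR := relax_table Hi HT1.
  by move=> e eS; rewrite G2 // subnn /=; apply: HR.
move=> s1 _ _ G; rewrite sum_nat_const card_ord => C1; split=> //.
have := leq0n (P * S); lia.
Qed.

Lemma half_ok j s : vr s vT = t -> vr s vSS = S -> vr s vDD = D ->
  (forall e, e < S -> exists2 b : bool, ar s aVAL e = b & (b <-> valid_code e)) ->
  (forall l, l < t -> ar s aBC l = cnt l %/ 2 ^ j) ->
  is_table (ar s aTB) (reach j P) ->
  wp half_prog (fun s1 => [/\ is_table (ar s1 aTB) (reach j.+1 0),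
     forall l, l < t -> ar s1 aBC l = cnt l %/ 2 ^ j.+1 &
     ck s1 <= ck s + 200 * (S + t + 1)]) s.
Proof.
move=> HT HS HD HV HB Htab; rewrite /half_prog; have M2 := M_n2.
wps; wps; apply: wp_seq.
apply: (wp_for (N := t) (I := fun i f g => [/\ f vW = encode bs (bit j) i,
    f vX = D ^ i & forall l, l < t -> g aBC l = cnt l %/ 2 ^ (if l < i then j.+1 else j)])
  (T := fun _ => 80)) => //=; try lia.
- by move=> s1 [A B]; rewrite A.
- by rewrite /upd /= /encode big_ord0.
- move=> i s1 Hi [A B] Hu [W1 X1 B1].
  have D1 : vr s1 vDD = D by rewrite A.
  have Bi := B1 i Hi; rewrite ltnn in Bi.
  have bE : ar s1 aBC i - ar s1 aBC i %/ 2 * 2 = bit j i.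
    by rewrite Bi /bit [X in X - _](divn_eq _ 2) addKn.
  have dv : ar s1 aBC i %/ 2 * 2 <= ar s1 aBC i by apply: leq_trunc_div.
  have bn : ar s1 aBC i <= n.
    by rewrite Bi; apply: leq_trans (leq_div _ _) (cnt_le Hi).
  have E3 : encode bs (bit j) i.+1 < S.
    apply: leq_trans (powD_le Hi); apply: encode_lt_pow => l _.
    by apply: (@leq_trans 2); rewrite ?ltn_mod.
  have E4 := powD_le Hi; have E5 := powD_le (ltnW Hi).
  rewrite encodeS weight_bs in E3; rewrite expnSr in E4.
  have b2 : bit j i < 2 by rewrite ltn_mod.
  have bD : bit j i * D ^ i <= D ^ i by rewrite -[leqRHS]mul1n leq_mul2r; lia.
  wps; rewrite ?bE; try lia.
  wps; wps; split; last by lia.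
  split; first by rewrite encodeS weight_bs.
    by rewrite expnSr.
  move=> l lt; case: (eqVneq l i) => [->|li]; rewrite ?eqxx.
    by rewrite ltnSn Bi expnSr divnMA.
  by rewrite B1 // [l < i.+1]ltnS [l <= i]leq_eqVlt (negPf li).
move=> s1 [A B] J1 [W1 X1 B1]; rewrite sum_nat_const card_ord => C1.
have WS : encode bs (bit j) t < S.
  by apply: encode_lt_pow => l _; apply: (@leq_trans 2); rewrite ?ltn_mod.
have T1 e : ar s1 aTB e = ar s aTB e by rewrite B.
have V1 e : ar s1 aVAL e = ar s aVAL e by rewrite B.
apply: (wp_for (N := S) (I := fun i f g =>
     (forall e, i <= e -> g aTB e = ar s aTB e) /\
     (forall e, e < i -> (forall v, reach j.+1 0 e v -> v < g aTB e) /\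
        (0 < g aTB e -> reach j.+1 0 e (g aTB e).-1)))
  (T := fun _ => 100)) => //=; try lia.
- by move=> s2 [A2 B2]; rewrite A2 // A.
- move=> i s2 Hi [A2 B2] Hu [G1 G2].
  have SS2 : vr s2 vSS = S by rewrite A2 // A.
  have WW2 : vr s2 vW = enc (bit j) by rewrite A2.
  have VV2 : ar s2 aVAL i = ar s aVAL i by rewrite B2 // V1.
  have [b Eb Vb] := HV i Hi.
  have RH v := @reach_half P t h tq cc cnt tq_le j i v Hi.
  rewrite -/(enc (bit j)) in WS.
  have fin g x : g aTB = upd (ar s2 aTB) i x ->
      (forall v, reach j.+1 0 i v -> v < x) -> (0 < x -> reach j.+1 0 i x.-1) ->
      (forall e, i.+1 <= e -> g aTB e = ar s aTB e) /\
      (forall e, e < i.+1 -> (forall v, reach j.+1 0 e v -> v < g aTB e) /\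
        (0 < g aTB e -> reach j.+1 0 e (g aTB e).-1)).
    move=> Eg F1 F2; rewrite Eg /upd; split=> e.
      by move=> ie; rewrite gtn_eqF // G1 // ltnW.
    rewrite ltnS leq_eqVlt; case: (eqVneq e i) => [-> _|_ /=]; first by split.
    exact: G2.
  apply: wp_if; try okt.
    simp; rewrite VV2 Eb lt0b => bT; wps; apply: wp_if; try okt.
      simp => zS; wps; split; last by lia.
      apply: (fin (fun a e => if (a == 25) && (e == i) then _ else ar s2 a e)).
      + by [].
      + have [H1 _] := Htab _ zS; rewrite G1 -?addnA ?leq_addr // addnA.
        by move=> v /RH[_ _ /H1].
      rewrite G1 -?addnA ?leq_addr // addnA => H2.
      by apply/RH; split=> //; [apply/Vb|apply: (Htab _ zS).2].
    simp => zS; wps; split; last by lia.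
    apply: (fin (fun a e => if (a == 25) && (e == i) then 0 else ar s2 a e)) => //.
    by move=> v /RH[_]; lia.
  simp; rewrite VV2 Eb leqNgt lt0b => bF; wps; split; last by lia.
  apply: (fin (fun a e => if (a == 25) && (e == i) then 0 else ar s2 a e)) => //.
  by move=> v /RH[/Vb]; rewrite (negPf bF).
move=> s2 [A2 B2] J2 [_ G2]; rewrite sum_nat_const card_ord => C2; split.
- by move=> e eS; apply: G2.
- by move=> l lt; rewrite B2 // B1 // lt.
move: C1 C2 => /=; lia.
Qed.

Lemma dp_ok s : vr s vN = n -> vr s vP = P -> vr s vT = t -> vr s vK = k ->
  vr s vM2 = m2 -> vr s vAns = 0 -> vr s vSS = S -> vr s vDD = D -> vr s vHH = H ->
  (forall e, ar s aTB e = 0) ->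
  (forall q, q < P -> (forall j, j < t -> ar s aTAU (q * t + j) = tq q j) /\
     ar s aCC q = cc q) ->
  (forall i, i < t -> ar s aCNT i = cnt i) ->
  wp dp_prog (fun s1 =>
    exists2 b : bool, vr s1 vAns = b & (b <-> exists x,
       [/\ forall q, q < P -> x q < 2 ^ (trunc_log 2 n).+1,
         forall l, l < t -> combo P x (tq^~ l) = cnt l &
         m2 <= combo P x cc + k + k]) /\
     ck s1 <= ck s + (trunc_log 2 n).+1 * (1000 * ((P + 1) * (S + 1) + t)) +
       1000 * ((P + 1) * (S + t + 1))) s.
Proof.
move=> HN HP HT HK HM HA HS HD HH Htb Htq Hcnt; rewrite /dp_prog.
have M2 := M_n2; have M4 := M_n4; have n0 : 0 < n by lia.
apply: wp_seq; refine (wp_conseq (codes_ok HP HT HD (fun q qP => (Htq q qP).1)) _) => /=.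
move=> s1 [A1 B1] [G1 C1]; apply: wp_seq.
have S1 : vr s1 vSS = S by rewrite A1.
have D1 : vr s1 vDD = D by rewrite A1.
have H1 : vr s1 vHH = H by rewrite A1.
refine (wp_conseq (valid_ok S1 D1 H1) _) => /=.
move=> s2 [A2 B2] [G2 C2]; apply: wp_seq.
apply: (wp_for (N := t) (I := fun i f g => forall l, l < i -> g aBC l = cnt l)
  (T := fun _ => 40)) => //=; try lia.
- by move=> s3 [A3 B3]; rewrite A3 // A2 // A1.
- move=> i s3 Hi [A3 B3] J3 G3; wps; split; last by lia.
  move=> l; rewrite ltnS leq_eqVlt => /orP[/eqP->|li].
    by rewrite eqxx B3 // B2 // B1 // Hcnt.
  by rewrite (ltn_eqF li) G3.
move=> s3 [A3 B3] J3 G3; rewrite sum_nat_const card_ord => C3.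
wps; wps; apply: wp_seq.
have tl : 2 ^ trunc_log 2 n <= n by apply: trunc_logP.
have tl' : n < 2 ^ (trunc_log 2 n).+1 by apply: trunc_log_ltn.
have Vx x : x \notin [:: 23; 25; 13; 24; 23; 23; 0; 31] -> vr s3 x = vr s x.
  move=> Hx; rewrite A3 ?A2 ?A1 //; move: Hx; rewrite ?inE ?negb_or; lia.
apply: (wp_while (N := (trunc_log 2 n).+1) (I := fun j s4 =>
    [/\ vr s4 vL = 2 ^ j, is_table (ar s4 aTB) (reach j 0) &
      forall l, l < t -> ar s4 aBC l = cnt l %/ 2 ^ j])
  (T := fun _ => 900 * ((P + 1) * (S + 1) + t))).
- split=> [|e eS|l lt] /=; rewrite /upd /= /aupd /=.
  + by [].
  + split=> [v /(reach0 _ _ _ _ eS)[-> ->]|]; first by rewrite eqxx.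
    case: eqP => [e0 _|_]; first by apply/(reach0 _ _ _ _ eS); rewrite e0.
    by rewrite B3 // B2 // B1 // Htb.
  by rewrite divn1 G3.
- move=> j s4 jN [A4 B4] [L4 _ _].
  have N4 : vr s4 vN = n by rewrite A4 //= /upd /= Vx.
  okt; rewrite addn1 ltnS; apply/idP/idP => [jn|jl].
    rewrite ltnNge; apply/negP => jl.
    by have := leq_trans tl' (leq_trans (leq_pexp2l (isT : 0 < 2) jl) jn); rewrite ltnn.
  by apply: leq_trans tl; rewrite leq_pexp2l.
- move=> j s4 jN [A4 B4] [L4 T4 BC4].
  have jn : 2 ^ j <= n by apply: leq_trans tl; rewrite leq_pexp2l.
  apply: wp_seq.
  have P4 : vr s4 vP = P by rewrite A4 //= /upd /= Vx.
  have S4 : vr s4 vSS = S by rewrite A4 //= /upd /= Vx.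
  have D4 : vr s4 vDD = D by rewrite A4 //= /upd /= Vx.
  have TT4 : vr s4 vT = t by rewrite A4 //= /upd /= Vx.
  have Q4 q : q < P -> ar s4 aE q = tcode q /\ ar s4 aCC q = cc q.
    move=> qP; rewrite !B4 //= /aupd /= !B3 // !B2 // G1 // B1 //.
    by split=> //; case: (Htq q qP).
  refine (wp_conseq (@relax_ok j (tick s4 (ce vL + ce (vN + EK 1)%X + 1))
     P4 S4 L4 jn Q4 T4) _) => /=.
  move=> s5 [A5 B5] [T5 C5]; apply: wp_seq.
  have TT5 : vr s5 vT = t by rewrite A5.
  have S5 : vr s5 vSS = S by rewrite A5.
  have D5 : vr s5 vDD = D by rewrite A5.
  have V5 e : e < S -> exists2 b : bool, ar s5 aVAL e = b & (b <-> valid_code e).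
    by move=> eS; rewrite B5 // B4 //= /aupd /= B3 //; apply: G2.
  have BC5 l : l < t -> ar s5 aBC l = cnt l %/ 2 ^ j by move=> lt; rewrite B5 //= BC4.
  refine (wp_conseq (half_ok TT5 S5 D5 V5 BC5 T5) _) => /=.
  move=> s6 [A6 B6] [T6 BC6 C6].
  have L6 : vr s6 vL = 2 ^ j by rewrite A6 // A5.
  wps.
  split; first by split=> //=; rewrite expnS; lia.
  have := leq0n (P * S); move: C5 C6 => /=; lia.
move=> s4 [A4 B4] [L4 T4 BC4]; rewrite sum_nat_const card_ord => C4.
have K4 : vr s4 vK = k by rewrite A4 //= /upd /= Vx.
have MM4 : vr s4 vM2 = m2 by rewrite A4 //= /upd /= Vx.
have Ans4 : vr s4 vAns = 0 by rewrite A4 //= /upd /= Vx.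
have S0 : 0 < S by rewrite /tabsize expn_gt0.
have [R1 R2] := T4 0 S0.
have V0 : ar s4 aTB 0 <= 4 * (n * n * (n * n)) + 1.
  case E : (ar s4 aTB 0) R2 => [//|v] /(_ isT) /= [x [y [Hx _ _ ->]]].
  rewrite addn1 ltnS; apply: (@leq_trans (\sum_(q < P) (2 * n) * (n * n))).
    apply: leq_sum => q _; apply: leq_mul.
      have := Hx q (ltn_ord q); rewrite ltn0 addn0 expnS; lia.
    by apply: leq_trans (cc_le q) _; apply: leq_mul; apply: ltnW.
  rewrite sum_nat_const card_ord; apply: (@leq_trans (n * (2 * n * (n * n)))).
    by rewrite leq_mul2r P_le orbT.
  lia.
have RF v := @reach_final P t h tq cc cnt (trunc_log 2 n).+1 v
  (fun l lt => leq_ltn_trans (cnt_le lt) tl').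
have CK : ck s4 + 200 <= ck s + (trunc_log 2 n).+1 *
      (1000 * ((P + 1) * (S + 1) + t)) + 1000 * ((P + 1) * (S + t + 1)).
  have : (trunc_log 2 n).+1 * (900 * ((P + 1) * (S + 1) + t) + 3) <=
     (trunc_log 2 n).+1 * (1000 * ((P + 1) * (S + 1) + t)).
    by rewrite leq_mul2l; apply/orP; right; have := leq0n (P * S); lia.
  have := leq0n (P * S); have := leq0n (P * t).
  move: C1 C2 C3 C4 => /=; set Z := _.+1 * _; set Z' := _.+1 * _; lia.
apply: wp_if; try okt.
  simp => T0; apply: wp_if; try okt.
    simp => Hlt; wps; exists true => //; split; last by lia.
    split=> // _.
    have /RF[x [X1 X2 X3]] := R2 T0; exists x; split=> //.
    by rewrite -X3; lia.
  simp => Hle; wps; exists false => //; split; last by lia.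
  split=> // -[x [X1 X2 X3]].
  have /R1 : reach (trunc_log 2 n).+1 0 0 (combo P x cc) by apply/RF; exists x.
  by lia.
simp => T0; wps; exists false => //; split; last by lia.
split=> // -[x [X1 X2 X3]].
have /R1 : reach (trunc_log 2 n).+1 0 0 (combo P x cc) by apply/RF; exists x.
by lia.
Qed.
End DP.

(** * Twin classes and component types *)

Section TwinClasses.
Variables (n : nat) (nb : nat -> seq nat).
Hypothesis nb_lt : forall u v, u < n -> v \in nb u -> v < n.
Hypothesis nb_uniq : forall u, u < n -> uniq (nb u).
Hypothesis nb_irr : forall u, u < n -> u \notin nb u.
Hypothesis nb_sym : forall u v, u < n -> v < n -> (v \in nb u) = (u \in nb v).

Definition open_twin u v := forall x, x < n -> (x \in nb u) = (x \in nb v).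
Definition closed_twin u v :=
  forall x, x < n -> (x == u) || (x \in nb u) = (x == v) || (x \in nb v).
Definition twin_eq u v := open_twin u v \/ closed_twin u v.

Lemma twin_eq_sym u v : twin_eq u v -> twin_eq v u.
Proof. by case=> H; [left|right] => x xn; rewrite H. Qed.

Lemma twin_eq_nb x y y' : x < n -> y < n -> y' < n ->
  twin_eq y y' -> x != y' -> y \in nb x -> y' \in nb x.
Proof.
move=> xn yn y'n; rewrite nb_sym // (nb_sym xn y'n) => -[H|H] xy yx.
  by rewrite -H.
by have := H x xn; rewrite yx orbT (negPf xy) /= => <-.
Qed.

Lemma twin_eq_adj x x' y y' : x < n -> x' < n -> y < n -> y' < n ->
  twin_eq x x' -> twin_eq y y' -> x' != y' -> y \in nb x -> y' \in nb x'.
Proof.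
move=> xn x'n yn y'n xx yy ne yx.
case: (eqVneq x y') => [xy'|xy'].
  case: (eqVneq x' y) => [x'y|x'y].
    by rewrite x'y -xy' nb_sym.
  apply: (twin_eq_nb x'n yn y'n yy ne).
  by rewrite nb_sym //; apply: (twin_eq_nb yn xn x'n xx); rewrite 1?eq_sym // nb_sym.
rewrite nb_sym //; apply: (twin_eq_nb y'n xn x'n xx); first by rewrite eq_sym.
by rewrite nb_sym //; apply: twin_eq_nb yx.
Qed.

Lemma twin_eq_trans u v w : u < n -> v < n -> w < n ->
  twin_eq u v -> twin_eq v w -> twin_eq u w.
Proof.
move=> un vn wn.
have mix a b c : a < n -> b < n -> c < n -> open_twin a b -> closed_twin b c ->
    a = b \/ b = c.
  move=> an bn cn H1 H2; case: (eqVneq a b) => [->|ab]; first by left.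
  case: (eqVneq b c) => [->|bc]; first by right.
  have b1 := H2 b bn; rewrite eqxx /= (negPf bc) /= in b1.
  have c1 : c \in nb a by rewrite H1 // nb_sym.
  have a1 : a \in nb c by rewrite nb_sym.
  have := H2 a an; rewrite (negPf ab) a1 orbT /= nb_sym // H1 //.
  by rewrite (negPf (nb_irr bn)).
move=> [H1|H1] [H2|H2].
- by left=> x xn; rewrite H1 // H2.
- by case: (mix u v w un vn wn H1 H2) => E; [right; rewrite E|left; rewrite -E].
- have H1' : closed_twin v u by move=> x xn; rewrite H1.
  have H2' : open_twin w v by move=> x xn; rewrite H2.
  by case: (mix w v u wn vn un H2' H1') => E; [right; rewrite E|left; rewrite -E].
by right=> x xn; rewrite H1 // H2.
Qed.

Variables (t : nat) (cid rep : nat -> nat).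
Hypothesis rep_lt : forall i, i < t -> rep i < n.
Hypothesis cid_rep : forall i, i < t -> cid (rep i) = i.
Hypothesis cid_lt : forall v, v < n -> cid v < t.
Hypothesis cid_eq : forall u v, u < n -> v < n -> cid u = cid v <-> twin_eq u v.

Notation adj := (cadj nb rep cid).

Lemma adjE u v : u < n -> v < n -> (v \in nb u) = (u != v) && adj (cid u) (cid v).
Proof.
move=> un vn; have rn := rep_lt (cid_lt un).
have ru : twin_eq u (rep (cid u)) by apply/cid_eq => //; rewrite cid_rep // cid_lt.
case: (eqVneq u v) => [->|uv] /=; first by apply/negbTE/nb_irr.
apply/idP/hasP => [vu|[v' v'r /eqP Ev]].
  case: (eqVneq (rep (cid u)) v) => [Er|rv].
    exists u; last by rewrite -Er cid_rep // cid_lt.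
    by rewrite Er nb_sym.
  exists v; last by [].
  apply: (twin_eq_adj un rn vn vn ru _ rv vu); by left.
have v'n := nb_lt rn v'r.
apply: (twin_eq_adj rn un v'n vn (twin_eq_sym ru) _ uv v'r).
exact/cid_eq.
Qed.

Lemma sum_nb u (f : nat -> nat) : u < n ->
  \sum_(v <- nb u) f v = \sum_(v < n) (val v \in nb u) * f v.
Proof.
move=> un; rewrite -(big_mkord xpredT (fun v => (v \in nb u) * f v)).
rewrite /index_iota subn0; under [RHS]eq_bigr do rewrite mulnbl.
rewrite -big_mkcond /= -[RHS]big_filter; apply: perm_big; apply: uniq_perm.
- exact: nb_uniq.
- by rewrite filter_uniq ?iota_uniq.
move=> x; rewrite mem_filter mem_iota add0n /=.
by case: (boolP (x \in nb u)) => //= /(nb_lt un) ->.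
Qed.

Section Assignment.
Variables (h : nat) (a : nat -> nat).

Definition ctype c i := \sum_(v < n) (a v == c) * (cid v == i).
Definition kept c := \sum_(u < n) \sum_(v <- nb u) (a u == c) * (a v == c).

Lemma sum_class (f : nat -> nat) v : v < n -> \sum_(i < t) (cid v == i) * f i = f (cid v).
Proof.
move=> vn; rewrite (bigD1 (Ordinal (cid_lt vn))) //= eqxx mul1n big1 ?addn0 // => i.
by rewrite -val_eqE /= eq_sym => /negPf->; rewrite mul0n.
Qed.

Lemma sum_ctype (f : nat -> nat) c :
  \sum_(i < t) ctype c i * f i = \sum_(v < n) (a v == c) * f (cid v).
Proof.
rewrite /ctype; under eq_bigr do rewrite big_distrl /=.
rewrite exchange_big /=; apply: eq_bigr => v _.
by under eq_bigr do rewrite -mulnA; rewrite -big_distrr /= sum_class.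
Qed.

Lemma sum_ctype1 c : \sum_(i < t) ctype c i = block_size n a c.
Proof.
have := sum_ctype (fun=> 1) c; under eq_bigr do rewrite muln1.
by move->; apply: eq_bigr => v _; rewrite muln1.
Qed.

Lemma wt_kept c : wt t adj (ctype c) = kept c.
Proof.
have E1 : \sum_(i < t) wt_row adj (ctype c) i t =
    \sum_(u < n) \sum_(v < n) (a u == c) * (a v == c) * adj (cid u) (cid v).
  have E i : wt_row adj (ctype c) i t =
      ctype c i * \sum_(v < n) (a v == c) * adj i (cid v).
    rewrite -(sum_ctype (adj i)) big_distrr; apply: eq_bigr => j _ /=.
    by rewrite mulnC -mulnA.
  rewrite (eq_bigr _ (fun i _ => E (val i))).
  rewrite (sum_ctype (fun i => \sum_(v < n) (a v == c) * adj i (cid v))).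
  by apply: eq_bigr => u _; rewrite big_distrr /=; apply: eq_bigr => v _; rewrite mulnA.
have E2 : \sum_(i < t) adj i i * ctype c i =
    \sum_(u < n) (a u == c) * adj (cid u) (cid u).
  by rewrite -(sum_ctype (fun i => adj i i)); apply: eq_bigr => i _; rewrite mulnC.
have E3 : \sum_(i < t) wt_row adj (ctype c) i t =
    kept c + \sum_(i < t) adj i i * ctype c i.
  rewrite E1 E2 /kept -big_split; apply: eq_bigr => u _ /=.
  rewrite sum_nb // (bigD1 u) //= [in RHS](bigD1 u) //= (negPf (nb_irr _)) //.
  rewrite mul0n add0n addnC mulnb andbb; congr (_ + _).
  apply: eq_bigr => v vu.
  have uv : (u == v :> nat) = false by rewrite eq_sym; apply/negbTE.
  by rewrite adjE // uv mulnC.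
apply/eqP; rewrite -(eqn_add2r (\sum_(i < t) adj i i * ctype c i)) -E3; apply/eqP.
rewrite /wt /wt_pre -big_split; apply: eq_bigr => i _ /=; rewrite subnK //.
rewrite /wt_row (bigD1 i) //=; apply: leq_trans (leq_addr _ _).
rewrite leq_mul2l; case: (ctype c i) => [|m]; rewrite ?orbT // leq_pmulr ?orbT //.
Qed.

Lemma kept_cut K : (forall v, v < n -> a v < K) ->
  \sum_(c < K) kept c + cut_size nb a n = \sum_(u < n) size (nb u).
Proof.
move=> HK; rewrite /kept exchange_big /= -big_split; apply: eq_bigr => u _ /=.
rewrite exchange_big /= /cut_row take_size -big_split /= -sum1_size.
apply: eq_big_seq => v vu; have un := ltn_ord u.
rewrite (bigD1 (Ordinal (HK u un))) //= eqxx mul1n big1 ?addn0; last first.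
  by move=> c; rewrite -val_eqE /= eq_sym => /negPf->; rewrite mul0n.
by rewrite eq_sym; case: eqP.
Qed.

Lemma ctype_class K i : (forall v, v < n -> a v < K) ->
  \sum_(c < K) ctype c i = \sum_(v < n) (cid v == i).
Proof.
move=> HK; rewrite /ctype exchange_big /=; apply: eq_bigr => v _.
rewrite (bigD1 (Ordinal (HK v (ltn_ord v)))) //= eqxx mul1n big1 ?addn0 // => c.
by rewrite -val_eqE /= eq_sym => /negPf->; rewrite mul0n.
Qed.

End Assignment.
End TwinClasses.

Section Ilp.
Variables (h t : nat) (adj : nat -> nat -> bool).

Definition type_list := types h t (h.+1 ^ t).
Definition type_num := size type_list.
Definition type_vec q i := tau h (nth 0 type_list q) i.
Definition type_wt q := wt t adj (type_vec q).

Lemma type_vec_le q i : type_vec q i <= h.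
Proof. by rewrite -ltnS; apply: digit_lt. Qed.

Lemma sum_type_vec q : \sum_(i < t) type_vec q i <= h.
Proof.
case: (ltnP q type_num) => qP; last first.
  by rewrite /type_vec nth_default // big1 // => i _; rewrite /tau digit0.
have : nth 0 type_list q \in type_list by apply: mem_nth.
by rewrite mem_filter => /andP[].
Qed.

Lemma wt_le (a : nat -> nat) : \sum_(i < t) a i <= h -> wt t adj a <= h * h.
Proof.
move=> ah; rewrite /wt; case: t ah => [|t'] ah; first by rewrite /wt_pre big_ord0.
rewrite wt_preS; apply: leq_trans (wt_bound adj (ltnSn t') (leqnn _) ah).
by rewrite leq_add2l leq_subr.
Qed.

Lemma type_wt_le q : type_wt q <= h * h.
Proof. exact: wt_le (sum_type_vec q). Qed.

Lemma wt_ext (a a' : nat -> nat) : (forall i, i < t -> a i = a' i) ->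
  wt t adj a = wt t adj a'.
Proof.
move=> H; apply: eq_bigr => i _; rewrite H //; congr (_ - _).
by apply: eq_bigr => j _; rewrite !H.
Qed.

Lemma type_index (a : nat -> nat) : \sum_(i < t) a i <= h ->
  exists2 q, q < type_num & forall i, i < t -> type_vec q i = a i.
Proof.
move=> ah; have [|r rW Hr] := @digit_onto (fun=> h.+1) t a.
  move=> j jt; rewrite ltnS; apply: leq_trans ah.
  by rewrite (bigD1 (Ordinal jt)) //= leq_addr.
rewrite /weight prod_nat_const card_ord in rW.
have rT : r \in type_list.
  rewrite mem_filter mem_iota add0n rW /= andbT /valid.
  by apply: leq_trans ah; apply: leq_sum => i _; rewrite /tau Hr.
exists (index r type_list); first by rewrite index_mem.
by move=> i it; rewrite /type_vec nth_index // /tau Hr.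
Qed.

Definition zero_type q := [forall i : 'I_t, type_vec q i == 0].

Lemma zero_typeP q : reflect (forall i, i < t -> type_vec q i = 0) (zero_type q).
Proof.
apply: (iffP forallP) => [H i it|H i]; last by rewrite H.
exact: (eqP (H (Ordinal it))).
Qed.

Lemma zero_type_wt q : zero_type q -> type_wt q = 0.
Proof.
move=> /zero_typeP H; rewrite /type_wt (wt_ext (a' := fun=> 0) H).
rewrite /wt /wt_pre big1 // => i _; rewrite /wt_row big1 ?muln0 // => j _.
by rewrite muln0.
Qed.

Definition find_type (a : nat -> nat) :=
  find (fun r => [forall i : 'I_t, tau h r i == a i]) type_list.

Lemma find_typeP (a : nat -> nat) : \sum_(i < t) a i <= h ->
  find_type a < type_num /\ forall i, i < t -> type_vec (find_type a) i = a i.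
Proof.
move=> /type_index[q qP Hq].
have Hh : has (fun r => [forall i : 'I_t, tau h r i == a i]) type_list.
  apply/hasP; exists (nth 0 type_list q); first exact: mem_nth.
  by apply/forallP => i; apply/eqP; apply: Hq.
split; first by rewrite /find_type -has_find.
by move=> i it; have /forallP/(_ (Ordinal it))/eqP := nth_find 0 Hh.
Qed.

Variables (n k : nat) (nb : nat -> seq nat) (cid : nat -> nat).
Hypothesis cid_lt : forall v, v < n -> cid v < t.
Hypothesis wt_keptE : forall a c, wt t adj (ctype n cid a c) = kept n nb a c.

Definition class_size i := \sum_(v < n) (cid v == i).
Definition degree_sum := \sum_(u < n) size (nb u).

Definition ilp (x : nat -> nat) :=
  (forall i, i < t -> combo type_num x (type_vec^~ i) = class_size i) /\
  degree_sum <= combo type_num x type_wt + k + k.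

Lemma ilp_of_assignment a : (forall v, v < n -> a v < n) ->
  (forall c, c < n -> block_size n a c <= h) -> cut_size nb a n <= k + k ->
  exists x, [/\ ilp x, forall q, x q <= n & forall q, zero_type q -> x q = 0].
Proof.
move=> an ah ak; pose idx c := find_type (ctype n cid a c).
have idxP c : c < n -> idx c < type_num /\
    forall i, i < t -> type_vec (idx c) i = ctype n cid a c i.
  by move=> cn; apply: find_typeP; rewrite sum_ctype1 // ah.
pose x q := if zero_type q then 0 else \sum_(c < n) (idx c == q).
have comboE f : (forall q, zero_type q -> f q = 0) ->
    combo type_num x f = \sum_(c < n) f (idx c).
  move=> f0; rewrite /combo.
  rewrite (eq_bigr (fun q : 'I_type_num => \sum_(c < n) (idx c == q) * f q)).
    rewrite exchange_big /=; apply: eq_bigr => c _.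
    have [iP _] := idxP c (ltn_ord c).
    rewrite (bigD1 (Ordinal iP)) //= eqxx mul1n big1 ?addn0 // => q.
    by rewrite -val_eqE /= eq_sym => /negPf->; rewrite mul0n.
  move=> q _; rewrite -big_distrl /x /=; case: ifP => // /f0->.
  by rewrite !muln0.
exists x; split.
- split=> [i it|].
    rewrite comboE; last by move=> q /zero_typeP ->.
    rewrite /class_size -(ctype_class cid i an); apply: eq_bigr => c _.
    by have [_ ->] := idxP c (ltn_ord c).
  rewrite comboE; last exact: zero_type_wt.
  have -> : \sum_(c < n) type_wt (idx c) = \sum_(c < n) kept n nb a c.
    apply: eq_bigr => c _; rewrite -wt_keptE; apply: wt_ext.
    by have [] := idxP c (ltn_ord c).
  rewrite /degree_sum -(kept_cut nb an) -addnA leq_add2l; exact: ak.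
- move=> q; rewrite /x; case: ifP => // _.
  rewrite -[leqRHS]card_ord -sum1_card; apply: leq_sum => c _.
  by case: (_ == _).
by move=> q zq; rewrite /x zq.
Qed.

Lemma assignment_of_ilp x : ilp x -> exists a,
  (forall c, block_size n a c <= h) /\ cut_size nb a n <= k + k.
Proof.
move=> [xb xk].
pose L := flatten [seq nseq (x q) q | q <- iota 0 type_num].
have sumL f : \sum_(c < size L) f (nth 0 L c) = combo type_num x f.
  rewrite -(big_mkord xpredT (fun c => f (nth 0 L c))) -(big_nth 0 xpredT f).
  rewrite /L big_flatten /= big_map /combo -(big_mkord xpredT (fun q => x q * f q)).
  rewrite /index_iota subn0; apply: eq_bigr => q _.
  by rewrite big_nseq iter_addn_0 mulnC.
pose slots i := flatten [seq nseq (type_vec (nth 0 L c) i) c | c <- iota 0 (size L)].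
have slots_count i c : count_mem c (slots i) =
    if c < size L then type_vec (nth 0 L c) i else 0.
  rewrite /slots count_flatten -map_comp sumnE big_map.
  have E : \sum_(c' <- iota 0 (size L)) (c' == c) * type_vec (nth 0 L c') i =
      \sum_(c' < size L) (c' == c :> nat) * type_vec (nth 0 L c') i.
    rewrite -(big_mkord xpredT (fun c' => (c' == c) * type_vec (nth 0 L c') i)).
    by rewrite /index_iota subn0.
  rewrite (eq_bigr (fun c' => (c' == c) * type_vec (nth 0 L c') i)); last first.
    by move=> c' _ /=; rewrite count_nseq.
  rewrite E; case: ltnP => cL.
    rewrite (bigD1 (Ordinal cL)) //= eqxx mul1n big1 ?addn0 // => q.
    by rewrite -val_eqE /= => /negPf->.
  rewrite big1 // => q _; case: eqP => // Eq.
  by have := ltn_ord q; rewrite Eq ltnNge cL.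
have slots_lt i c : c \in slots i -> c < size L.
  by rewrite -has_pred1 has_count slots_count; case: ifP.
pose cls i := [seq v <- iota 0 n | cid v == i].
have size_cls i : size (cls i) = class_size i.
  rewrite size_filter -sum1_count big_mkcond /class_size.
  rewrite -(big_mkord xpredT (fun v => nat_of_bool (cid v == i))) /index_iota subn0.
  by apply: eq_bigr => v _; case: eqP.
have size_slots i : i < t -> size (slots i) = class_size i.
  move=> it; rewrite -xb // -sumL size_flatten /shape -map_comp sumnE big_map.
  rewrite -(big_mkord xpredT (fun c => type_vec (nth 0 L c) i)) /index_iota subn0.
  by apply: eq_bigr => c _ /=; rewrite size_nseq.
pose a v := nth 0 (slots (cid v)) (index v (cls (cid v))).
have a_cls i : i < t -> map a (cls i) = slots i.
  move=> it; apply: (@eq_from_nth _ 0); first by rewrite size_map size_cls size_slots.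
  move=> j; rewrite size_map => jl; rewrite (nth_map 0) //.
  have jc : nth 0 (cls i) j \in cls i by apply: mem_nth.
  have /eqP Ec : cid (nth 0 (cls i) j) == i by move: jc; rewrite mem_filter => /andP[].
  by rewrite /a Ec index_uniq // filter_uniq // iota_uniq.
have ctE c i : i < t -> ctype n cid a c i = if c < size L then type_vec (nth 0 L c) i else 0.
  move=> it; rewrite -slots_count -a_cls // count_map count_filter -sum1_count big_mkcond.
  rewrite /ctype -(big_mkord xpredT (fun v => (a v == c) * (cid v == i))) /index_iota subn0.
  by apply: eq_bigr => v _ /=; case: eqP => _; case: eqP.
have aL v : v < n -> a v < size L.
  move=> vn; apply: (slots_lt (cid v)); rewrite -a_cls ?cid_lt //.
  by apply: map_f; rewrite mem_filter eqxx mem_iota.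
exists a; split.
  move=> c; rewrite -(sum_ctype1 cid_lt).
  rewrite (eq_bigr (fun i : 'I_t => if c < size L then type_vec (nth 0 L c) i else 0)).
    by case: (c < size L); [exact: sum_type_vec|rewrite big1].
  by move=> i _; exact: ctE.
have E : \sum_(c < size L) kept n nb a c = combo type_num x type_wt.
  rewrite -sumL; apply: eq_bigr => c _; rewrite -wt_keptE; apply: wt_ext => i it.
  by rewrite ctE // ltn_ord.
have := kept_cut nb aL; rewrite E; move: xk; rewrite /degree_sum; lia.
Qed.

End Ilp.

Section FewLarge.
Variables (P t h n : nat) (tq : nat -> nat -> nat) (cc b : nat -> nat).
Hypothesis h_gt0 : 0 < h.
Hypothesis tq_le : forall q i, tq q i <= h.
Hypothesis b_le : forall i, i < t -> b i <= n.

Definition large_bound := (2 * t * h).+1.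
Definition large (x : nat -> nat) := [seq q <- iota 0 P | large_bound <= x q].
Definition null q := [forall i : 'I_t, tq q i == 0].

Definition feasible (x : nat -> nat) :=
  [forall i : 'I_t, combo P x (tq^~ i) == b i] &&
  [forall q : 'I_P, null q ==> (x q == 0)].

Lemma feasibleP x : reflect
  ((forall i, i < t -> combo P x (tq^~ i) = b i) /\
   (forall q, q < P -> null q -> x q = 0)) (feasible x).
Proof.
apply: (iffP andP) => [[/forallP H1 /forallP H2]|[H1 H2]].
  split=> [i it|q qP]; first by rewrite (eqP (H1 (Ordinal it))).
  by move=> nq; have := H2 (Ordinal qP); rewrite /= nq => /eqP.
split; apply/forallP => i; first by rewrite H1.
by apply/implyP => nq; rewrite H2.
Qed.

Lemma feasible_le x q : feasible x -> q < P -> x q <= n.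
Proof.
move=> /feasibleP[H1 H2] qP; case: (boolP (null q)) => nq; first by rewrite H2.
have [i] := forallPn nq; rewrite -lt0n => ti.
apply: leq_trans (b_le (ltn_ord i)); rewrite -H1 // /combo (bigD1 (Ordinal qP)) //=.
by apply: leq_trans (leq_addr _ _); rewrite leq_pmulr.
Qed.

Definition spread (L : seq nat) (f : nat -> nat) q :=
  \sum_(j < 2 * t) (nth 0 L j == q) * f j.

Lemma spread_nth L f j : uniq L -> 2 * t <= size L -> j < 2 * t ->
  spread L f (nth 0 L j) = f j.
Proof.
move=> uL sL jt; rewrite /spread (bigD1 (Ordinal jt)) //= eqxx mul1n big1 ?addn0 // => i.
rewrite -val_eqE /= => ij; rewrite nth_uniq ?(negPf ij) //.
  by apply: leq_trans sL; apply: ltn_ord.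
exact: leq_trans sL.
Qed.

Lemma spread_out L f q : q \notin L -> 2 * t <= size L -> spread L f q = 0.
Proof.
move=> qL sL; rewrite /spread big1 // => j _; case: eqP => // E.
by move: qL; rewrite -E mem_nth //; apply: leq_trans sL; apply: ltn_ord.
Qed.

Lemma combo_spread L f F : (forall q, q \in L -> q < P) -> 2 * t <= size L ->
  combo P (spread L f) F = \sum_(j < 2 * t) f j * F (nth 0 L j).
Proof.
move=> LP sL; rewrite /combo /spread.
under eq_bigr do rewrite big_distrl /=.
rewrite exchange_big /=; apply: eq_bigr => j _.
have jP : nth 0 L j < P.
  by apply: LP; apply: mem_nth; apply: leq_trans sL; apply: ltn_ord.
rewrite (bigD1 (Ordinal jP)) //= eqxx mul1n big1 ?addn0 // => q.
by rewrite -val_eqE /= eq_sym => /negPf->; rewrite !mul0n.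
Qed.

Lemma collision (L : seq nat) : 0 < t -> exists f f' : nat -> nat,
  [/\ forall j, j < 2 * t -> f j < large_bound /\ f' j < large_bound,
      exists2 j, j < 2 * t & f j != f' j &
      forall i, i < t -> \sum_(j < 2 * t) f j * tq (nth 0 L j) i =
        \sum_(j < 2 * t) f' j * tq (nth 0 L j) i].
Proof.
move=> t0; set m := 2 * t * h.
have bd (f : {ffun 'I_(2 * t) -> 'I_large_bound}) i :
    \sum_(j < 2 * t) f j * tq (nth 0 L j) i < (m * m).+1.
  rewrite ltnS; apply: (@leq_trans (\sum_(j < 2 * t) m * h)).
    apply: leq_sum => j _; apply: leq_mul; last exact: tq_le.
    by rewrite -ltnS; apply: ltn_ord.
  by rewrite sum_nat_const card_ord mulnCA.
pose g (f : {ffun 'I_(2 * t) -> 'I_large_bound}) :=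
  [ffun i : 'I_t => Ordinal (bd f i)].
have ng : ~~ injectiveb g.
  apply/negP => /injectiveP /leq_card.
  rewrite !card_ffun !card_ord expnM leqNgt => /negP; apply.
  rewrite ltn_exp2r //; rewrite /large_bound -/m.
  have : 0 < m by rewrite !muln_gt0 t0 h_gt0.
  rewrite expnS expn1; lia.
have /injectivePn[f [f' ff gg]] := ng.
exists (fun j => if insub j is Some o then val (f o) else 0).
exists (fun j => if insub j is Some o then val (f' o) else 0).
have vE (f0 : {ffun 'I_(2 * t) -> 'I_large_bound}) (j : 'I_(2 * t)) :
    (if insub (val j) is Some o then val (f0 o) else 0) = val (f0 j).
  by rewrite valK.
split.
- by move=> j jt; rewrite insubT /=; split; apply: ltn_ord.
- have [j fj] : exists j, f j != f' j.
    apply/existsP; rewrite -negb_forall; apply: contra ff => /forallP H.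
    by apply/eqP/ffunP => j; apply/eqP.
  by exists (val j); rewrite ?ltn_ord // !vE.
move=> i it; have /ffunP/(_ (Ordinal it)) := gg; rewrite !ffunE => /(congr1 val) /= E.
rewrite (eq_bigr (fun j : 'I_(2 * t) => f j * tq (nth 0 L j) i)); last first.
  by move=> j _; rewrite vE.
by rewrite E; apply: eq_bigr => j _; rewrite vE.
Qed.

Definition sq (x : nat -> nat) := \sum_(q < P) x q * x q.

Lemma exchange_sq a a' x : a <= x -> a' <= x ->
  (x + a - a') * (x + a - a') + (x + a' - a) * (x + a' - a) =
  2 * (x * x) + 2 * ((a - a') * (a - a') + (a' - a) * (a' - a)).
Proof.
move=> ax a'x; case/orP: (leq_total a a') => aa.
  have [d Ed] : exists d, a' = a + d by exists (a' - a); rewrite subnKC.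
  have [y Ey] : exists y, x = y + d by exists (x - d); rewrite subnK //; lia.
  subst a' x.
  have -> : y + d + a - (a + d) = y by lia.
  have -> : y + d + (a + d) - a = y + d + d by lia.
  have -> : a - (a + d) = 0 by lia.
  have -> : a + d - a = d by lia.
  lia.
have [d Ed] : exists d, a = a' + d by exists (a - a'); rewrite subnKC.
have [y Ey] : exists y, x = y + d by exists (x - d); rewrite subnK //; lia.
subst a x.
have -> : y + d + a' - (a' + d) = y by lia.
have -> : y + d + (a' + d) - a' = y + d + d by lia.
have -> : a' - (a' + d) = 0 by lia.
have -> : a' + d - a' = d by lia.
lia.
Qed.

(* With [2 t] entries of size at least [2 t h + 1], two different choices of small
   amounts on them use the same resources; moving along their difference in both
   directions contradicts the maximality of the value and then of the sum of
   squares. *)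
Lemma few_large x0 : feasible x0 -> exists x, [/\ feasible x,
  combo P x0 cc <= combo P x cc & size (large x) <= 2 * t].
Proof.
move=> Hx0; pose ext (f : {ffun 'I_P -> 'I_n.+1}) q :=
  if insub q is Some o then val (f o) else 0.
pose BIG := (P * (n * n)).+1.
pose phi x := combo P x cc * BIG + sq x.
have comboE x x' F : (forall q, q < P -> x q = x' q) -> combo P x F = combo P x' F.
  by move=> H; apply: eq_bigr => q _; rewrite H.
have sqE x x' : (forall q, q < P -> x q = x' q) -> sq x = sq x'.
  by move=> H; apply: eq_bigr => q _; rewrite H.
have feaE x x' : (forall q, q < P -> x q = x' q) -> feasible x -> feasible x'.
  move=> H /feasibleP[H1 H2]; apply/feasibleP; split=> [i it|q qP].
    by rewrite -H1 //; apply: comboE => q qP; rewrite H.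
  by rewrite -H //; apply: H2.
pose res (x : nat -> nat) : {ffun 'I_P -> 'I_n.+1} := [ffun q => inord (x (val q))].
have resE x : feasible x -> forall q, q < P -> x q = ext (res x) q.
  move=> Hx q qP; rewrite /ext insubT /= ffunE inordK //= ltnS.
  exact: feasible_le.
have F0 : feasible (ext (res x0)) by exact: feaE (resE _ Hx0) Hx0.
case: (@arg_maxnP _ (res x0) (fun f => feasible (ext f)) (fun f => phi (ext f)) F0).
move=> f Ff max_f; set x := ext f in Ff max_f.
have max_x y : feasible y -> phi y <= phi x.
  move=> Fy; have := max_f (res y) (feaE _ _ (resE y Fy) Fy).
  by rewrite /phi -(comboE _ _ _ (resE y Fy)) -(sqE _ _ (resE y Fy)).
have sq_lt y : feasible y -> sq y < BIG.
  move=> Fy; rewrite ltnS -[P in P * _]card_ord -sum_nat_const; apply: leq_sum => q _.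
  by apply: leq_mul; apply: feasible_le.
exists x; split=> //.
  have := max_x _ Hx0; have := sq_lt _ Ff; rewrite /phi => S1 S2.
  rewrite -ltnS -(@ltn_pmul2r BIG) // mulSn; lia.
rewrite leqNgt; apply/negP => sL; set L := large x in sL.
have uL : uniq L by rewrite filter_uniq // iota_uniq.
have LP q : q \in L -> q < P by rewrite mem_filter mem_iota add0n => /andP[].
have Lx q : q \in L -> large_bound <= x q by rewrite mem_filter => /andP[].
have [Fb Fn] := feasibleP _ Ff.
have t0 : 0 < t.
  case: (posnP t) => // t0; have q0 : nth 0 L 0 \in L by apply: mem_nth; apply: leq_ltn_trans sL.
  have : null (nth 0 L 0) by apply/forallP => i; have := leq_ltn_trans (leq0n _) (ltn_ord i) => tp; exfalso; move: tp; rewrite t0.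
  by move=> /(Fn _ (LP _ q0)) E; have := Lx _ q0; rewrite E.
have [a [a' [Hlt [j0 j0t aj] Haa]]] := collision L t0.
have sL' := ltnW sL.
have le_x f0 q : (forall j, j < 2 * t -> f0 j < large_bound) -> q < P ->
    spread L f0 q <= x q.
  move=> H qP; case: (boolP (q \in L)) => qL; last by rewrite spread_out.
  rewrite -(nth_index 0 qL); case: (ltnP (index q L) (2 * t)) => it.
    rewrite spread_nth //; apply: leq_trans (ltnW (H _ it)) _.
    by rewrite nth_index // Lx.
  rewrite /spread big1 // => j _; rewrite nth_uniq ?index_mem //.
    by have := ltn_ord j; case: eqP => // ->; lia.
  by apply: leq_trans sL'; apply: ltn_ord.
have Aa := le_x a _ (fun j jt => (Hlt j jt).1).
have Aa' := le_x a' _ (fun j jt => (Hlt j jt).2).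
pose A := spread L a; pose A' := spread L a'.
pose x1 q := x q + A q - A' q; pose x2 q := x q + A' q - A q.
have comboAB F y y' z : (forall q, q < P -> z q + y' q = x q + y q) ->
    combo P z F + combo P y' F = combo P x F + combo P y F.
  move=> H; rewrite /combo -!big_split; apply: eq_bigr => q _ /=.
  by rewrite -!mulnDl H.
have E1 q : q < P -> x1 q + A' q = x q + A q.
  by move=> qP; rewrite /x1 subnK //; apply: leq_trans (Aa' q qP) (leq_addr _ _).
have E2 q : q < P -> x2 q + A q = x q + A' q.
  by move=> qP; rewrite /x2 subnK //; apply: leq_trans (Aa q qP) (leq_addr _ _).
have EA i : i < t -> combo P A (tq^~ i) = combo P A' (tq^~ i).
  by move=> it; rewrite !combo_spread //; apply: Haa.
have nL q : q < P -> null q -> q \notin L.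
  by move=> qP nq; apply/negP => /Lx; rewrite Fn.
have F1 : feasible x1.
  apply/feasibleP; split=> [i it|q qP nq].
    have := comboAB (tq^~ i) _ _ _ E1; rewrite EA // => /addIn ->; exact: Fb.
  by rewrite /x1 Fn // /A /A' !spread_out // ?nL.
have F2 : feasible x2.
  apply/feasibleP; split=> [i it|q qP nq].
    have := comboAB (tq^~ i) _ _ _ E2; rewrite EA // => /addIn ->; exact: Fb.
  by rewrite /x2 Fn // /A /A' !spread_out // ?nL.
have C12 : combo P x1 cc + combo P x2 cc = combo P x cc + combo P x cc.
  have := comboAB cc _ _ _ E1; have := comboAB cc _ _ _ E2; lia.
have S12 : 2 * sq x < sq x1 + sq x2.
  have j0P : nth 0 L j0 < P by apply: LP; apply: mem_nth; apply: leq_trans sL'.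
  rewrite /sq -big_split big_distrr /=.
  rewrite (bigD1 (Ordinal j0P)) //= [ltnRHS](bigD1 (Ordinal j0P)) //=.
  rewrite -addSn; apply: leq_add.
    rewrite exchange_sq ?Aa ?Aa' // /A /A' !spread_nth //.
    have : 0 < (a j0 - a' j0) * (a j0 - a' j0) + (a' j0 - a j0) * (a' j0 - a j0).
      by rewrite addn_gt0 !muln_gt0 !andbb !subn_gt0; case: ltngtP aj.
    by lia.
  by apply: leq_sum => q _; rewrite exchange_sq ?Aa ?Aa' // leq_addr.
have := max_x _ F1; have := max_x _ F2; rewrite /phi => M1 M2.
have : (combo P x1 cc + combo P x2 cc) * BIG = combo P x cc * BIG + combo P x cc * BIG.
  by rewrite C12 mulnDl.
rewrite mulnDl; lia.
Qed.

End FewLarge.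

Section SparseSearch.
Variables (P t h n k m2 : nat) (tq : nat -> nat -> nat) (cc cnt : nat -> nat).

Lemma combo_of_solves d : in_box n h t P d -> solves k m2 t P tq cc cnt d ->
  exists x, (forall i, i < t -> combo P x (tq^~ i) = cnt i) /\
    m2 <= combo P x cc + k + k.
Proof.
move=> Hd /andP[/allP Hr Hm].
pose x q := d q + \sum_(s < 2 * t) (d (P + s) == q) * d (P + 2 * t + s).
have E f : dot t P d f = combo P x f.
  rewrite /dot /combo /x; under [RHS]eq_bigr do rewrite mulnDl big_distrl /=.
  rewrite big_split /=; congr (_ + _); rewrite exchange_big /=.
  apply: eq_bigr => s _; have sP : d (P + s) < P.
    have := Hd (P + s); rewrite /radix.
    have -> : (P + s < P) = false by lia.
    by rewrite ltn_add2l ltn_ord; apply; have := ltn_ord s; lia.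
  rewrite (bigD1 (Ordinal sP)) //= eqxx mul1n big1 ?addn0 // => q.
  by rewrite -val_eqE /= eq_sym => /negPf->; rewrite !mul0n.
exists x; rewrite -E; split=> // i it; rewrite -E.
by apply/eqP/Hr; rewrite mem_iota.
Qed.

Hypothesis h_gt0 : 0 < h.
Hypothesis tq_le : forall q i, tq q i <= h.
Hypothesis cnt_le : forall i, i < t -> cnt i <= n.
Hypothesis P_gt0 : 0 < P.

Lemma solves_of_combo x : (forall i, i < t -> combo P x (tq^~ i) = cnt i) ->
  m2 <= combo P x cc + k + k ->
  (forall q, q < P -> null t tq q -> x q = 0) ->
  exists2 d, in_box n h t P d & solves k m2 t P tq cc cnt d.
Proof.
move=> Hx Hm Hn.
have Fx : feasible P t tq cnt x by apply/feasibleP.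
have [{Hx Hm Hn}y [Fy Cy Ly]] : exists y, [/\ feasible P t tq cnt y,
    m2 <= combo P y cc + k + k & size (large P t h y) <= 2 * t].
  have [y [Fy Cy Ly]] := few_large cc h_gt0 tq_le cnt_le Fx.
  by exists y; split=> //; lia.
set L := large P t h y in Ly.
have LP q : q \in L -> q < P by rewrite mem_filter mem_iota add0n => /andP[].
have uL : uniq L by rewrite filter_uniq // iota_uniq.
pose d j := if j < P then (if y j < large_bound t h then y j else 0) else
  if j < P + 2 * t then nth 0 L (j - P) else
  if j - (P + 2 * t) < size L then y (nth 0 L (j - (P + 2 * t))) else 0.
have E f : dot t P d f = combo P y f.
  have -> : combo P y f = \sum_(q < P) (if y q < large_bound t h then y q else 0) * f q +
      \sum_(q <- L) y q * f q.
    rewrite /L /large big_filter -[in X in _ + X](subn0 P) -/(index_iota 0 P).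
    rewrite (big_mkord (fun q => large_bound t h <= y q) (fun q => y q * f q)).
    rewrite [X in _ + X]big_mkcond -big_split; apply: eq_bigr => q _ /=.
    by case: ltnP; rewrite ?mul0n ?add0n ?addn0.
  rewrite /dot; congr (_ + _).
    by apply: eq_bigr => q _; rewrite /d ltn_ord.
  rewrite (big_nth 0) big_mkord /dot2.
  rewrite (big_ord_widen (2 * t) (fun s => y (nth 0 L s) * f (nth 0 L s))) //.
  rewrite [RHS]big_mkcond; apply: eq_bigr => s _ /=; rewrite /d.
  have s2 := ltn_ord s.
  have -> : (P + 2 * t + s < P) = false by lia.
  have -> : (P + 2 * t + s < P + 2 * t) = false by lia.
  have -> : (P + s < P) = false by lia.
  rewrite ltn_add2l s2 !addKn.
  by case: ifP => // _; rewrite mul0n.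
exists d.
  move=> j jl; rewrite /radix /d; case: (ltnP j P) => jP.
    by case: (ltnP (y j) (large_bound t h)).
  case: (ltnP j (P + 2 * t)) => j2.
    case: (ltnP (j - P) (size L)) => jL; first by apply/LP/mem_nth.
    by rewrite nth_default.
  case: ifP => // jL; rewrite ltnS; apply: (feasible_le cnt_le Fy).
  by apply/LP/mem_nth.
rewrite /solves E Cy andbT; apply/allP => i; rewrite mem_iota add0n => it.
by have [H _] := feasibleP _ _ _ _ _ Fy; rewrite E H.
Qed.

End SparseSearch.

(** * Graphs *)

Section EdgeCount.
Variables (T : finType) (e : rel T).
Hypothesis e_sym : symmetric e.
Hypothesis e_irr : irreflexive e.

Definition edge_sets : {set {set T}} :=
  ([set [set x.1; x.2] | x : T * T & e x.1 x.2])%SET.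

Lemma card_edge_sets : \sum_u \sum_v e u v = 2 * #|edge_sets|.
Proof.
have -> : \sum_u \sum_v e u v = \sum_(x in [set x : T * T | e x.1 x.2]%SET) 1.
  rewrite pair_big /= [RHS]big_mkcond; apply: eq_bigr => x _.
  by rewrite inE; case: (e _ _).
rewrite (partition_big_imset (fun x : T * T => [set x.1; x.2]%SET)) /=.
have <- : ([set [set x.1; x.2]%SET | x in [set x : T * T | e x.1 x.2]%SET] = edge_sets)%SET.
  apply/setP => A; apply/imsetP/imsetP => -[x]; rewrite inE => ex ->;
    by exists x; rewrite ?inE.
rewrite mulnC -sum_nat_const; apply: eq_bigr => A /imsetP[[u v]].
rewrite inE /= => uv ->.
have uv' : u != v by apply: contraTneq uv => ->; rewrite e_irr.
have -> : 2 = #|[set (u, v); (v, u)]%SET| by rewrite cards2 xpair_eqE (negPf uv').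
rewrite sum1dep_card; apply: eq_card => -[a b]; rewrite !inE /= !xpair_eqE.
rewrite finset.eqEsubset !finset.subUset !finset.sub1set !inE.
case: (eqVneq a u) => [->|au]; case: (eqVneq b v) => [->|bv] /=;
  rewrite ?eqxx ?uv ?orbT //=.
- by rewrite (eq_sym v u) (negPf uv') !andbF.
- by rewrite (eq_sym v u) (negPf uv') !andbF.
case: (eqVneq a v) => [->|av] /=; last by rewrite andbF.
by rewrite orbF (eq_sym u); case: eqP => [->|] //=; rewrite ?andbF // e_sym uv.
Qed.
End EdgeCount.

Section AdjacencyLists.
Variables (n : nat) (G : sgraph 'I_n) (adj : 'I_n -> seq 'I_n).
Hypothesis adjG : adjacency_lists G adj.

Definition nbs (u : nat) : seq nat :=
  if insub u is Some o then [seq val v | v <- adj o] else [::].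

Lemma nbsE (u : 'I_n) : nbs u = [seq val v | v <- adj u].
Proof. by rewrite /nbs valK. Qed.

Lemma mem_nbs (u v : 'I_n) : (val v \in nbs u) = G u v.
Proof. by rewrite nbsE mem_map; [case: (adjG u)|exact: val_inj]. Qed.

Lemma nbs_lt u v : u < n -> v \in nbs u -> v < n.
Proof.
move=> un; rewrite (nbsE (Ordinal un)) => /mapP[w _ ->]; exact: ltn_ord.
Qed.

Lemma nbs_uniq u : u < n -> uniq (nbs u).
Proof.
move=> un; rewrite (nbsE (Ordinal un)) map_inj_uniq; last exact: val_inj.
by case: (adjG (Ordinal un)).
Qed.

Lemma nbs_irr u : u < n -> u \notin nbs u.
Proof.
by move=> un; rewrite (mem_nbs (Ordinal un) (Ordinal un)) (adjacent_irrefl G).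
Qed.

Lemma nbs_sym u v : u < n -> v < n -> (v \in nbs u) = (u \in nbs v).
Proof.
move=> un vn; rewrite (mem_nbs (Ordinal un) (Ordinal vn)).
by rewrite (mem_nbs (Ordinal vn) (Ordinal un)) (adjacent_sym G).
Qed.

Lemma sum_nbs (u : 'I_n) (f : nat -> nat) :
  \sum_(v <- nbs u) f v = \sum_(v < n) G u v * f v.
Proof.
rewrite (sum_nb nbs_lt nbs_uniq _ (ltn_ord u)).
by apply: eq_bigr => v _; rewrite -mem_nbs.
Qed.

Lemma degree_sum_edges : degree_sum n nbs = 2 * #|edges G|.
Proof.
rewrite -(card_edge_sets (adjacent_sym G) (adjacent_irrefl G)).
apply: eq_bigr => u _; rewrite -sum1_size (sum_nbs u (fun=> 1)).
by apply: eq_bigr => v _; rewrite muln1.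
Qed.

Variables (k h : nat).

Definition rows i := [seq size (nbs u) :: nbs u | u <- iota 0 i].

Lemma size_rows i : size (flatten (rows i)) = \sum_(u < i) (size (nbs u)).+1.
Proof.
rewrite size_flatten /shape -map_comp sumnE big_map.
by rewrite -(big_mkord xpredT (fun u => (size (nbs u)).+1)) /index_iota subn0.
Qed.

Lemma instanceE : instance adj k h = [:: n; k; h] ++ flatten (rows n).
Proof.
rewrite /instance /rows -val_enum_ord -map_comp; congr (_ ++ flatten _).
by apply: eq_map => u /=; rewrite nbsE size_map.
Qed.

Lemma instance_nth u j : u < n -> j < (size (nbs u)).+1 ->
  nth 0 (instance adj k h) (pos nbs u + j) = nth 0 (size (nbs u) :: nbs u) j.
Proof.
move=> un ju; rewrite instanceE /pos -addnA -/(size [:: n; k; h]).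
rewrite nth_cat ltnNge leq_addr /= addKn -size_rows.
have -> : rows n = rows u ++ (size (nbs u) :: nbs u) ::
    [seq size (nbs v) :: nbs v | v <- iota u.+1 (n - u.+1)].
  by rewrite /rows -[n in LHS](subnKC (ltnW un)) iotaD map_cat -[n - u]prednK
    ?subn_gt0 //= subnS.
rewrite flatten_cat nth_cat ltnNge leq_addr /= addKn.
by case: j ju => //= j; rewrite ltnS nth_cat => ->.
Qed.

Lemma instance_deg u : u < n -> nth 0 (instance adj k h) (pos nbs u) = size (nbs u).
Proof. by move=> un; rewrite -[pos _ _]addn0 instance_nth. Qed.

Lemma instance_nbs u j : u < n -> j < size (nbs u) ->
  nth 0 (instance adj k h) (pos nbs u + 1 + j) = nth 0 (nbs u) j.
Proof. by move=> un ju; rewrite -addnA instance_nth. Qed.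

Lemma size_instance : size (instance adj k h) = pos nbs n.
Proof. by rewrite instanceE size_cat size_rows. Qed.

Definition crossing (a : nat -> nat) : rel 'I_n := fun u v => G u v && (a u != a v).

Lemma cut_crossing (a : nat -> nat) :
  cut_size nbs a n = 2 * #|edge_sets (crossing a)|.
Proof.
rewrite -card_edge_sets; last 2 first.
- by move=> u v; rewrite /crossing (adjacent_sym G) eq_sym.
- by move=> u; rewrite /crossing eqxx andbF.
apply: eq_bigr => u _; rewrite /cut_row take_size (sum_nbs u (fun w => a u != a w)).
by apply: eq_bigr => v _; rewrite /crossing mulnb.
Qed.

Lemma block_size_card (a : nat -> nat) c :
  block_size n a c = #|[set v : 'I_n | a v == c]%SET|.
Proof.
by rewrite -sum1dep_card big_mkcond; apply: eq_bigr => v _; case: eqP.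
Qed.

Lemma deletion_of_assignment (a : nat -> nat) :
  (forall v, v < n -> block_size n a (a v) <= h) -> cut_size nbs a n <= k + k ->
  free_edge_deletion G k h.
Proof.
move=> Hb Hc; apply/existsP; exists (edge_sets (crossing a)); apply/and3P; split.
- apply/fintype.subsetP => A /imsetP[x]; rewrite inE => /andP[Gx _] ->.
  by apply/imsetP; exists x; rewrite ?inE.
- by rewrite cut_crossing addnn -mul2n leq_mul2l in Hc.
apply/forallP => u; apply: leq_trans (Hb u (ltn_ord u)).
rewrite block_size_card; apply: subset_leq_card; apply/fintype.subsetP => v.
rewrite !inE => /connectP[p]; elim: p u => [|w p IH] u /=; first by move=> _ ->.
move=> /andP[/andP[Guw uwF] wp] /(IH _ wp) /eqP ->.
apply/negPn; apply: contra uwF => au.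
by apply/imsetP; exists (u, w); rewrite // inE /crossing Guw eq_sym.
Qed.

Lemma assignment_of_deletion : free_edge_deletion G k h ->
  exists a : nat -> nat, [/\ forall v, v < n -> a v < n,
    forall c, c < n -> block_size n a c <= h & cut_size nbs a n <= k + k].
Proof.
case/existsP=> F /and3P[FE Fk /forallP Fh].
pose e := delete_edges G F.
have e_sym : connect_sym e.
  by apply: sym_connect_sym => u v; rewrite /e /delete_edges (adjacent_sym G) finset.setUC.
pose a (v : nat) := if (insub v : option 'I_n) is Some o then val (fingraph.root e o) else 0.
have aE (v : 'I_n) : a v = fingraph.root e v by rewrite /a valK.
exists a; split.
- by move=> v vn; rewrite (aE (Ordinal vn)).
- move=> c cn; rewrite block_size_card.
  case: (set_0Vmem [set v : 'I_n | a v == c]%SET) => [->|[u]]; first by rewrite cards0.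
  rewrite inE => /eqP uc; apply: leq_trans (Fh u); apply: subset_leq_card.
  apply/fintype.subsetP => v; rewrite !inE -uc !aE => /eqP E.
  by rewrite e_sym; apply/(fingraph.rootP e_sym); apply: val_inj.
rewrite cut_crossing addnn -mul2n leq_mul2l /=; apply: leq_trans Fk.
apply: subset_leq_card; apply/fintype.subsetP => A /imsetP[[u v]].
rewrite inE /= => /andP[Guv auv] ->; apply/negPn; apply: contra auv => uvF.
rewrite !aE; apply/eqP; congr val; apply/(fingraph.rootP e_sym); apply: connect1.
by rewrite /e /delete_edges Guv uvF.
Qed.

Variables (t0 t : nat) (cid rep : nat -> nat).
Hypothesis rep_lt : forall i, i < t -> rep i < n.
Hypothesis cid_rep : forall i, i < t -> cid (rep i) = i.
Hypothesis cid_eq : forall u v, u < n -> v < n -> cid u = cid v <-> twin_eq n nbs u v.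

Lemma twins_twin_eq (u v : 'I_n) : twins G u v -> twin_eq n nbs u v.
Proof.
case/andP=> _ /orP[/eqP E|/eqP E]; [right|left] => x xn.
  have := congr1 (fun A : {set 'I_n} => Ordinal xn \in A) E.
  by rewrite /closed_nbh /open_nbh !inE -!mem_nbs.
have := congr1 (fun A : {set 'I_n} => Ordinal xn \in A) E.
by rewrite /open_nbh !inE -!mem_nbs.
Qed.

Lemma class_num_le : nbh_diversity_le G t0 -> t <= t0.
Proof.
case=> P [partP Pt0 HP]; apply: leq_trans Pt0.
have /and3P[/eqP covP tivP _] := partP.
pose f (i : 'I_t) := finset.pblock P (Ordinal (rep_lt (ltn_ord i))).
have inP (i : 'I_t) : Ordinal (rep_lt (ltn_ord i)) \in finset.cover P by rewrite covP inE.
have fP i : f i \in P by apply: finset.pblock_mem.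
have f_inj : injective f.
  move=> i j E; apply: val_inj.
  rewrite /= -(cid_rep (ltn_ord i)) -(cid_rep (ltn_ord j)).
  apply/cid_eq; rewrite ?rep_lt //.
  set u := Ordinal (rep_lt (ltn_ord i)); set v := Ordinal (rep_lt (ltn_ord j)).
  have uA : u \in f i by rewrite /f finset.mem_pblock inP.
  have vA : v \in f i by rewrite E /f finset.mem_pblock inP.
  case: (eqVneq u v) => [/(congr1 val) /= -> |uv]; first by left.
  exact: (twins_twin_eq (HP _ (fP i) _ _ uA vA uv)).
rewrite -[t in t <= _]card_ord -(card_imset _ f_inj).
apply: subset_leq_card; apply/fintype.subsetP => A /imsetP[i _ ->]; exact: fP.
Qed.

End AdjacencyLists.

(** * The main program *)

(* Large enough for the factor [n ^ (2 * t)] of the sparse search to be at most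
   [D ^ (t ^ 2 / 24)] when [n ^ threshold < D ^ t], where [D = dbase P h]. *)
Definition threshold := 48.

Definition select_prog :=
  vHH <~ vP * vH;;
  vDD <~ vHH + vHH + EK 2;;
  vX <~ EK 1;;
  vY <~ EK threshold;;
  For vA vY (vX <~ vX * vN);;
  vSS <~ EK 1;;
  For vA vT (If vX vSS Skip (vSS <~ vSS * vDD)).

Definition solve_prog :=
  If vN vP brute_prog (select_prog;; If vX vSS search_prog dp_prog).

Definition front_prog :=
  refine false aOP 4 5;; refine true aCL 7 8;;
  classes_prog;; matrix_prog;; types_prog.

Definition main_prog :=
  vN <~ EIn (EK 0);; vK <~ EIn (EK 1);; vH <~ EIn (EK 2);;
  If vH vN
    (block1;;
     If vH (EK 2) (If (vK + vK) vM2 Skip (vAns <~ EK 1))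
       (front_prog;; solve_prog))
    (vAns <~ EK 1).

Section Select.
Variables (inp : nat -> nat) (len M n h t P : nat).
Notation wp := (wp inp len M).
Notation D := (dbase P h).
Hypothesis h_lt : h < n.
Hypothesis t_le : t <= n.
Hypothesis P_le : P <= n.
Hypothesis M_big : 20 * (n ^ threshold * (n + 2) ^ 2) + threshold < M.

Lemma select_ok s : vr s vN = n -> vr s vH = h -> vr s vP = P -> vr s vT = t ->
  wp select_prog (fun s1 => [/\ vr s1 vHH = carry_max P h, vr s1 vDD = D,
    vr s1 vX = n ^ threshold,
    (n ^ threshold < vr s1 vSS -> n ^ threshold < D ^ t) /\
      (vr s1 vSS <= n ^ threshold -> vr s1 vSS = D ^ t) &
    ck s1 <= ck s + 100 * t + 4000]) s.
Proof.
move=> HN HH HP HT; rewrite /select_prog.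
have n0 : 0 < n by lia.
have X0 : 0 < n ^ threshold by rewrite expn_gt0 n0.
have n2 : (n + 2) ^ 2 = n * n + 4 * n + 4 by rewrite expnS expn1; lia.
have Ph : P * h <= n * n by apply: leq_mul; lia.
have XY1 : n ^ threshold <= n ^ threshold * (n + 2) ^ 2 by rewrite leq_pmulr //; lia.
have XY2 : (n + 2) ^ 2 <= n ^ threshold * (n + 2) ^ 2 by rewrite leq_pmull.
have DX : D * n ^ threshold <= 4 * (n ^ threshold * (n + 2) ^ 2).
  rewrite (mulnC (n ^ threshold)) mulnA leq_mul2r; apply/orP; right.
  by rewrite /dbase /carry_max; lia.
have nD : n <= D * n by rewrite leq_pmull.
have nX i : i < threshold -> n ^ i * n <= n ^ threshold.
  by move=> it; rewrite -expnSr leq_pexp2l.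
have pX i : i <= threshold -> n ^ i <= n ^ threshold by move=> it; rewrite leq_pexp2l.
move: M_big DX XY1 XY2 pX nX X0; set X := n ^ threshold; set Y := X * _.
move=> MB DX XY1 XY2 pX nX X0.
have T1 : threshold < M by lia.
wps; wps; wps; wps; apply: wp_seq.
apply: (wp_for (N := threshold) (I := fun i f _ => f vX = n ^ i)
  (T := fun _ => 40)) => //; try lia.
- by move=> s1 [A B]; split=> //; rewrite /= A.
- move=> i s1 Hi [A B] Hu E.
  have N1 : vr s1 vN = n by rewrite A //= /upd /=.
  have := nX i Hi; have := pX i (ltnW Hi) => p1 p2.
  wps; split; last by lia.
  by rewrite /upd /= expnSr.
move=> s1 [A B] J1 E; rewrite sum_nat_const card_ord => C1.
have X1 : vr s1 vX = X by [].
wps.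
have P1 : vr s1 vP = P by rewrite A //= /upd /=.
have T2 : vr s1 vT = t by rewrite A //= /upd /=.
have D1 : vr s1 vDD = D by rewrite A //= /upd /= ?HP ?HH /dbase /carry_max; lia.
have H1 : vr s1 vHH = carry_max P h by rewrite A //= /upd /= ?HP ?HH.
apply: (wp_for (N := t) (I := fun i f _ =>
    (X < f vSS -> X < D ^ i) /\ (f vSS <= X -> f vSS = D ^ i))
  (T := fun _ => 50)) => //; try lia.
- by move=> s2 [A2 B2]; split=> //; rewrite /= A2.
- move=> i s2 Hi [A2 B2] Hu [E1 E2].
  have X2 : vr s2 vX = X by rewrite A2.
  have D2 : vr s2 vDD = D by rewrite A2.
  have DD : D ^ i <= D ^ i.+1 by rewrite leq_pexp2l.
  apply: wp_if; try okt.
    simp => Hlt; wps; split; last by lia.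
    split; first by move=> _; apply: leq_trans (E1 Hlt) DD.
    by move=> /= H; lia.
  simp => Hle.
  have SD : vr s2 vSS * D <= 4 * Y.
    by apply: leq_trans DX; rewrite mulnC leq_mul2l Hle orbT.
  wps; split; last by lia.
  by rewrite /upd /= (E2 Hle) expnSr; split.
move=> s2 [A2 B2] J2 [E1 E2]; rewrite sum_nat_const card_ord => C2.
split; [by rewrite A2|by rewrite A2|by rewrite A2|by split|].
move: C1 C2 => /=; rewrite (_ : threshold = 48) //; clear. lia.
Qed.

End Select.

Section Front.
Variables (inp : nat -> nat) (len M n h : nat) (nb : nat -> seq nat).
Notation wp := (wp inp len M).
Notation pos := (pos nb).
Hypothesis inp_nb : forall u j, u < n -> j < size (nb u) ->
  inp (pos u + 1 + j) = nth 0 (nb u) j.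
Hypothesis len_pos : len = pos n.
Hypothesis nb_lt : forall u v, u < n -> v \in nb u -> v < n.
Hypothesis nb_uniq : forall u, u < n -> uniq (nb u).
Hypothesis nb_irr : forall u, u < n -> u \notin nb u.
Hypothesis nb_sym : forall u v, u < n -> v < n -> (v \in nb u) = (u \in nb v).
Hypothesis h_lt : h < n.
Hypothesis M_big : len + 10 * ((n + 2) * (n + 2)) < M.

Record class_data t cid rep := ClassData {
  cd_le : t <= n;
  cd_rep_lt : forall i, i < t -> rep i < n;
  cd_cid_rep : forall i, i < t -> cid (rep i) = i;
  cd_cid_lt : forall v, v < n -> cid v < t;
  cd_cid_eq : forall u v, u < n -> v < n -> cid u = cid v <-> twin_eq n nb u v }.

Lemma front_ok s : vr s vN = n -> vr s vH = h ->
  (forall u, u < n -> ar s aPOS u = pos u + 1 /\ ar s aDEG u = size (nb u)) ->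
  (forall a i, 2 < a -> ar s a i = 0) ->
  wp front_prog (fun s1 => exists t cid rep, [/\ class_data t cid rep,
    vr s1 vT = t, forall i, ar s1 aCNT i = class_size n cid i,
    types_inv n h t (cadj nb rep cid) (h.+1 ^ t) (vr s1) (ar s1) &
    ck s1 <= ck s + 2000 * len + h.+1 ^ t * (300 * (t.+1 * t.+1)) + 2000]) s.
Proof.
move=> HN HH Hpd Hz; rewrite /front_prog.
have nl : 3 + n <= len by rewrite len_pos pos_sum; lia.
have M1 : len + n + 10 < M by lia.
have M2 : len + n * n + 10 < M by lia.
apply: wp_seq; refine (wp_conseq (@refine_ok inp len M n nb inp_nb len_pos M1 nb_lt
  nb_uniq nb_irr false aOP 4 5 _ _ _ _ _ _ _ s HN Hpd _) _) => //.
  by move=> a i; rewrite !inE => Ha; apply: Hz; lia.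
move=> s1 [A1 B1] [E1 L1 C1]; apply: wp_seq.
have N1 : vr s1 vN = n by rewrite A1.
have Hpd1 u : u < n -> ar s1 aPOS u = pos u + 1 /\ ar s1 aDEG u = size (nb u).
  by move=> un; rewrite !B1 //; apply: Hpd.
refine (wp_conseq (@refine_ok inp len M n nb inp_nb len_pos M1 nb_lt
  nb_uniq nb_irr true aCL 7 8 _ _ _ _ _ _ _ s1 N1 Hpd1 _) _) => //.
  by move=> a i; rewrite !inE => Ha; rewrite B1 ?Hz // ?inE; lia.
move=> s2 [A2 B2] [E2 L2 C2]; apply: wp_seq.
pose op := ar s1 aOP; pose cl := ar s2 aCL.
have opE u v : u < n -> v < n -> (op u == op v) <-> open_twin n nb u v.
  move=> un vn; split=> [/eqP /(E1 _ _ un vn) H x xn|H].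
    by have := H x xn; rewrite /nbl !mem_cat !orbF !(nb_sym xn).
  by apply/eqP/E1 => // x xn; rewrite /nbl !mem_cat !orbF !(nb_sym xn) ?H.
have clE u v : u < n -> v < n -> (cl u == cl v) <-> closed_twin n nb u v.
  have nE x y : x < n -> y < n -> (y \in nbl nb true x) = (x == y) || (x \in nb y).
    by move=> xn yn; rewrite /nbl mem_cat inE (nb_sym xn) // orbC eq_sym.
  move=> un vn; split=> [/eqP /(E2 _ _ un vn) H x xn|H].
    by have := H x xn; rewrite !nE.
  by apply/eqP/E2 => // x xn; rewrite !nE ?H.
have twE u v : u < n -> v < n -> tw op cl u v <-> twin_eq n nb u v.
  move=> un vn; rewrite /tw /twin_eq; split.
    by case/orP=> [/(opE _ _ un vn)|/(clE _ _ un vn)]; [left|right].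
  by case=> [/(opE _ _ un vn)->|/(clE _ _ un vn)->]; rewrite ?orbT.
have N2 : vr s2 vN = n by rewrite A2.
refine (wp_conseq (@classes_ok inp len M n op cl M1 L1 L2 _ s2 N2 _ _) _).
- move=> u v w un vn wn /(twE _ _ un vn) H1 /(twE _ _ vn wn) H2.
  by apply/twE => //; apply: (twin_eq_trans nb_irr nb_sym un vn wn H1 H2).
- by move=> v vn; rewrite B2.
- by move=> a i ai; rewrite B2 ?B1 ?Hz // ?inE; lia.
move=> s3 [A3 B3] [[T1 T2] T3 T4 T5 C3]; apply: wp_seq.
set t := vr s3 vT in T1 T2 T3 T4 T5.
pose cid := ar s3 aCID; pose rep := ar s3 aREP.
have CD : class_data t cid rep.
  split=> // [i it|i it|u v un vn].
  - by have [] := T4 i it.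
  - by have [] := T4 i it.
  by rewrite -twE //; apply: T3.
have Hpd3 u : u < n -> ar s3 aPOS u = pos u + 1 /\ ar s3 aDEG u = size (nb u).
  by move=> un; rewrite !B3 // !B2 //; apply: Hpd1.
refine (wp_conseq (@matrix_ok inp len M n t nb rep cid inp_nb len_pos M2 nb_lt
  (cd_rep_lt CD) (cd_cid_rep CD) T2 T1 s3 (erefl _) Hpd3 _ _ _) _) => //.
  by move=> i; rewrite B3 // B2 // B1 // Hz.
move=> s4 [A4 B4] [E4 C4].
have T6 : vr s4 vT = t by rewrite A4.
have N4 : vr s4 vN = n by rewrite A4 // A3 // A2.
have H4 : vr s4 vH = h by rewrite A4 // A3 // A2 // A1.
refine (wp_conseq (@types_ok inp len M n h t (cadj nb rep cid) h_lt T1 M_big s4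
  T6 N4 H4 E4 _) _).
  by move=> i; rewrite B4 // B3 // B2 // B1 // Hz.
move=> s5 [A5 B5] [E5 C5].
exists t, cid, rep; split=> //.
- by rewrite A5.
- by move=> i; rewrite B5 // B4 // T5.
move: C5; set Z := h.+1 ^ t * _; lia.
Qed.

End Front.

Section Main.
Variables (n : nat) (G : sgraph 'I_n) (adj : 'I_n -> seq 'I_n).
Variables (k h M : nat).
Hypothesis adjG : adjacency_lists G adj.
Hypothesis h_gt0 : 0 < h.
Notation inp := (nth 0 (instance adj k h)).
Notation nb := (nbs adj).
Notation len := (pos nb n).
Notation wp := (wp inp len M).
Notation fed := (free_edge_deletion G k h).

Hypothesis M_big1 : 20 * (n ^ threshold * (n + 2) ^ 2) + len + 100 < M.
Hypothesis M_big2 : 20 * (n + 2) ^ 6 + k + k < M.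
Hypothesis M_big3 : len + n + h + k + k + 10 * ((n + 2) * (n + 2)) + 100 < M.

Definition search_time t P :=
  (2 * t * h).+1 ^ P * P ^ (2 * t) * n.+1 ^ (2 * t) *
    (2000 * ((t + 1) * (P + 2 * t + 1))) + 200 * (P + 2 * t + 1).
Definition dp_time t P :=
  (trunc_log 2 n).+1 * (1000 * ((P + 1) * (tabsize P t h + 1) + t)) +
    1000 * ((P + 1) * (tabsize P t h + t + 1)).
Definition brute_time := n ^ n * (1000 * (len + n * n + 1)) + 1000 * len.

Definition solver_time t T :=
  let P := type_num h t in
  [\/ n < P /\ T = brute_time,
      [/\ P <= n, n ^ threshold < dbase P h ^ t & T = search_time t P] |
      P <= n /\ T = dp_time t P].

Lemma solve_ok s t cid rep : h < n -> class_data n nb t cid rep ->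
  vr s vN = n -> vr s vK = k -> vr s vH = h -> vr s vAns = 0 ->
  vr s vM2 = degree_sum n nb -> vr s vT = t ->
  (forall u, u < n -> ar s aPOS u = pos nb u + 1 /\ ar s aDEG u = size (nb u)) ->
  (forall i, ar s aCNT i = class_size n cid i) ->
  types_inv n h t (cadj nb rep cid) (h.+1 ^ t) (vr s) (ar s) ->
  (forall a i, 18 < a -> ar s a i = 0) ->
  wp solve_prog (fun s1 => vr s1 vAns = fed /\
    exists2 T, solver_time t T & ck s1 <= ck s + T + 100 * t + 5000) s.
Proof.
move=> h_lt [Tn R1 R2 R3 R4] HN HK HH HA HM HT Hpd Hcnt [HP Hty] Hz.
have n0 : 0 < n by lia.
have WK := wt_kept (nbs_lt (adj := adj)) (nbs_uniq adjG) (nbs_irr adjG)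
  (nbs_sym adjG) R1 R2 R3 R4.
set ca := cadj nb rep cid in Hty WK.
have to_ilp : fed -> exists x, [/\ ilp h t ca n k nb cid x, forall q, x q <= n &
    forall q, zero_type h t q -> x q = 0].
  by case/(assignment_of_deletion adjG) => a [a1 a2 a3]; apply: (ilp_of_assignment R3 WK a1 a2 a3).
have of_ilp x : ilp h t ca n k nb cid x -> fed.
  case/(assignment_of_ilp R3 WK) => a [a1 a2].
  by apply: (deletion_of_assignment adjG) a2 => v vn; apply: a1.
have beq (b : bool) : (b <-> fed) -> nat_of_bool b = fed.
  by move=> H; congr nat_of_bool; apply/idP/idP => /H.
rewrite /solve_prog; apply: wp_if; try okt.
  simp => Hlt.
  have nP : n < type_num h t by move: Hlt; rewrite /type_num /type_list; lia.
  refine (wp_conseq (@brute_ok inp len M n h k nb (@instance_nbs n adj k h) (erefl _) _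
    (nbs_lt (adj := adj)) n0 (tick s (2 + 2 + 1)) HN HH HK HA Hpd _) _) => /=.
  - by lia.
  - by move=> v; apply: Hz.
  move=> s1 _ [b Eb [Hb C1]]; split.
    rewrite Eb; apply: beq; rewrite Hb; split.
      move=> [a a1 /andP[/allP a2 a3]].
      apply: (deletion_of_assignment adjG) a3 => v vn.
      by apply: a2; rewrite mem_iota /= a1.
    case/(assignment_of_deletion adjG) => a [a1 a2 a3]; exists a => //.
    by rewrite /good a3 andbT; apply/allP => c; rewrite mem_iota => /a2.
  exists brute_time; first by apply: Or31.
  by move: C1; rewrite /brute_time; set Z := _ ^ _ * _; lia.
simp => Hle.
set P := type_num h t.
have Pn : P <= n by move: Hle; rewrite /P /type_num /type_list; lia.
have HP' : vr s vP = P.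
  by rewrite HP; apply/minn_idPl; move: Pn; rewrite /P /type_num /type_list; lia.
have P0 : 0 < P.
  have [|q qP _] := @type_index h t (fun=> 0); first by rewrite big1.
  exact: leq_ltn_trans qP.
have Htq q : q < P -> (forall j, j < t -> ar s aTAU (q * t + j) = type_vec h t q j) /\
    ar s aCC q = type_wt h t ca q.
  by rewrite -HP' => /Hty.
have cle i : i < t -> class_size n cid i <= n.
  move=> _; rewrite -[leqRHS]card_ord -sum1_card; apply: leq_sum => v _.
  by case: (_ == _).
apply: wp_seq.
refine (wp_conseq (@select_ok inp len M n h t P h_lt Tn Pn _ (tick s (2 + 2 + 1))
  HN HH HP' HT) _) => /=.
  by have -> : threshold = 48 by []; move: M_big1; set X := _ ^ threshold * _; lia.
move=> s1 [A1 B1] [H1 D1 X1 [S1 S2] C1].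
have V1 x : x \notin [:: 30; 28; 13; 32; 23; 13; 23; 29; 23; 0; 29; 23] -> vr s1 x = vr s x.
  by move=> Hx; rewrite A1 //; move: Hx; rewrite !inE; lia.
have Htq1 q : q < P -> (forall j, j < t -> ar s1 aTAU (q * t + j) = type_vec h t q j) /\
    ar s1 aCC q = type_wt h t ca q.
  by move=> qP; have [F1 F2] := Htq q qP; split=> [j jt|]; rewrite B1 //; apply: F1.
have Hcnt1 i : i < t -> ar s1 aCNT i = class_size n cid i.
  by move=> _; rewrite B1 //=; apply: Hcnt.
apply: wp_if; try okt.
  move=> XS; have XD := S1 XS.
  refine (wp_conseq (@search_ok inp len M n h k (degree_sum n nb) t P
    (type_vec h t) (type_wt h t ca) (class_size n cid) h_lt Tn P0 Pn
    (@type_vec_le h t) (@type_wt_le h t ca) M_big2 (tick s1 (2 + 2 + 1))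
    _ _ _ _ _ _ _ _ Htq1 Hcnt1) _) => /=; try by rewrite V1.
    by move=> j; rewrite B1 //; apply: Hz.
  move=> s2 _ [b Eb [Hb C2]]; split.
    rewrite Eb; apply: beq; rewrite Hb; split.
      move=> [d d1 d2]; have [x [x1 x2]] := combo_of_solves d1 d2.
      by apply: (of_ilp x).
    case/to_ilp=> x [[x1 x2] x3 x4].
    apply: (solves_of_combo h_gt0 (@type_vec_le h t) cle P0 x1 x2) => q _.
    exact: x4.
  exists (search_time t P); first by apply: Or32.
  by move: C1 C2; rewrite /search_time /=; set Z := _ * _ * _ * _; lia.
simp => XS; have SD := S2 XS.
have TS : tabsize P t h = dbase P h ^ t by [].
have M4 : 4 * tabsize P t h + len + 10 < M.
  rewrite TS -SD; apply: leq_ltn_trans M_big1.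
  have : n ^ threshold <= n ^ threshold * (n + 2) ^ 2.
    by rewrite leq_pmulr // expn_gt0; lia.
  by move: XS; set X := n ^ threshold; set Y := X * _; lia.
have M5 : 10 * (n + 2) ^ 4 + k + k < M.
  apply: leq_ltn_trans M_big2; rewrite !leq_add2r leq_mul //.
  by rewrite leq_pexp2l //; lia.
refine (wp_conseq (@dp_ok inp len M n h k (degree_sum n nb) t P
    (type_vec h t) (type_wt h t ca) (class_size n cid) h_lt Tn P0 Pn
    (@type_vec_le h t) (@type_wt_le h t ca) cle M4 M5 (tick s1 (2 + 2 + 1))
    _ _ _ _ _ _ _ _ _ _ Htq1 Hcnt1) _) => /=; try by rewrite V1.
- by rewrite SD.
- by [].
- by [].
- by move=> j; rewrite B1 //; apply: Hz.
move=> s2 _ [b Eb [Hb C2]]; split.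
  rewrite Eb; apply: beq; rewrite Hb; split.
    by move=> [x [x1 x2 x3]]; apply: (of_ilp x).
  case/to_ilp=> x [[x1 x2] x3 x4]; exists x; split=> // q qP.
  by apply: leq_ltn_trans (x3 q) _; apply: trunc_log_ltn.
exists (dp_time t P); first by apply: Or33.
by move: C1 C2; rewrite /dp_time /=; set Z := _.+1 * _; set Z' := 1000 * _; lia.
Qed.

End Main.

Lemma deletion_large (n : nat) (G : sgraph 'I_n) (k h : nat) :
  n <= h -> free_edge_deletion G k h.
Proof.
move=> nh; apply/existsP; exists finset.set0; apply/and3P; split.
- exact: finset.sub0set.
- by rewrite cards0.
by apply/forallP => u; apply: leq_trans nh; rewrite -[leqRHS]card_ord max_card.
Qed.

Lemma deletion_one (n : nat) (G : sgraph 'I_n) (k : nat) :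
  free_edge_deletion G k 1 = (#|edges G| <= k).
Proof.
apply/idP/idP => [/existsP[F /and3P[FE Fk /forallP Fh]]|ek].
  apply: leq_trans Fk; apply: subset_leq_card; apply/fintype.subsetP => A.
  case/imsetP=> -[u v]; rewrite inE /= => Guv ->; apply/negPn/negP => uvF.
  have uv : u != v by apply: contraTneq Guv => ->; rewrite adjacent_irrefl.
  suff : 1 < #|component (delete_edges G F) u| by rewrite ltnNge Fh.
  have <- : #|[set u; v]%SET| = 2 by rewrite cards2 uv.
  apply: subset_leq_card; rewrite finset.subUset !finset.sub1set !inE connect0 /=.
  by apply: connect1; rewrite /delete_edges Guv uvF.
apply/existsP; exists (edges G); rewrite fintype.subxx ek /=; apply/forallP => u.
rewrite -(cards1 u); apply: subset_leq_card; apply/fintype.subsetP => v.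
rewrite !inE => /connectP[[|w p] /=]; first by move=> _ ->.
case/andP=> /andP[Guw /negP[]]; apply/imsetP.
by exists (u, w); rewrite // inE.
Qed.

Section Whole.
Variables (n : nat) (G : sgraph 'I_n) (adj : 'I_n -> seq 'I_n).
Variables (k h M : nat).
Hypothesis adjG : adjacency_lists G adj.
Hypothesis h_gt0 : 0 < h.
Notation inp := (nth 0 (instance adj k h)).
Notation nb := (nbs adj).
Notation len := (pos nb n).
Notation wp := (wp inp len M).
Notation fed := (free_edge_deletion G k h).

Hypothesis M_big1 : 20 * (n ^ threshold * (n + 2) ^ 2) + len + 100 < M.
Hypothesis M_big2 : 20 * (n + 2) ^ 6 + k + k < M.
Hypothesis M_big3 : len + n + h + k + k + 10 * ((n + 2) * (n + 2)) + 100 < M.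

Definition main_time t0 T :=
  n <= h /\ T = 0 \/
  h < n /\ (T = 100 * len \/ 1 < h /\ exists t T1, [/\ 0 < t <= t0,
    solver_time adj h t T1 &
    T = T1 + 5000 * len + h.+1 ^ t * (300 * (t.+1 * t.+1))]).

Lemma main_ok t0 : nbh_diversity_le G t0 ->
  wp main_prog (fun s => vr s vAns = fed /\
    exists2 T, main_time t0 T & ck s <= T + 1000) (St (fun=> 0) (fun _ _ => 0) 0).
Proof.
move=> ndG; rewrite /main_prog.
have nl : 3 + n <= len by rewrite pos_sum; lia.
have DE := degree_sum_edges adjG.
have DL : degree_sum n nb <= len by rewrite pos_sum leq_addl.
wps; wps; wps.
apply: wp_if; try okt; simp => Hh; last first.
  wps; rewrite deletion_large //; split=> //.
  by exists 0 => //; left.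
apply: wp_seq.
have M1 : len + n + 10 < M by lia.
refine (wp_conseq (@block1_ok inp len M n nb (@instance_deg n adj k h)
  (erefl _) M1 _ _) _) => /=; first by simp.
move=> s1 [A1 B1] [E1 Hpd C1].
have N1 : vr s1 vN = n by rewrite A1.
have K1 : vr s1 vK = k by rewrite A1.
have H1 : vr s1 vH = h by rewrite A1.
have Q1 : vr s1 vAns = 0 by rewrite A1.
have C1' : ck s1 <= 100 * n + 400 by move: C1 => /=; lia.
rewrite -/(degree_sum n nb) in E1.
have Z1 a i : 2 < a -> ar s1 a i = 0 by move=> ai; rewrite B1 //= !inE; lia.
apply: wp_if; try okt; simp => Hh1.
  have h1 : h = 1 by lia.
  apply: wp_if; try okt; simp => Hm.
    wps; rewrite h1 deletion_one; split; first by rewrite leqNgt; lia.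
    by exists (100 * len); [right; split; rewrite -?h1 //; left|lia].
  wps; rewrite h1 deletion_one; split; first by have -> : #|edges G| <= k by lia.
  by exists (100 * len); [right; split; rewrite -?h1 //; left|lia].
apply: wp_seq.
have M2 : len + 10 * ((n + 2) * (n + 2)) < M by lia.
refine (wp_conseq (@front_ok inp len M n h nb (@instance_nbs n adj k h) (erefl _)
  (nbs_lt (adj := adj)) (nbs_uniq adjG) (nbs_irr adjG) (nbs_sym adjG) Hh M2
  (tick s1 (2 + 1 + 1)) N1 H1 Hpd Z1) _).
move=> s2 [A2 B2] [t [cid [rep [CD T2 L2 T3 C2]]]].
have tt0 : t <= t0.
  by case: CD => _ R1 R2 _ R4; apply: (class_num_le adjG R1 R2 R4 ndG).
refine (wp_conseq (@solve_ok n G adj k h M adjG h_gt0 M_big1 M_big2 M_big3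
  s2 t cid rep Hh CD _ _ _ _ _ T2 _ L2 T3 _) _); rewrite ?A2 //=.
- by move=> u un; rewrite !B2 //; apply: Hpd.
- by move=> a i ai; rewrite B2 ?Z1 //= ?inE; lia.
move=> s3 _ [E3 [T1 HT C3]]; split=> //.
exists (T1 + 5000 * len + h.+1 ^ t * (300 * (t.+1 * t.+1))).
  right; split=> //; right; split; first by lia.
  exists t, T1; split=> //; rewrite tt0 andbT.
  by case: CD => _ _ _ /(_ 0) R3 _; apply: leq_ltn_trans (R3 _); lia.
have tn : t <= n by case: CD.
by move: C2 C3 => /=; set Z := h.+1 ^ t * _; lia.
Qed.

End Whole.

(** * Running time *)

Lemma digit_inj (b : nat -> nat) k l Q : (forall j, j < Q -> 0 < b j) ->
  k < weight b Q -> l < weight b Q ->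
  (forall j, j < Q -> digit b k j = digit b l j) -> k = l.
Proof.
move=> b0 kQ lQ H; rewrite -(modn_small kQ) -(modn_small lQ).
have modS q j : q %% weight b j.+1 = digit b q j * weight b j + q %% weight b j.
  have /eqP := divn_eq q (weight b j.+1).
  rewrite {1}(divn_eq q (weight b j)) weightS divnMA /digit.
  rewrite {1}(divn_eq (q %/ weight b j) (b j)) mulnDl -!addnA.
  by rewrite (mulnC (weight b j)) -mulnA eqn_add2l => /eqP.
elim: Q b0 H {kQ lQ} => [|Q IH] b0 H; first by rewrite /weight big_ord0 !modn1.
by rewrite !modS H // IH // => j jQ; [apply: b0|apply: H]; apply: ltnW.
Qed.

Lemma type_num_le h t : type_num h t <= 'C(h + t, t).
Proof.
rewrite addnC -card_partial_ord_partitions.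
pose f k := [tuple inord (tau h k (i : 'I_t)) : 'I_h.+1 | i < t].
have fE k i : val (tnth (f k) i) = tau h k i.
  rewrite tnth_mktuple; apply: inordK; exact: digit_lt.
have W : weight (fun=> h.+1) t = h.+1 ^ t by rewrite /weight prod_nat_const card_ord.
have f_inj : {in type_list h t &, injective f}.
  move=> k l; rewrite !mem_filter !mem_iota /= !add0n -W.
  move=> /andP[_ kW] /andP[_ lW] E; apply: (digit_inj _ kW lW) => // j jt.
  by rewrite -!/(tau h _ j) -!(fE _ (Ordinal jt)) E.
rewrite /type_num -(size_map f) cardE; apply: uniq_leq_size.
  by rewrite map_inj_in_uniq // filter_uniq // iota_uniq.
move=> x /mapP[k]; rewrite mem_filter => /andP[kV _] ->.
rewrite mem_enum inE big_tuple; apply: leq_trans kV.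
by apply: leq_sum => i _; rewrite fE.
Qed.

Lemma bin_ge_mul h t : h * t + 1 <= 'C(h + t, t).
Proof.
have bin_ge r q : r <= 'C(r + q, q.+1).
  elim: r => [|r IH] //; rewrite addSn binS -addn1 leq_add // bin_gt0 leq_addl //.
elim: t => [|t IH]; first by rewrite muln0 bin0.
by rewrite (addnS h) binS mulnS -addnA leq_add.
Qed.

Lemma bin_ge_square h t : 1 < h -> t * t <= 2 * 'C(h + t, t).
Proof.
move=> h1; have : 'C(t + 2, t) <= 'C(h + t, t) by apply: leq_bin2l; lia.
rewrite -bin_sub ?leq_addr // addKn addn2 bin2 -[_.-1]/(t.+1); set p := 'C(_, _).
have := odd_double_half (t.+2 * t.+1).
by move: (_./2) => q; case: odd; lia.
Qed.

Lemma expn_absorb c : exists K, forall p, 2 ^ (c * p) <= K * p ^ p.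
Proof.
exists (2 ^ (c * 2 ^ c)) => p; case: (leqP (2 ^ c) p) => [cp|pc].
  rewrite expnM; apply: (@leq_trans (p ^ p)); first by rewrite leq_exp2r // (leq_trans _ cp) // expn_gt0.
  by rewrite leq_pmull // expn_gt0.
case: (posnP p) => [->|p0]; first by rewrite muln0 expn0 muln1 expn_gt0.
apply: (@leq_trans (2 ^ (c * 2 ^ c))); first by rewrite leq_pexp2l // leq_mul2l ltnW ?orbT.
by rewrite leq_pmulr // expn_gt0 p0.
Qed.

Section SolverTime.
Variables (n h t : nat) (adj : 'I_n -> seq 'I_n).
Hypothesis h_gt1 : 1 < h.
Hypothesis h_lt : h < n.
Hypothesis t_gt0 : 0 < t.
Let p := 'C(h + t, t).

(* The 48th power removes the fractional exponent [t ^ 2 / 24] and the factor 5/2. *)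
Definition tame X := X ^ 48 <= 2 ^ (5000 * p) * p ^ (100 * p).

Let htp : h * t + 1 <= p. Proof. exact: bin_ge_mul. Qed.
Let hp : h < p. Proof. by apply: leq_trans htp; rewrite addn1 ltnS leq_pmulr. Qed.
Let tp : t < p. Proof. by apply: leq_trans htp; rewrite addn1 ltnS leq_pmull //; lia. Qed.
Let t96 : 96 * t <= 24 * p + 768.
Proof.
have := bin_ge_square t h_gt1; rewrite -/p.
have : 8 * t <= t * t + 64; last by lia.
case: (leqP 8 t) => t8; last by lia.
by apply: (@leq_trans (t * t)); rewrite ?leq_addr // leq_mul2r t8 orbT.
Qed.
Let p2 : p < 2 ^ p. Proof. exact: ltn_expl. Qed.
Let h2 : h.+1 ^ t <= 2 ^ p.
Proof.
apply: (@leq_trans ((2 ^ h) ^ t)).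
  by case: t t_gt0 => // t' _; rewrite leq_exp2r //; exact: ltn_expl.
by rewrite -expnM leq_pexp2l //; lia.
Qed.

Lemma tame_le X a : X <= 2 ^ (a * p) * p ^ p -> a <= 100 -> tame X.
Proof.
move=> HX a100; rewrite /tame.
apply: (@leq_trans ((2 ^ (a * p) * p ^ p) ^ 48)); first by rewrite leq_exp2r.
rewrite expnMn -!expnM leq_mul //; first by rewrite leq_pexp2l // mulnAC leq_mul2r; lia.
by rewrite leq_pexp2l; lia.
Qed.

Lemma p_le_expn a : p ^ a <= 2 ^ (a * p).
Proof. by case: a => // a; rewrite mulnC expnM leq_exp2r //; apply: ltnW. Qed.

Lemma num_le_expn a : 2 ^ a <= 2 ^ (a * p).
Proof. by rewrite leq_pexp2l // leq_pmulr //; lia. Qed.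

Lemma types_tame : tame (h.+1 ^ t * (t.+1 * t.+1)).
Proof.
apply: (@tame_le _ 3) => //; apply: (@leq_trans (2 ^ p * p ^ 2)).
  by rewrite leq_mul // leq_mul.
rewrite -[leqLHS]muln1 leq_mul ?expn_gt0 //; last by lia.
by rewrite mulSn expnD leq_mul // p_le_expn.
Qed.

Lemma brute_tame : n < type_num h t -> pos (nbs adj) n <= 3 + n * n ->
  tame (brute_time adj).
Proof.
move=> nP len_le; have np : n < p := leq_trans nP (type_num_le h t).
have n0 : 0 < n by lia.
rewrite /brute_time; set len := pos _ _ in len_le *.
have nn : n ^ n <= p ^ p.
  by apply: (@leq_trans (p ^ n)); [rewrite leq_exp2r // ltnW|rewrite leq_pexp2l //; lia].
have n1 : 1 <= n ^ n by rewrite expn_gt0 n0.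
apply: (@tame_le _ 16) => //.
apply: (@leq_trans (2 ^ 14 * p ^ 2 * n ^ n)).
  have np2 : n * n <= p * p by apply: leq_mul; apply: ltnW.
  have pp : 2 * p <= p * p by rewrite leq_mul2r; lia.
  have Y : 1000 * (len + n * n + 1) + 1000 * len <= 2 ^ 14 * p ^ 2.
    by rewrite -mulnn; lia.
  apply: leq_trans (leq_mul Y (leqnn (n ^ n))).
  by rewrite mulnDl mulnC leq_add2l leq_pmulr.
rewrite leq_mul // (_ : 16 * p = 14 * p + 2 * p); last by lia.
by rewrite expnD leq_mul // ?num_le_expn ?p_le_expn.
Qed.

Lemma dp_tame P : 0 < P -> P <= p ->
  exists2 X, dp_time n h t P <= (trunc_log 2 n).+1 * X & tame X.
Proof.
move=> P0 Pp; set S := tabsize P t h.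
have S0 : 0 < S by rewrite expn_gt0.
have S1 : S <= 2 ^ (2 * p) * p ^ p.
  apply: (@leq_trans ((2 * p * h.+1) ^ t)).
    rewrite /S /tabsize leq_exp2r // /dbase /carry_max.
    have : P * h <= p * h by rewrite leq_mul2r Pp orbT.
    by lia.
  rewrite !expnMn mul2n -addnn expnD -mulnA -mulnA leq_mul //.
    by rewrite leq_pexp2l // ltnW.
  rewrite mulnC leq_mul // leq_pexp2l //; [by lia|exact: ltnW].
exists (2 ^ 14 * (p * S)).
  rewrite /dp_time; set L := (trunc_log 2 n).+1.
  have L0 : 0 < L by [].
  have PS : P * S <= p * S by rewrite leq_mul2r Pp orbT.
  have pS : p <= p * S by rewrite leq_pmulr.
  have SpS : S <= p * S by rewrite leq_pmull //; lia.
  have St : t <= S by apply/ltnW/(leq_trans (ltn_expl t (ltnSn 1))); rewrite leq_exp2r.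
  have Pt : P * t <= p * S by apply: leq_mul.
  have LX : p * S <= L * (p * S) by rewrite leq_pmull.
  rewrite (_ : (P + 1) * (S + 1) = P * S + P + S + 1); last by lia.
  rewrite (_ : (P + 1) * (S + t + 1) = P * S + P * t + P + S + t + 1); last by lia.
  apply: (@leq_trans (L * (5000 * (p * S)) + L * (1000 * (6 * (p * S))))).
    by apply: leq_add; [rewrite leq_mul2l|rewrite -[leqLHS]mul1n leq_mul //]; lia.
  by rewrite -mulnDr leq_mul2l; lia.
apply: (@tame_le _ 17) => //.
rewrite (_ : 17 * p = 14 * p + (p + 2 * p)); last by lia.
rewrite (expnD 2 (14 * p)) (expnD 2 p) -(mulnA (2 ^ (14 * p))); apply: leq_mul; first exact: num_le_expn.
by rewrite -(mulnA (2 ^ p)); apply: leq_mul => //; apply: ltnW.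
Qed.

Lemma search_tame P : 0 < P -> P <= p -> n ^ threshold < dbase P h ^ t ->
  tame (search_time n h t P).
Proof.
move=> P0 Pp nD; rewrite /search_time.
have n0 : 0 < n by lia.
have p0 : 0 < p by lia.
have Dp : dbase P h <= 2 * (p * p).
  have : P * h <= p * p.-1 by apply: leq_mul; lia.
  by rewrite /dbase /carry_max -{2 4}(prednK p0); lia.
have N1 : n.+1 ^ (2 * t) <= 2 ^ (2 * p) * n ^ (2 * t).
  apply: (@leq_trans ((2 * n) ^ (2 * t))); first by rewrite leq_exp2r; lia.
  by rewrite expnMn leq_mul2r leq_pexp2l ?orbT //; lia.
have A1 : (2 * t * h).+1 ^ P <= 2 ^ p * p ^ p.
  by rewrite -expnMn; apply: (@leq_trans ((2 * p) ^ P));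
    [rewrite leq_exp2r|rewrite leq_pexp2l]; lia.
have A2 : P ^ (2 * t) <= p ^ (2 * t) by rewrite leq_exp2r; lia.
have A3 : 2000 * ((t + 1) * (P + 2 * t + 1)) + 200 * (P + 2 * t + 1) <= 2 ^ 14 * p ^ 2.
  have : (t + 1) * (P + 2 * t + 1) <= p * (4 * p) by apply: leq_mul; lia.
  have : p * 1 <= p * p by rewrite leq_mul2l; lia.
  by rewrite -mulnn; lia.
have n48 : (n ^ (2 * t)) ^ 48 <= 2 ^ (4 * p) * p ^ (8 * p).
  have -> : (n ^ (2 * t)) ^ 48 = (n ^ threshold) ^ (2 * t) by rewrite -!expnM mulnC.
  apply: (@leq_trans ((dbase P h ^ t) ^ (2 * t))); first by rewrite leq_exp2r ?muln_gt0 // ltnW.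
  rewrite -expnM; move: nD => _; apply: (@leq_trans ((2 * (p * p)) ^ (t * (2 * t)))).
    by rewrite leq_exp2r //; lia.
  apply: (@leq_trans ((2 * (p * p)) ^ (4 * p))).
    rewrite leq_pexp2l ?muln_gt0 ?p0 // (mulnC 2) mulnA.
    by have := bin_ge_square t h_gt1; rewrite -/p; lia.
  by rewrite expnMn mulnn -expnM mulnA.
have pt : (p ^ (2 * t)) ^ 48 <= p ^ (24 * p) * 2 ^ (768 * p).
  rewrite -expnM; apply: (@leq_trans (p ^ (24 * p + 768))).
    by rewrite leq_pexp2l //; lia.
  by rewrite expnD leq_mul // p_le_expn.
set Y := 2 ^ p * p ^ p * p ^ (2 * t) * (2 ^ (2 * p) * n ^ (2 * t)) * (2 ^ 14 * p ^ 2).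
apply: (@leq_trans (Y ^ 48)).
  rewrite leq_exp2r //; set W := _ ^ P * _ * _; apply: (@leq_trans (W * (2 ^ 14 * p ^ 2))).
    apply: leq_trans (leq_mul (leqnn W) A3); rewrite (mulnDr W) leq_add2l leq_pmull //.
    by rewrite !muln_gt0 !expn_gt0 P0.
  by rewrite leq_mul // leq_mul // leq_mul.
have Z : 2 ^ 14 * p ^ 2 <= 2 ^ (16 * p).
  rewrite (_ : 16 * p = 14 * p + 2 * p); last by lia.
  by rewrite expnD; apply: leq_mul; [exact: num_le_expn|exact: p_le_expn].
rewrite /Y; move: n48 pt; move: (n ^ (2 * t)) (p ^ (2 * t)) => U V n48 pt.
apply: (@leq_trans ((2 ^ p * p ^ p * 2 ^ (2 * p) * 2 ^ (16 * p)) ^ 48 * (V ^ 48 * U ^ 48))).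
  rewrite -(expnMn V U) -(expnMn _ (V * U)) leq_exp2r //.
  apply: (@leq_trans (2 ^ p * p ^ p * V * (2 ^ (2 * p) * U) * 2 ^ (16 * p))).
    by rewrite leq_mul2l Z orbT.
  move: (2 ^ p) (p ^ p) (2 ^ (2 * p)) (2 ^ (16 * p)); clear=> a b c d; lia.
apply: (@leq_trans ((2 ^ (19 * p) * p ^ p) ^ 48 *
  (p ^ (24 * p) * 2 ^ (768 * p) * (2 ^ (4 * p) * p ^ (8 * p))))).
  apply: leq_mul; last exact: leq_mul.
  rewrite leq_exp2r // (_ : 19 * p = p + 2 * p + 16 * p); last by lia.
  by rewrite expnD (expnD 2 p); move: (2 ^ p) (p ^ p) (2 ^ (2 * p)) (2 ^ (16 * p)); clear=> a b c d; lia.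
rewrite expnMn -!expnM.
apply: (@leq_trans (2 ^ (19 * p * 48 + 768 * p + 4 * p) * p ^ (p * 48 + 24 * p + 8 * p))).
  rewrite !(expnD 2 (19 * p * 48 + 768 * p)) (expnD 2 (19 * p * 48)).
  rewrite (expnD p (p * 48 + 24 * p)) (expnD p (p * 48)).
  move: (2 ^ _) (p ^ (p * 48)) (2 ^ (768 * p)) (2 ^ (4 * p)) (p ^ (24 * p)) (p ^ (8 * p)) ; clear=> a b c d e f; lia.
clear Y n48 pt nD N1 A1 A2 A3 Z.
by apply: leq_mul; rewrite leq_pexp2l //; lia.
Qed.

End SolverTime.

Lemma type_num_gt0 h t : 0 < type_num h t.
Proof.
have [|q qP _] := @type_index h t (fun=> 0); first by rewrite big1.
exact: leq_ltn_trans qP.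
Qed.

Lemma pos_nbs_le n (G : sgraph 'I_n) (adj : 'I_n -> seq 'I_n) :
  adjacency_lists G adj -> pos (nbs adj) n <= 3 + n * n.
Proof.
move=> adjG; rewrite /pos leq_add2l -[X in X * n]card_ord -sum_nat_const.
apply: leq_sum => u _; rewrite -[leqRHS](size_iota 0).
apply: (@uniq_leq_size _ (val u :: nbs adj u)).
  by rewrite /= (nbs_irr adjG) //= (nbs_uniq adjG).
move=> v; rewrite inE mem_iota => /orP[/eqP->|/(nbs_lt (ltn_ord u))] //.
exact: ltn_ord.
Qed.

Definition log_time n := (trunc_log 2 n).+1.

Lemma solver_time_le n (G : sgraph 'I_n) (adj : 'I_n -> seq 'I_n) h t T :
  adjacency_lists G adj -> 1 < h -> h < n -> 0 < t -> solver_time adj h t T ->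
  exists2 X, T <= log_time n * X & tame h t X.
Proof.
move=> adjG h1 hn t0; have tpP := type_num_le h t; have P0 := type_num_gt0 h t.
case=> [[nP ->]|[Pn nD ->]|[Pn ->]]; last exact: dp_tame.
  exists (brute_time adj); first by rewrite leq_pmull.
  by apply: brute_tame => //; apply: pos_nbs_le adjG.
exists (search_time n h t (type_num h t)); first by rewrite leq_pmull.
exact: search_tame.
Qed.

Lemma tame_mono c : exists K, forall h t t0 X, t <= t0 ->
  X ^ 48 <= 2 ^ (c * 'C(h + t, t)) * 'C(h + t, t) ^ (100 * 'C(h + t, t)) ->
  X ^ 48 <= K * 'C(h + t0, t0) ^ (120 * 'C(h + t0, t0)).
Proof.
have [K HK] := expn_absorb c; exists K => h t t0 X tt0.
have pq : 'C(h + t, t) <= 'C(h + t0, t0).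
  rewrite -(@bin_sub (h + t)) ?leq_addl // -(@bin_sub (h + t0)) ?leq_addl //.
  by rewrite !addnK leq_bin2l // leq_add2l.
have p0 : 0 < 'C(h + t, t) by rewrite bin_gt0 leq_addl.
move: pq p0; move: 'C(h + t, t) 'C(h + t0, t0) => p q pq p0 HX.
apply: leq_trans HX _; apply: (@leq_trans (K * p ^ p * p ^ (100 * p))).
  by rewrite leq_mul2r HK orbT.
rewrite -mulnA -expnD leq_mul2l; apply/orP; right.
apply: (@leq_trans (p ^ (120 * q))); first by rewrite leq_pexp2l //; lia.
by rewrite leq_exp2r ?muln_gt0 ?(leq_trans p0 pq).
Qed.

Lemma main_time_le : exists K, forall n (G : sgraph 'I_n) (adj : 'I_n -> seq 'I_n)
    h t0 T, adjacency_lists G adj -> main_time adj h t0 T ->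
  T <= 5000 * pos (nbs adj) n \/
  [/\ 1 < n, 0 < t0 & exists2 X, T <= 5000 * pos (nbs adj) n + 301 * (log_time n * X) &
    X ^ 48 <= K * 'C(h + t0, t0) ^ (120 * 'C(h + t0, t0))].
Proof.
have [K HK] := tame_mono 5000; exists K => n G adj h t0 T adjG.
case=> [[_ ->]|[hn [->|[h1 [t [T1 [/andP[t1 tt0] HT1 ->]]]]]]]; [by left|by left; lia|].
right; split; [by lia|by lia|].
have [X1 T1X X1t] := solver_time_le adjG h1 hn t1 HT1.
have X2t := types_tame h1 hn t1; set X2 := h.+1 ^ t * _ in X2t.
exists (maxn X1 X2).
  rewrite (_ : h.+1 ^ t * (300 * (t.+1 * t.+1)) = 300 * X2); last by rewrite /X2; lia.
  have L1 : X2 <= log_time n * maxn X1 X2.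
    by rewrite -[leqLHS]mul1n; apply: leq_mul => //; apply: leq_maxr.
  have L2 : T1 <= log_time n * maxn X1 X2.
    by apply: leq_trans T1X _; rewrite leq_mul2l leq_maxl orbT.
  by move: L1 L2; set Y := log_time n * _; lia.
apply: (HK h t t0 _ tt0); rewrite -/(tame h t _) /maxn; by case: ifP.
Qed.

Definition prologue : program :=
  [:: Const (tmp 0) 0; Read (tmp 0) (tmp 0); Mul nvars (tmp 0) (tmp 0);
      Const (tmp 0) 3; Add nvars nvars (tmp 0)].

Definition epilogue l : program :=
  [:: Const (tmp 0) 0; JumpLt (tmp 0) vAns (l + 3); Answer false; Answer true].

Definition solver : program :=
  prologue ++ ccmd 5 main_prog ++ epilogue (5 + csz main_prog).

Lemma prologue_steps w x Q : steps w (prologue ++ Q) 5 (init x)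
  (foldl (fun c i => exec w i c) (init x) prologue).
Proof. by []. Qed.

Lemma run_answer w P c b : onth P (pc c) = Some (Answer b) -> run w P 1 c = Some b.
Proof. by rewrite /= => ->. Qed.

Lemma main_prog_wf : wfc main_prog.
Proof. by []. Qed.

Section Run.
Variables (n : nat) (G : sgraph 'I_n) (adj : 'I_n -> seq 'I_n).
Variables (k h w : nat).
Hypothesis adjG : adjacency_lists G adj.
Hypothesis h_gt0 : 0 < h.
Let N := n + #|edges G| + k + h + 2.
Let M := 400 * N ^ 50.
Let base := n * n + 3.
Notation inp := (nth 0 (instance adj k h)).
Notation len := (pos (nbs adj) n).

Lemma instance_le i : inp i <= n + k + h.
Proof.
case: (ltnP i (size (instance adj k h))) => Hi; last by rewrite nth_default.
have : inp i \in instance adj k h by apply: mem_nth.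
move: (inp i) => x {i Hi}; rewrite instanceE mem_cat !inE => /orP[|/flattenP[r /mapP[u]]]; first by lia.
rewrite mem_iota /= add0n => un -> Hr.
suff : x <= n by lia.
move: Hr; rewrite inE => /orP[/eqP->|/(nbs_lt un)/ltnW] //.
rewrite -[leqRHS](size_iota 0); apply: uniq_leq_size; first exact: (nbs_uniq adjG).
by move=> v /(nbs_lt un); rewrite mem_iota.
Qed.

Lemma len_edges : len = 3 + n + 2 * #|edges G|.
Proof. by rewrite pos_sum -(degree_sum_edges adjG). Qed.

Hypothesis w_ok : word_size_ok 64 w n #|edges G| k h.

Lemma word_big : base + (M * narrs + narrs) <= 2 ^ w.
Proof.
apply: leq_trans w_ok; rewrite -addn2 -/N.
have N2 : 1 < N by rewrite /N; lia.
have -> : 64 = 14 + 50 by [].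
rewrite expnD; apply: (@leq_trans (2 ^ 14 * N ^ 50)); last by rewrite leq_mul2r leq_exp2r // N2 orbT.
have N1 : N ^ 2 <= N ^ 50 by rewrite leq_pexp2l //; lia.
have n1 : n * n <= N ^ 2 by rewrite -mulnn /N; apply: leq_mul; lia.
have n2 : 2 ^ 2 <= N ^ 2 by rewrite leq_exp2r.
by move: N1 n1 n2; rewrite /M /base /narrs; move: (N ^ 50) (N ^ 2) => X Y; lia.
Qed.

Lemma M_bounds : [/\ 20 * (n ^ threshold * (n + 2) ^ 2) + len + 100 < M,
  20 * (n + 2) ^ 6 + k + k < M &
  len + n + h + k + k + 10 * ((n + 2) * (n + 2)) + 100 < M].
Proof.
have N2 : 1 < N by rewrite /N; lia.
have lN : len + n + h + k + k <= 3 + 3 * N by rewrite len_edges /N; lia.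
have N50 a : a <= 50 -> N ^ a <= N ^ 50 by move=> a50; rewrite leq_pexp2l //; lia.
have n2N : n + 2 <= N by rewrite /N; lia.
have X1 : n ^ threshold * (n + 2) ^ 2 <= N ^ 50.
  rewrite (_ : 50 = threshold + 2) // expnD leq_mul // leq_exp2r //.
  by apply: leq_trans n2N; rewrite leq_addr.
have X2 : (n + 2) ^ 6 <= N ^ 50.
  by apply: leq_trans (N50 6 isT); rewrite leq_exp2r.
have X3 : (n + 2) * (n + 2) <= N ^ 50.
  by apply: leq_trans (N50 2 isT); rewrite -mulnn leq_mul.
have X4 : N <= N ^ 50 by apply: leq_trans (N50 1 isT); rewrite expn1.
rewrite /M; move: lN X1 X2 X3 X4 N2; move: (N ^ 50) (n ^ _ * _) ((n + 2) ^ 6) ((n + 2) * (n + 2)).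
move: N len; clear=> m l X Y Z T *; split; lia.
Qed.

Lemma prologue_matches : matches w inp len base (St (fun=> 0) (fun _ _ => 0) 0)
  (foldl (fun c i => exec w i c) (init (instance adj k h)) prologue).
Proof.
have W := word_big; have w0 : 0 < 2 ^ w by rewrite expn_gt0.
have m0 v : v %% 2 ^ w < 2 ^ w by rewrite ltn_mod.
have mem_lt i : inp i < 2 ^ w.
  apply: leq_ltn_trans (instance_le i) _; have [_ _ B3] := M_bounds.
  move: W B3; rewrite /narrs; move: (M) (base) (2 ^ w) (len) ((n + 2) * (n + 2)).
  by clear=> *; lia.
have b0 : base < 2 ^ w.
  move: W; rewrite /narrs; move: (M) (base) (2 ^ w); clear=> *; lia.
split=> //=.
- by move=> x xn; rewrite /upd !ltn_eqF // /tmp; lia.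
- rewrite /upd /= /base !mod0n (modn_small (mem_lt 0)) /=.
  rewrite (@modn_small 3) ?(@modn_small (n * n)) ?modn_small //;
    by move: b0; rewrite /base; move: (2 ^ w); clear=> *; lia.
- by move=> r; rewrite /upd; do ?case: ifP => // _.
split=> // a i an; rewrite nth_default // size_instance.
by apply: leq_trans (pos_nbs_le adjG) _; rewrite /base; lia.
Qed.

Lemma solver_ok t0 : nbh_diversity_le G t0 ->
  exists2 T, main_time adj h t0 T & exists2 s, s <= T + 1010 &
  run w solver s (init (instance adj k h)) = Some (free_edge_deletion G k h).
Proof.
move=> ndG; have [B1 B2 B3] := M_bounds; have W := word_big.
have [s1 [S1 [E1 [T HT C1]]]] := main_ok adjG h_gt0 B1 B2 B3 ndG.
exists T => //.
have L : len <= base by apply: leq_trans (pos_nbs_le adjG) _; rewrite /base; lia.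
have C0 : code_at solver 0 solver by [].
have C2 := code_atR C0; have C3 := code_atR C2.
have [c [R1 R2 pc1]] := ccmd_ok L W S1 prologue_matches (erefl _) (code_atL C2) main_prog_wf.
move: C3; rewrite size_ccmd -pc1 => C3.
have [|c2 [R3 R4 pc2 V2 F2]] := step_tmp L W (v := 0) (code_at0 C3) (erefl _) R2.
  by rewrite /= mod0n.
move: (code_atS C3); rewrite -pc2 => C4.
exists (5 + ((ck s1 - 0) + (1 + (1 + 1)))); first by move: C1; rewrite subn0; clear; lia.
rewrite /solver prologue_steps -/solver R1 R3.
have A4 : registers c2 vAns = free_edge_deletion G k h by case: R4 => H _ _ _ _; rewrite (H 4 isT).
rewrite (steps1 w (code_at0 C4) isT); apply: run_answer.
have -> : pc (exec w (JumpLt (tmp 0) vAns (pc c + 3)) c2) =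
    if free_edge_deletion G k h then (pc c2).+2 else (pc c2).+1.
  by move: V2 A4 pc2; case: (c2) => l r m /= -> -> ->; case: free_edge_deletion; rewrite // !addnS addn0.
case: free_edge_deletion; last exact: code_at0 (code_atS C4).
exact: code_at0 (code_atS (code_atS C4)).
Qed.

End Run.

Local Open Scope classical_set_scope.
Local Open Scope ring_scope.

Lemma zero_littleo (R : realType) :
  (fun=> 0 : R) =o_\oo (fun p : nat => p%:R : R).
Proof.
by apply/eqoP => e e0; near=> p; rewrite normr0 mulr_ge0 // ltW.
Unshelve. all: by end_near. Qed.

Lemma ln_ge_half (R : realType) n : (1 < n)%N -> 1 / 2 <= ln (n%:R : R).
Proof.
move=> n1; apply: (@le_trans _ _ (ln (2 : R))); last first.
  by rewrite ler_ln ?posrE ?ltr0n ?ler_nat // ltnW.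
rewrite [X in ln X](_ : 2 = (1 + - (1 / 2))^-1); last by field.
rewrite lnV ?posrE; last by lra.
by rewrite lerNr; apply: le_ln1Dx; lra.
Qed.

Lemma log_time_le (R : realType) n : (1 < n)%N ->
  (log_time n)%:R <= 8 * (ln (n%:R : R)) ^+ 2.
Proof.
move=> n1; have H := @ln_ge_half R n n1; have H2 := @ln_ge_half R 2 isT.
have n0 : (0 < n)%N by apply: ltnW.
have : (trunc_log 2 n)%:R * ln (2 : R) <= ln (n%:R : R).
  rewrite mulr_natl -lnXn // ler_ln ?posrE ?exprn_gt0 ?ltr0n //.
  by rewrite -natrX ler_nat; apply: trunc_logP.
rewrite /log_time -natr1; set x := ln n%:R in H *; set y := ln 2 in H2 *.
set a := _%:R => K; have a0 : 0 <= a by apply: ler0n.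
have : a * (1 / 2) <= x by apply: le_trans K; rewrite ler_wpM2l.
by rewrite expr2; nra.
Qed.

Lemma tame_le_powR (R : realType) (X K p : nat) : (0 < p)%N ->
  (X ^ 48 <= K * p ^ (120 * p))%N ->
  X%:R <= K%:R * p%:R `^ (5 / 2 * p%:R + 0) :> R.
Proof.
move=> p0 H; have [K0|K0] := posnP K.
  by move: H; rewrite K0 mul0n mul0r leqn0 expn_eq0 andbT => /eqP->.
rewrite -(@ler_pXn2r _ 48) ?nnegrE ?mulr_ge0 ?powR_ge0 // exprMn.
have -> : (p%:R `^ (5 / 2 * p%:R + 0)) ^+ 48 = (p ^ (120 * p))%:R :> R.
  rewrite -powR_mulrn ?powR_ge0 // -powRrM natrX -powR_mulrn ?ler0n //.
  by congr (_ `^ _); rewrite natrM addr0; field.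
rewrite -!natrX -natrM ler_nat; apply: leq_trans H _.
by rewrite leq_mul2r -{1}(expn1 K) leq_pexp2l ?orbT.
Qed.

Lemma time_arith (R : realType) (a c d K F L S T l Y : R) :
  0 <= a -> 0 <= c -> 0 <= d -> 0 <= K -> 0 <= F -> 0 <= L -> 1 <= S ->
  l <= 5 * S -> Y <= 8 * (K * F) * L -> T <= a * l + d * Y ->
  T + c <= (a * 5 + c + d * 8 * K) * (F * L + S).
Proof.
move=> a0 c0 d0 K0 F0 L0 S1 lS YF HT; have S0 := le_trans ler01 S1.
have al := ler_wpM2l a0 lS; have dY := ler_wpM2l d0 YF; have cS := ler_wpM2l c0 S1.
have FL := mulr_ge0 F0 L0; have aFL := mulr_ge0 a0 FL; have cFL := mulr_ge0 c0 FL.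
have dKS := mulr_ge0 (mulr_ge0 d0 K0) S0.
move: HT al dY cS aFL cFL dKS; clear; lra.
Qed.

Theorem theorem4 (R : realType) :
  exists (P : program) (c : nat) (C : R) (g : nat -> R),
    g =o_\oo (fun p : nat => p%:R : R) /\
    forall (n : nat) (G : sgraph 'I_n) (adj : 'I_n -> seq 'I_n)
           (k h t w : nat),
      (0 < k)%N -> (0 < h)%N ->
      nbh_diversity_le G t ->
      adjacency_lists G adj ->
      word_size_ok c w n #|edges G| k h ->
      exists s : nat,
        run w P s (init (instance adj k h)) =
          Some (free_edge_deletion G k h) /\
        ((0 < n)%N ->
         s%:R <= C * (fpt_factor g t h * (ln n%:R) ^+ 2
                      + n%:R + #|edges G|%:R)).
Proof.
have [K HK] := main_time_le.
exists solver, 64, (5000%:R * 5 + 1010%:R + 301%:R * 8 * K%:R), (fun=> 0); split.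
  exact: zero_littleo.
move=> n G adj k h t w _ h0 ndG adjG w_ok.
have [T HT [s sT Hs]] := solver_ok adjG h0 w_ok ndG.
exists s; split=> // n0.
apply: (@le_trans _ _ (T%:R + 1010%:R)); first by rewrite -natrD ler_nat.
set F := fpt_factor _ _ _; set L := _ ^+ 2; rewrite -(addrA (F * L)).
have F0 : 0 <= F by rewrite mulr_ge0 // powR_ge0.
have L0 : 0 <= L by apply: sqr_ge0.
have [Y TY YF] : exists2 Y : R, T%:R <= 5000%:R * (pos (nbs adj) n)%:R + 301%:R * Y &
    Y <= 8 * (K%:R * F) * L.
  have [TL|[n2 t0 [X TX XK]]] := HK _ _ _ _ _ _ adjG HT.
    exists 0; last by apply: mulr_ge0 => //; apply: mulr_ge0 => //; apply: mulr_ge0.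
    by rewrite mulr0 addr0 -natrM ler_nat.
  exists (log_time n * X)%:R; first by rewrite -!natrM -natrD ler_nat.
  rewrite natrM mulrAC ler_pM // ?log_time_le //.
  apply: le_trans (tame_le_powR _ _ XK) _; first by rewrite bin_gt0 leq_addl.
  by rewrite ler_wpM2l // /F /fpt_factor ler_peMl ?powR_ge0 // ler1n.
apply: (time_arith (ler0n _ _) (ler0n _ _) (ler0n _ _) (ler0n _ _) F0 L0 _ _ YF TY);
  first by rewrite -natrD ler1n addn_gt0 n0.
rewrite -natrD -natrM ler_nat (len_edges adjG); move: n0; clear; lia.
Qed.
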